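(* Let $N\ge 2$ and $1^*=N/(N-1)$. Let $f:\mathbb{R}\to\mathbb{R}$ satisfy: $(f_1)$ $f\in C^1(\mathbb{R})$; $(f_2)$ $f(s)=o(1)$ as $s\to 0$; $(f_3)$ there exist $c_1,c_2>0$ and $p\in[1,1^* )$ with $|f(s)|\le c_1+c_2|s|^{p-1}$ for all $s\in\mathbb{R}$; $(f_4)$ there exists $\theta>1$ with $0<\theta F(s)\le f(s)s$ for all $s\neq 0$, where $F(s)=\int_0^s f(t)\,dt$; $(f_5)$ $f$ is increasing. Let $V:\mathbb{R}^N\to\mathbb{R}$ satisfy: $(V_1)$ $V\in L^\infty(\mathbb{R}^N)$ and $V_0:=\inf_{\mathbb{R}^N}V>0$; $(V_3)$ $V\in C(\mathbb{R}^N)$, $\lim_{|x|\to+\infty}V(x)=V_\infty$ for some $V_\infty\in\mathbb{R}$, and $V\le V_\infty$ in $\mathbb{R}^N$. Then for every $\epsilon>0$ the problem $$-\epsilon\Delta_1 u+V(x)\frac{u}{|u|}=f(u)\ \text{in }\mathbb{R}^N,\qquad u\in BV(\mathbb{R}^N),$$ has a nontrivial bounded variation solution $u_\epsilon$.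
   Context: $BV(\mathbb{R}^N)$ is the space of $u\in L^1(\mathbb{R}^N)$ whose distributional gradient $Du$ is a finite vector Radon measure, with total variation $\int_{\mathbb{R}^N}|Du|$. For $\epsilon>0$, a function $u\in BV(\mathbb{R}^N)$ is called a bounded variation solution of the problem $-\epsilon\Delta_1 u+V(x)\frac{u}{|u|}=f(u)$ if, writing $\|w\|_{*}:=\epsilon\int_{\mathbb{R}^N}|Dw|+\int_{\mathbb{R}^N}V(x)|w|\,dx$, $$\|w\|_{*}-\|u\|_{*}\ge\int_{\mathbb{R}^N}f(u)(w-u)\,dx\quad\text{for all }w\in BV(\mathbb{R}^N).$$ *)

(* Defs.v *)
From HB Require Import structures.
From mathcomp Require Import all_boot all_order all_algebra.
From mathcomp Require Import all_classical all_reals all_analysis.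
Set Implicit Arguments. Unset Strict Implicit. Unset Printing Implicit Defensive.
Import Order.TTheory GRing.Theory Num.Theory.
Import numFieldNormedType.Exports.
Local Open Scope classical_set_scope.
Local Open Scope ring_scope.

Section BVdefs.
Variable R : realType.

Definition row_cons (n : nat) (x : R) (y : 'rV[R]_n) : 'rV[R]_n.+1 :=
  \row_(i < n.+1) match unlift ord0 i with Some j => y 0 j | None => x end.

(* N-dimensional Lebesgue integral, as the iterated one-dimensional
   Lebesgue integrals (Fubini–Tonelli); extended-real valued. *)
Fixpoint iint (n : nat) : ('rV[R]_n -> \bar R) -> \bar R :=
  match n with
  | 0 => fun g => g 0
  | n'.+1 => fun g =>
      (\int[@lebesgue_measure R]_x iint (fun y => g (row_cons x y)))%E
  end.

(* coordinates: identification of n.-tuple R (measurable, product sigma-algebra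
   = Borel sets of R^n) with 'rV[R]_n *)
Definition rv_of_tuple (n : nat) (t : n.-tuple R) : 'rV[R]_n := \row_i tnth t i.

Definition measurableN (n : nat) (g : 'rV[R]_n -> R) : Prop :=
  measurable_fun [set: n.-tuple R] (g \o @rv_of_tuple n).

Definition L1 (n : nat) (g : 'rV[R]_n -> R) : Prop :=
  measurableN g /\ (iint (fun x => (`|g x|)%:E) < +oo)%E.

Definition enorm (n : nat) (x : 'rV[R]_n) : R := Num.sqrt (\sum_i x 0 i ^+ 2).

Definition ebasis (n : nat) (i : 'I_n) : 'rV[R]_n := delta_mx 0 i.

Definition C1N (n : nat) (phi : 'rV[R]_n -> R) : Prop :=
  forall j : 'I_n, (forall x, derivable phi x (ebasis j)) /\
                   continuous (fun x => 'D_(ebasis j) phi x).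

Definition test_field (n : nat) (phi : 'I_n -> 'rV[R]_n -> R) : Prop :=
  (forall i, C1N (phi i)) /\
  compact (closure [set x | exists i, phi i x != 0]) /\
  (forall x, enorm (\row_i phi i x) <= 1).

Definition divergence (n : nat) (phi : 'I_n -> 'rV[R]_n -> R) (x : 'rV[R]_n) : R :=
  \sum_i 'D_(ebasis i) (phi i) x.

Definition total_variation (n : nat) (u : 'rV[R]_n -> R) : \bar R :=
  ereal_sup [set r | exists phi, test_field phi /\
                       r = iint (fun x => (u x * divergence phi x)%:E)].

Definition BV (n : nat) (u : 'rV[R]_n -> R) : Prop :=
  L1 u /\ (total_variation u < +oo)%E.

Definition norm_star (n : nat) (eps : R) (V : 'rV[R]_n -> R) (w : 'rV[R]_n -> R)
  : \bar R :=
  (eps%:E * total_variation w + iint (fun x => (V x * `|w x|)%:E))%E.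

(* bounded variation solution of -eps Delta_1 u + V u/|u| = f(u) *)
Definition BV_solution (n : nat) (eps : R) (V : 'rV[R]_n -> R) (f : R -> R)
  (u : 'rV[R]_n -> R) : Prop :=
  BV u /\
  forall w, BV w ->
    (norm_star eps V w - norm_star eps V u >=
       iint (fun x => (f (u x) * (w x - u x))%:E))%E.

Definition primitive (f : R -> R) (s : R) : R :=
  if 0 <= s then Rintegral (@lebesgue_measure R) `[0, s] f
  else - Rintegral (@lebesgue_measure R) `[s, 0] f.

End BVdefs.

(* Main.v *)
(* The solution is [u = t 1_E] with [f t = lam].  As [f 0 = 0], the variational inequality follows
   from [lam * \int_E w <= Q w] for all [w >= 0] in BV, with equality for [w = 1_E], where
   [Q w = eps * TV w + \int V |w|].  To find such [E] and [lam], let [O] be a minimizer of [Q] among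
   sets containing a fixed set of positive measure, so that replacing [w] by [min (w, 1_O)] does not
   increase [Q]; let [lam] be the infimum of [Q w / \int w] over [w >= 0] vanishing off [O], and
   [E] the positivity set of a minimizer.  Minimizers exist without any compactness theorem: [Q] is
   submodular, so finite maxima of almost minimizers are almost minimizers, and the upper limit of a
   fast minimizing sequence is a minimizer.  It does not vanish because a function of unit mass and
   bounded total variation cannot lose all its mass under truncation at height 1.  Finally [lam]
   is in the range of [f] because, by [(f4)], the increasing function [f] is unbounded. *)
Require Import Defs.
From HB Require Import structures.
From mathcomp Require Import all_boot all_order all_algebra.
From mathcomp Require Import all_classical all_reals all_analysis.
From mathcomp Require Import measurable_realfun ring lra.
Import Order.TTheory GRing.Theory Num.Theory.
Import numFieldNormedType.Exports.
Local Open Scope classical_set_scope.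
Local Open Scope ring_scope.

Set Implicit Arguments. Unset Strict Implicit. Unset Printing Implicit Defensive.

(** * Lebesgue measure on row vectors *)

(** On the whole space minimizing sequences may spread out or drift away, and in the second stage
    [Q - lam * \int] is not visibly coercive; this dictates the two stages. Confinement to a set [O]
    of finite measure bounds the mass of unions of almost minimizers, so their upper limit stays
    integrable. It costs nothing because [O] minimizes from outside: by homogeneity [min (w, k 1_O)]
    has no more energy than [w], and it tends to [w 1_O], so a lower bound for functions vanishing
    off [O] is one for all.

    Passing from functions to sets needs no coarea formula. Cutting at a height [s] gives [Q (min
    (w, s)) + Q (max (w - s, 0)) <= Q w]; for a minimizer the energy is then shared exactly among
    the slices, and [1_O] and [1_E] are limits of rescaled slices.

    Submodularity and cutting both come from one inequality on test fields: two fields are exchanged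
    across the interface [u = v + c] by a smooth convex combination, and the gradient term so
    created carries a factor that is bounded and tends to 0. *)

Section measurable_row.
Variable R : realType.
Variable n : nat.

Definition rv_display : measure_display -> measure_display.
Proof. by []. Qed.

(** The product sigma-algebra carried over along [rv_of_tuple], so that [measurableN] becomes
    ordinary measurability. *)
Let rv_measurable : set (set 'rV[R]_n) :=
  [set A | measurable (@rv_of_tuple R n @^-1` A)].

Let rv_measurable0 : rv_measurable set0.
Proof. by rewrite /rv_measurable /= preimage_set0; exact: measurable0. Qed.

Let rv_measurableC A : rv_measurable A -> rv_measurable (~` A).
Proof. by rewrite /rv_measurable /= preimage_setC => ?; exact: measurableC. Qed.

Let rv_measurable_bigcup (F : (set 'rV[R]_n)^nat) :
  (forall i, rv_measurable (F i)) -> rv_measurable (\bigcup_i F i).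
Proof.
by rewrite /rv_measurable /= preimage_bigcup => ?; exact: bigcup_measurable.
Qed.

HB.instance Definition _ := @isMeasurable.Build
  (rv_display (measure_tuple_display default_measure_display))
  'rV[R]_n rv_measurable rv_measurable0 rv_measurableC rv_measurable_bigcup.

End measurable_row.

Section measurable_row_theory.
Variable R : realType.

Lemma measurable_rv_of_tuple n : measurable_fun setT (@rv_of_tuple R n).
Proof. by move=> _ A mA; rewrite setTI. Qed.

Lemma measurable_coord n (i : 'I_n) :
  measurable_fun setT (fun x : 'rV[R]_n => x 0 i).
Proof.
move=> _ A mA; rewrite setTI.
have := @measurable_tnth _ (R : measurableType _) n i measurableT A mA.
rewrite setTI /measurable /=; congr (g_sigma_preimage _ _).
by apply/seteqP; split => t; rewrite /= mxE.
Qed.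

Lemma measurableNE n (g : 'rV[R]_n -> R) : measurableN g <-> measurable_fun setT g.
Proof.
split => mg.
  by move=> _ A mA; have := mg measurableT A mA; rewrite !setTI.
exact: measurableT_comp mg (@measurable_rv_of_tuple n).
Qed.

Lemma measurable_rowP d (T : measurableType d) n (h : T -> 'rV[R]_n) :
  measurable_fun setT h <-> forall i, measurable_fun setT (fun x => h x 0 i).
Proof.
split => [mh i|mh]; first exact: measurableT_comp (@measurable_coord n i) mh.
have mt : measurable_fun setT (fun x => [tuple h x 0 i | i < n] : n.-tuple R).
  apply/measurable_fun_tnthP => i.
  rewrite (_ : _ \o _ = fun x => h x 0 i)//.
  by apply/funext => x /=; rewrite tnth_mktuple.
rewrite (_ : h = @rv_of_tuple R n \o (fun x => [tuple h x 0 i | i < n])).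
  exact: measurableT_comp (@measurable_rv_of_tuple n) mt.
by apply/funext => x; apply/rowP => i; rewrite /= mxE tnth_mktuple.
Qed.

Lemma measurable_row_cons_comp d (T : measurableType d) n (g : T -> R)
    (h : T -> 'rV[R]_n) : measurable_fun setT g -> measurable_fun setT h ->
  measurable_fun setT (fun x => row_cons (g x) (h x)).
Proof.
move=> mg mh; apply/measurable_rowP => i; rewrite /row_cons.
under eq_fun do rewrite mxE.
case: (unliftP ord0 i) => [j _|_]//.
exact: measurableT_comp (@measurable_coord n j) mh.
Qed.

Lemma measurable_row_cons n :
  measurable_fun setT (fun p : R * 'rV[R]_n => row_cons p.1 p.2).
Proof. exact: measurable_row_cons_comp. Qed.

Lemma measurable_rowD d (T : measurableType d) n (g h : T -> 'rV[R]_n) :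
  measurable_fun setT g -> measurable_fun setT h ->
  measurable_fun setT (fun x => g x + h x).
Proof.
move=> /measurable_rowP mg /measurable_rowP mh; apply/measurable_rowP => i.
by under eq_fun do rewrite mxE; exact: measurable_funD.
Qed.

Definition row_split n (z : 'rV[R]_n.+1) : R * 'rV[R]_n :=
  (z 0 ord0, \row_i z 0 (lift ord0 i)).

Lemma row_consK n (p : R * 'rV[R]_n) : row_split (row_cons p.1 p.2) = p.
Proof.
case: p => x y; rewrite /row_split /row_cons; congr pair.
  by rewrite mxE unlift_none.
by apply/rowP => i; rewrite !mxE liftK.
Qed.

Lemma row_splitK n (z : 'rV[R]_n.+1) :
  row_cons (row_split z).1 (row_split z).2 = z.
Proof.
apply/rowP => i; rewrite mxE.
by case: unliftP => [j ->|->]; rewrite ?mxE.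
Qed.

Lemma row_consD n (x x' : R) (y y' : 'rV[R]_n) :
  row_cons x y + row_cons x' y' = row_cons (x + x') (y + y').
Proof. by apply/rowP => i; rewrite !mxE; case: unliftP => [j|] _; rewrite ?mxE. Qed.

Lemma measurable_row_split n : measurable_fun setT (@row_split n).
Proof.
apply/measurable_fun_pairP; split; first exact: measurable_coord.
by apply/measurable_rowP => i; rewrite /comp /=; under eq_fun do rewrite mxE;
  exact: measurable_coord.
Qed.

End measurable_row_theory.

Section leb_succ.
Variables (R : realType) (n : nat).
Variable m : {sigma_finite_measure set 'rV[R]_n -> \bar R}.

Let mu1 : {sigma_finite_measure set (measurableTypeR R) -> \bar R} :=
  @lebesgue_measure R.

Let prodm : {measure set (measurableTypeR R * 'rV[R]_n) -> \bar R} :=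
  product_measure1 mu1 m.

Let rc : measurableTypeR R * 'rV[R]_n -> 'rV[R]_n.+1 :=
  fun p => row_cons p.1 p.2.

Let mrc : measurable_fun setT rc. Proof. exact: measurable_row_cons. Qed.

(** A push-forward of the product measure, so that Tonelli and Fubini unfold its integral in the way
    [iint] recurses, with the first coordinate outermost. *)
Definition leb_succ : set 'rV[R]_n.+1 -> \bar R := pushforward prodm rc.

Let leb_succ0 : leb_succ set0 = 0%E.
Proof. by rewrite /leb_succ /pushforward preimage_set0 measure0. Qed.

Let leb_succ_ge0 A : (0 <= leb_succ A)%E.
Proof. exact: measure_ge0. Qed.

Let leb_succ_sigma_additive : semi_sigma_additive leb_succ.
Proof.
exact: (@measure_semi_sigma_additive _ _ _ (measure_function_pushforward__canonical__measure_function_Measure prodm mrc)).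
Qed.

HB.instance Definition _ := isMeasure.Build _ _ _
  leb_succ leb_succ0 leb_succ_ge0 leb_succ_sigma_additive.

Let leb_succ_sigma_finite : sigma_finite setT leb_succ.
Proof.
have /sigma_finiteP[F [TF ndF Foo]] := sigma_finiteT mu1.
have /sigma_finiteP[G [TG ndG Goo]] := sigma_finiteT m.
exists (fun k => @row_split R n @^-1` (F k `*` G k)).
  rewrite -preimage_bigcup (_ : \bigcup_k _ = setT) ?preimage_setT//.
  rewrite -setXTT TF TG predeqE => -[x y]; split.
    by move=> [k _ []/= ? ?]; split; exists k.
  move=> [/= [k _ Fnx] [l _ Gky]]; exists (maxn k l) => //; split.
  - by move: x Fnx; exact/subsetPset/ndF/leq_maxl.
  - by move: y Gky; exact/subsetPset/ndG/leq_maxr.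
move=> k; have [? ?] := Foo k; have [? ?] := Goo k; split.
  rewrite -[X in measurable X]setTI; apply: measurable_row_split => //.
  exact: measurableX.
rewrite /leb_succ /pushforward -comp_preimage (_ : _ \o _ = id).
  rewrite preimage_id [ltLHS]product_measure1E//.
  by rewrite lte_mul_pinfty// ge0_fin_numE.
by apply/funext => p; exact: row_consK.
Qed.

HB.instance Definition _ := Measure_isSigmaFinite.Build _ _ _
  leb_succ leb_succ_sigma_finite.

Lemma leb_succ_integral (g : 'rV[R]_n.+1 -> \bar R) : measurable_fun setT g ->
  (forall x, 0 <= g x)%E ->
  (\int[leb_succ]_z g z = \int[@lebesgue_measure R]_x \int[m]_y g (row_cons x y))%E.
Proof.
move=> mg g0; rewrite ge0_integral_pushforward//.
rewrite preimage_setT fubini_tonelli1//.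
exact: measurableT_comp mg mrc.
by move=> p; exact: g0.
Qed.

Lemma leb_succ_integral_swap (g : 'rV[R]_n.+1 -> \bar R) : measurable_fun setT g ->
  (forall x, 0 <= g x)%E ->
  (\int[leb_succ]_z g z = \int[m]_y \int[@lebesgue_measure R]_x g (row_cons x y))%E.
Proof.
move=> mg g0; rewrite ge0_integral_pushforward//.
rewrite preimage_setT fubini_tonelli2//.
exact: measurableT_comp mg mrc.
by move=> p; exact: g0.
Qed.

Lemma leb_succ_integrable (g : 'rV[R]_n.+1 -> \bar R) :
  leb_succ.-integrable setT g <-> prodm.-integrable setT (g \o rc).
Proof.
split=> /integrableP[mg goo]; apply/integrableP; split.
- exact: measurableT_comp mg mrc.
- move: goo; rewrite ge0_integral_pushforward// ?preimage_setT//.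
  exact: measurableT_comp.
- have -> : g = (g \o rc) \o @row_split R n.
    by apply/funext => z; rewrite /= /rc row_splitK.
  exact: measurableT_comp mg (@measurable_row_split R n).
- have mg' : measurable_fun setT g.
    have -> : g = (g \o rc) \o @row_split R n.
      by apply/funext => z; rewrite /= /rc row_splitK.
    exact: measurableT_comp mg (@measurable_row_split R n).
  rewrite ge0_integral_pushforward// ?preimage_setT//.
  exact: measurableT_comp.
Qed.

Lemma leb_succ_integralE (g : 'rV[R]_n.+1 -> \bar R) :
  leb_succ.-integrable setT g ->
  (\int[leb_succ]_z g z = \int[@lebesgue_measure R]_x \int[m]_y g (row_cons x y))%E.
Proof.
move=> ig; have ig' := ig; move/leb_succ_integrable: ig' => ig'.
rewrite integral_pushforward//; last by case/integrableP: ig.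
by rewrite preimage_setT -integral12_prod_meas1.
Qed.

End leb_succ.

Fixpoint leb (R : realType) (n : nat) :
    {sigma_finite_measure set 'rV[R]_n -> \bar R} :=
  match n with
  | 0 => \d_(0 : 'rV[R]_0)
  | n'.+1 => leb_succ (leb R n')
  end.

(** The integral is by definition the difference of the integrals of the positive and negative
    parts, and Tonelli gives the measurability of each; integrability of the slices is not
    assumed. *)
Lemma measurable_integral_param d1 d2 (T1 : measurableType d1)
    (T2 : measurableType d2) (R : realType)
    (m : {sigma_finite_measure set T2 -> \bar R}) (f : T1 * T2 -> \bar R) :
  measurable_fun setT f -> measurable_fun setT (fun x => \int[m]_y f (x, y))%E.
Proof.
move=> mf.
have -> : (fun x => \int[m]_y f (x, y))%E =
    ((fun x => \int[m]_y (f^\+ (x, y))) \- (fun x => \int[m]_y (f^\- (x, y))))%E.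
  apply/funext => x; rewrite [LHS]integralE.
  under eq_integral do rewrite funepos_comp/=.
  by under [X in (_ - X = _)%E]eq_integral do rewrite funeneg_comp/=.
apply: emeasurable_funB.
- by apply: (measurable_fun_fubini_tonelli_F (f^\+)%E) => //; exact: measurable_funepos.
- by apply: (measurable_fun_fubini_tonelli_F (f^\-)%E) => //; exact: measurable_funeneg.
Qed.

(** * Agreement of the iterated integral with the Lebesgue integral *)

Section iint_leb.
Variable R : realType.

Lemma measurable_iint n d (T : measurableType d) (g : T -> 'rV[R]_n -> \bar R) :
  measurable_fun setT (fun p : T * 'rV[R]_n => g p.1 p.2) ->
  measurable_fun setT (fun z => iint (g z)).
Proof.
elim: n d T g => [|n IH] d T g mg /=.
  exact: (measurableT_comp mg (pair2_measurable (0 : 'rV[R]_0))).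
apply: (measurable_integral_param (@lebesgue_measure R)
  (f := fun p : T * measurableTypeR R => iint (fun y => g p.1 (row_cons p.2 y)))).
apply: IH.
pose h (q : (T * measurableTypeR R) * 'rV[R]_n) : T * 'rV[R]_n.+1 :=
  (q.1.1, row_cons q.1.2 q.2).
have mh : measurable_fun setT h.
  apply/measurable_fun_pairP; split.
    exact: measurableT_comp measurable_fst measurable_fst.
  apply: measurable_row_cons_comp; last exact: measurable_snd.
  exact: (measurableT_comp measurable_snd measurable_fst).
exact: measurableT_comp mg mh.
Qed.

Lemma measurable_slice n (g : 'rV[R]_n.+1 -> \bar R) (x : R) :
  measurable_fun setT g -> measurable_fun setT (fun y => g (row_cons x y)).
Proof.
move=> mg; apply: (measurableT_comp mg).
exact: measurableT_comp (@measurable_row_cons R n) (pair1_measurable x).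
Qed.

Lemma iint_ge0 n (g : 'rV[R]_n -> \bar R) : measurable_fun setT g ->
  (forall x, 0 <= g x)%E -> iint g = (\int[leb R n]_x g x)%E.
Proof.
elim: n g => [|n IH] g mg g0 /=.
  by rewrite integral_dirac// diracE in_setT mul1e.
rewrite leb_succ_integral//; apply: eq_integral => x _.
by rewrite IH//; exact: measurable_slice.
Qed.

(** By Fubini only almost every slice is integrable, so the induction hypothesis identifies the
    inner integrals almost everywhere; comparing the outer integrals then requires [iint] to be
    measurable in the parameter over all slices. *)
Lemma iint_integrable n (g : 'rV[R]_n -> \bar R) :
  (leb R n).-integrable setT g -> iint g = (\int[leb R n]_x g x)%E.
Proof.
elim: n g => [|n IH] g ig /=.
  have mg := measurable_int _ ig.
  by rewrite integral_dirac// diracE in_setT mul1e.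
have mg := measurable_int _ ig.
rewrite leb_succ_integralE//.
have ig' : (product_measure1 (@lebesgue_measure R) (leb R n)).-integrable setT
    (fun p => g (row_cons p.1 p.2)) by exact/(leb_succ_integrable (leb R n) g).
have mg' := measurable_int _ ig'.
apply: ae_eq_integral => //.
- apply: (measurable_iint (g := fun x : measurableTypeR R => fun y => g (row_cons x y))).
  exact: mg'.
- exact: (measurable_integral_param (leb R n) mg').
- by have := ae_integrable1 ig'; apply: filterS => x /= ix _; rewrite IH.
Qed.

End iint_leb.

(** * Translation invariance *)

Section translation.
Variable R : realType.

Let rshift1 (a : R) : measurableTypeR R -> measurableTypeR R := fun x : R => x + a.

Lemma measurable_shift (a : R) :
  measurable_fun setT (rshift1 a).
Proof.
have : measurable_fun setT (fun x : R => x + a) by exact: measurable_funD.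
exact.
Qed.

Lemma lebesgue_measure_shift (a : R) (A : set R) : measurable A ->
  pushforward (@lebesgue_measure R) (rshift1 a) A
  = lebesgue_measure A.
Proof.
move=> mA; apply/esym.
apply: (lebesgue_measure_unique (mu := measure_function_pushforward__canonical__measure_function_Measure (@lebesgue_measure R) (measurable_shift a))) => // X.
move=> [[u v] _ <-].
rewrite /= /pushforward.
have -> : rshift1 a @^-1` `]u, v] = `]u - a, v - a]%classic.
  by apply/seteqP; split => x; rewrite /= !in_itv/= ltrBlDr lerBrDr.
rewrite !lebesgue_measure_itv/= !lte_fin ltrD2r.
by case: ifP => // _; rewrite -!EFinB opprB addrA subrK.
Qed.

Lemma integral_shift1 (a : R) (f : R -> \bar R) : measurable_fun setT f ->
  (forall x, 0 <= f x)%E ->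
  (\int[@lebesgue_measure R]_x f ((x : R) + a)%R = \int[@lebesgue_measure R]_x f x)%E.
Proof.
move=> mf f0.
rewrite -[LHS]/(\int[@lebesgue_measure R]_(x in setT)
   (f \o (rshift1 a)) x)%E.
rewrite -[in LHS](preimage_setT (rshift1 a)).
rewrite -ge0_integral_pushforward//; last exact: measurable_shift.
apply: eq_measure_integral => [|mr A mA _]; first exact: measurable_shift.
exact: lebesgue_measure_shift.
Qed.

Lemma integral_shift n (a : 'rV[R]_n) (f : 'rV[R]_n -> \bar R) :
  measurable_fun setT f -> (forall x, 0 <= f x)%E ->
  (\int[leb R n]_x f (x + a)%R = \int[leb R n]_x f x)%E.
Proof.
elim: n a f => [|n IH] a f mf f0.
  by apply: eq_integral => x _; congr f; apply/rowP => -[].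
have mfa : measurable_fun setT (fun x : 'rV[R]_n.+1 => f (x + a)).
  by apply: (measurableT_comp mf); apply: measurable_rowD.
have fa0 x : (0 <= f (x + a)%R)%E by exact: f0.
rewrite [LHS](leb_succ_integral (leb R n) mfa fa0).
rewrite [RHS](leb_succ_integral (leb R n) mf f0).
clear mfa fa0.
rewrite -(row_splitK a).
transitivity (\int[@lebesgue_measure R]_x
    \int[leb R n]_y f (row_cons ((x : R) + (row_split a).1)%R y))%E.
  apply: eq_integral => x _.
  rewrite -[RHS](IH (row_split a).2 (fun y => f (row_cons ((x : R) + (row_split a).1)%R y))); last 2 first.
  - exact: (@measurable_slice R n f _ mf).
  - by move=> y; exact: f0.
  by apply: eq_integral => y _; rewrite row_consD.
pose F (x : R) := (\int[leb R n]_y f (row_cons x y))%E.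
have mF : measurable_fun setT F.
  apply: (measurable_integral_param (leb R n) (f := fun p => f (row_cons p.1 p.2))).
  exact: measurableT_comp mf (@measurable_row_cons R n).
have F0 x : (0 <= F x)%E by exact: integral_ge0.
exact: (integral_shift1 (row_split a).1 mF F0).
Qed.

Lemma integrable_shift n (a : 'rV[R]_n) (f : 'rV[R]_n -> R) :
  (leb R n).-integrable setT (EFin \o f) ->
  (leb R n).-integrable setT (fun x => (f (x + a))%:E).
Proof.
move=> /integrableP[mf foo]; apply/integrableP; split.
  by apply: (measurableT_comp mf); apply: measurable_rowD.
rewrite (integral_shift a (f := fun x => `|(f x)%:E|%E))//.
exact: measurableT_comp.
Qed.

Lemma Rintegral_shift n (a : 'rV[R]_n) (f : 'rV[R]_n -> R) :
  measurable_fun setT f ->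
  \int[leb R n]_x f (x + a) = \int[leb R n]_x f x.
Proof.
move=> /measurable_EFinP mf; rewrite /Rintegral; congr fine.
rewrite integralE [RHS]integralE.
have p0 x : (0 <= (EFin \o f)^\+ x)%E by exact: funepos_ge0.
have n0 x : (0 <= (EFin \o f)^\- x)%E by exact: funeneg_ge0.
rewrite -[in RHS](integral_shift a (measurable_funepos mf) p0).
rewrite -[in RHS](integral_shift a (measurable_funeneg mf) n0).
by congr (_ - _)%E; apply: eq_integral => x _; rewrite ?funeposE ?funenegE.
Qed.

End translation.

Section integrable_real.
Context d (T : measurableType d) (R : realType).
Variable mu : {measure set T -> \bar R}.
Implicit Types f g : T -> R.

Definition intble f := mu.-integrable setT (EFin \o f).

Lemma intble_meas f : intble f -> measurable_fun setT f.
Proof. by move=> /measurable_int/measurable_EFinP. Qed.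

Lemma intbleE f : intble f -> (\int[mu]_x f x)%:E = (\int[mu]_x (f x)%:E)%E.
Proof. by move=> fi; rewrite fineK//; exact: integrable_fin_num. Qed.

Lemma intble_le f g : measurable_fun setT g -> (forall x, `|g x| <= f x) ->
  intble f -> intble g.
Proof.
move=> mg gf fi; apply: (le_integrable _ _ _ fi) => //; first exact/measurable_EFinP.
by move=> x _ /=; rewrite lee_fin (le_trans (gf x))// ler_norm.
Qed.

Lemma intbleD f g : intble f -> intble g -> intble (fun x => f x + g x).
Proof. by move=> fi gi; exact: (integrableD _ fi gi). Qed.

Lemma intbleB f g : intble f -> intble g -> intble (fun x => f x - g x).
Proof. by move=> fi gi; exact: (integrableB _ fi gi). Qed.

Lemma intbleZ c f : intble f -> intble (fun x => c * f x).
Proof. by move=> fi; exact: (integrableZl _ c fi). Qed.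

Lemma intble_norm f : intble f -> intble (fun x => `|f x|).
Proof.
move=> fi; apply: (le_integrable _ _ _ fi) => //.
  by apply/measurable_EFinP/measurableT_comp => //; exact: intble_meas.
by move=> x _ /=; rewrite normr_id.
Qed.

Lemma intbleM c f g : intble f -> measurable_fun setT g ->
  (forall x, `|g x| <= c) -> intble (fun x => f x * g x).
Proof.
move=> fi mg gc; apply: (@intble_le (fun x => c * `|f x|)).
- by apply: measurable_funM => //; exact: intble_meas.
- by move=> x; rewrite normrM mulrC ler_wpM2r.
- exact/intbleZ/intble_norm.
Qed.

Lemma intble0 : intble (fun=> 0).
Proof. exact: integrable0. Qed.

Lemma intbleP f : intble f <->
  measurable_fun setT f /\ (\int[mu]_x (`|f x|)%:E < +oo)%E.
Proof.
split=> [fi|[mf foo]]; last by apply/integrableP; split => //; exact/measurable_EFinP.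
split; first exact: intble_meas.
by case/integrableP: fi.
Qed.

Lemma intble_sum (I : Type) (r : seq I) (h : I -> T -> R) :
  (forall i, intble (h i)) -> intble (fun x => \sum_(i <- r) h i x).
Proof.
move=> hi; elim: r => [|i r IH].
  by under eq_fun do rewrite big_nil; exact: intble0.
by under eq_fun do rewrite big_cons; exact: intbleD.
Qed.

Lemma Rintegral_sum (I : Type) (r : seq I) (h : I -> T -> R) :
  (forall i, intble (h i)) ->
  \int[mu]_x (\sum_(i <- r) h i x) = \sum_(i <- r) \int[mu]_x h i x.
Proof.
move=> hi; elim: r => [|i r IH].
  by rewrite big_nil /Rintegral integral0_eq// => x _; rewrite big_nil.
rewrite big_cons -IH -RintegralD//; [|exact: hi|exact: intble_sum].
by apply: eq_Rintegral => x _; rewrite big_cons.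
Qed.

Lemma Rintegral_dct (f_ : nat -> T -> R) f g :
  (forall n, measurable_fun setT (f_ n)) ->
  (forall x, f_ n x @[n --> \oo] --> f x) ->
  (forall n x, `|f_ n x| <= g x) -> intble g ->
  intble f /\ \int[mu]_x f_ n x @[n --> \oo] --> \int[mu]_x f x.
Proof.
move=> mf_ f_f f_g gi.
have mf : measurable_fun setT f by exact: (measurable_fun_cvg mf_).
have [|||||fi _ h] := @dominated_convergence _ _ _ mu setT measurableT
  (fun n x => (f_ n x)%:E) (EFin \o f) (EFin \o g).
- by move=> n; exact/measurable_EFinP.
- exact/measurable_EFinP.
- by apply: aeW => x _; apply: cvg_EFin => //; [exact: nearW|exact: f_f].

- exact: gi.
- by apply: aeW => x n _; rewrite lee_fin f_g.
- by split => //; apply/fine_cvg; rewrite fineK//; exact: integrable_fin_num.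
Qed.

End integrable_real.

(** * Continuity of translations in L^1 *)

Section shift_continuity.
Variable R : realType.
Notation mu1 := (@lebesgue_measure R).

Lemma intble_shift1 (u : R -> R) (t : R) :
  intble mu1 u -> intble mu1 (fun x : R => u (x + t)).
Proof.
move=> /intbleP[mu_ uoo]; apply/intbleP; split.
  exact: (measurableT_comp mu_ (measurable_shift t)).
rewrite (integral_shift1 t (f := fun x => (`|u x|)%:E))//.
exact/measurable_EFinP/measurableT_comp.
Qed.

Lemma shift1_norm (u : R -> R) (t : R) : measurable_fun setT u ->
  \int[mu1]_x `|u ((x : R) + t)| = \int[mu1]_x `|u x|.
Proof.
move=> mu_; rewrite /Rintegral (integral_shift1 t (f := fun x => (`|u x|)%:E))//.
exact/measurable_EFinP/measurableT_comp.
Qed.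

(** Dominated convergence: all translates involved live on the enlarged interval
    [[- (M + B), M + B]], where [B] bounds the shifts, and have the common bound [C]. *)
Lemma shift_cut_cvg (g : R -> R) (M : R) (t : nat -> R) : continuous g ->
  t k @[k --> \oo] --> 0 ->
  let v := fun x : R => \1_(`[- M, M]%classic) x * g x in
  intble mu1 v /\ \int[mu1]_x `|v ((x : R) + t k) - v x| @[k --> \oo] --> 0.
Proof.
move=> cg t0 v.
have inM (r x : R) : (x \in `[- r, r]%classic) = (`|x| <= r).
  by rewrite mem_setE in_itv/= ler_norml.
have mv : measurable_fun setT v.
  apply: measurable_funM; first exact: measurable_indic.
  exact: continuous_measurable_fun.
have [B B0 tB] : exists2 B, 0 <= B & forall k, `|t k| <= B.
  have /cvg_seq_bounded[B [_ Bt]] : cvgn t by apply/cvg_ex; exists 0.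
  exists (`|B| + 1); first by rewrite addr_ge0.
  by move=> k; apply: (Bt (`|B| + 1)) => //; rewrite (le_lt_trans (ler_norm B))// ltrDl.
have [C C0 vC] : exists2 C, 0 <= C & forall x, `|v x| <= C.
  have : bounded_set (g @` `[- M, M]).
    apply: compact_bounded; apply: continuous_compact; last exact: segment_compact.
    exact: continuous_subspaceT.
  move=> [C [_ gC]]; exists (`|C| + 1); first by rewrite addr_ge0.
  move=> x; rewrite /v indicE; case: (boolP (_ \in _)) => [|_]; last first.
    by rewrite mul0r normr0 addr_ge0.
  rewrite inE mul1r => xM; apply: (gC (`|C| + 1)); last by exists x.
  by rewrite (le_lt_trans (ler_norm C))// ltrDl.
pose w (r : R) (x : R) := C * \1_(`[- r, r]%classic) x.
have iC r : intble mu1 (w r) by apply: intbleZ; exact: integrable_indic_itv.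
have vw x : `|v x| <= w M x.
  rewrite /w indicE; case: (boolP (_ \in _)) => xM; first by rewrite mulr1; exact: vC.
  by rewrite /v indicE (negbTE xM) mul0r normr0 mulr0.
have wB x y : `|y| <= B -> w M (x + y) <= w (M + B) x.
  move=> yB; rewrite /w ler_wpM2l// !indicE !inM ler_nat.
  case: leP => //= xyM; rewrite (le_trans (y := `|x + y| + `|y|)) ?lerD//.
  by rewrite -{1}(addrK y x) ler_normB.
have vi : intble mu1 v by apply: intble_le (iC M).
split => //.
have [|||||_ _ h] := @dominated_convergence _ _ _ mu1 setT measurableT
  (fun n x => (`|v ((x : R) + t n) - v x|)%:E) (cst 0%E)
  (EFin \o (fun x => w (M + B) x + w (M + B) x)).
- move=> n; apply/measurable_EFinP/measurableT_comp => //.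
  apply: measurable_funB => //.
  exact: (measurableT_comp mv (measurable_shift (t n))).
- exact: measurable_cst.
(* The cut-off function may jump at [M] and [- M]; pointwise convergence holds off this null set. *)
- have nM a : mu1.-negligible [set a].
    by exists [set a]; split => //; exact: lebesgue_measure_set1.
  apply: negligibleS (negligibleU (nM M) (nM (- M))) => x /= /not_implyP[_ xM].
  apply: contrapT => /not_orP[xM1 xM2]; apply: xM.
  have xM0 : 0 < `| `|x| - M |.
    rewrite normr_gt0 subr_eq0; apply/eqP => xM.
    by case: (ger0P x) xM => _ xM; [apply: xM1|apply: xM2; rewrite -xM opprK].
  apply: cvg_EFin; first exact: nearW.
  suff h0 : (v (x + t n) - v x) @[n --> \oo] --> (0 : R).
    by rewrite -(@normr0 _ R); exact: cvg_norm h0.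
  move/cvgrPdist_lt : (t0) => /(_ _ xM0) tM.
  have xt : x + t n @[n --> \oo] --> x.
    by rewrite -[in X in _ --> X](addr0 x); apply: cvgD => //; exact: cvg_cst.
  have gx : g (x + t n) @[n --> \oo] --> g x by exact: cvg_comp xt (cg x).
  have -> : 0 = \1_(`[- M, M]%classic) x * g x - v x :> R by rewrite subrr.
  apply: cvgB; last exact: cvg_cst.
  apply: (@cvg_trans _ ((\1_(`[- M, M]%classic) x * g (x + t n)) @[n --> \oo])).
    apply: near_eq_cvg; near=> n; rewrite /v; congr (_ * _).
    rewrite !indicE !inM; congr (_%:R); congr nat_of_bool.
    have : `|0 - t n| < `| `|x| - M | by near: n.
    rewrite sub0r normrN => tn.
    have h1 : `|x + t n| <= `|x| + `|t n| by exact: ler_normD.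
    have h2 : `|x| <= `|x + t n| + `|t n|.
      by rewrite -{1}(addrK (t n) x) ler_normB.
    apply/idP/idP => ?; case: (ger0P (`|x| - M)) tn => ? ?; lra.
  by apply: cvgM => //; exact: cvg_cst.
- exact: intbleD.
- apply: aeW => x n _ /=; rewrite lee_fin normr_id.
  apply: le_trans (ler_normB _ _) _; rewrite lerD//.
    by apply: le_trans (vw _) _; exact: wB.
  by apply: le_trans (vw _) _; rewrite -[x in w _ x]addr0 wB// normr0.
- by move: h; rewrite integral_cst// mul0e => /fine_cvg.
Unshelve. all: by end_near.
Qed.

(** By density: [u] is first cut off to a bounded interval and then approximated there by a
    continuous function. Translation invariance makes the approximation error the same before and
    after the shift. *)
Lemma shift1_cvg (u : R -> R) (t : nat -> R) : intble mu1 u ->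
  t k @[k --> \oo] --> 0 ->
  \int[mu1]_x `|u ((x : R) + t k) - u x| @[k --> \oo] --> 0.
Proof.
move=> ui t0.
have mu_ := intble_meas ui.
suff apx (e : R) : 0 < e -> exists (M : R) (g : R -> R), continuous g /\
    \int[mu1]_x `|u x - \1_(`[- M, M]%classic) x * g x| <= e.
  apply/cvgrPdist_le => e e0.
  have e4 : 0 < e / 4 by rewrite divr_gt0.
  have [M [g [cg ug]]] := apx _ e4.
  have [] := shift_cut_cvg M cg t0.
  set v := fun x : R => _ => vi /cvgrPdist_le/(_ _ e4) vt.
  near=> k.
  have vk : \int[mu1]_x `|v ((x : R) + t k) - v x| <= e / 4.
    have : `|0 - \int[mu1]_x `|v ((x : R) + t k) - v x| | <= e / 4 by near: k.
    by rewrite sub0r normrN ger0_norm// Rintegral_ge0.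
  have uvi : intble mu1 (fun x => `|u x - v x|) by apply/intble_norm/intbleB.
  have uvti : intble mu1 (fun x : R => `|u (x + t k) - v (x + t k)|).
    exact: (intble_shift1 (t k) uvi).
  have vti : intble mu1 (fun x : R => `|v (x + t k) - v x|).
    by apply/intble_norm/intbleB => //; exact: intble_shift1.
  have -> : 0 - \int[mu1]_x `|u ((x : R) + t k) - u x| =
            - \int[mu1]_x `|u ((x : R) + t k) - u x| by rewrite sub0r.
  rewrite normrN ger0_norm ?Rintegral_ge0//.
  apply: (@le_trans _ _ (\int[mu1]_x (`|u ((x : R) + t k) - v ((x : R) + t k)|
    + (`|v ((x : R) + t k) - v x| + `|u x - v x|)))).
    apply: le_Rintegral => //.
    - by apply/intble_norm/intbleB => //; exact: intble_shift1.
    - by apply: intbleD => //; exact: intbleD.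
    move=> x _; set a := u _; set b := v _; set c := u x; set d := v x.
    have -> : a - c = (a - b) + ((b - d) - (c - d)) by ring.
    apply: le_trans (ler_normD _ _) _; rewrite lerD//.
    by apply: le_trans (ler_normB _ _) _.
  rewrite RintegralD//; last exact: intbleD.
  rewrite RintegralD//.
  rewrite (shift1_norm (u := fun x => u x - v x)); last first.
    by apply: measurable_funB => //; exact: (intble_meas vi).
  move: ug vk; rewrite -[X in X <= _ -> _]/(\int[mu1]_x `|u x - v x|).
  set I1 := Rintegral _ _ _; set I2 := Rintegral _ _ _ => ? ?; lra.
move=> e0.
have [M M0 uM] : exists2 M : R, 0 <= M &
    \int[mu1]_x `|u x - \1_(`[- M, M]%classic) x * u x| <= e / 2.
  have [||||_] := @Rintegral_dct _ _ _ mu1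
    (fun n (x : R) => `|u x - \1_(`[- n%:R, n%:R]%classic) x * u x|) (cst 0)
    (fun x => `|u x|).
  - move=> n; apply: measurableT_comp => //; apply: measurable_funB => //.
    by apply: measurable_funM => //; exact: measurable_indic.
  - move=> x; apply: cvg_near_cst; near=> n.
    rewrite indicE mem_set ?mul1r ?subrr ?normr0//=.
    rewrite in_itv/= -ler_norml.
    by near: n; exact: nbhs_infty_ger.
  - move=> n x; rewrite normr_id indicE; case: (_ \in _).
      by rewrite mul1r subrr normr0.
    by rewrite mul0r subr0.
  - exact: intble_norm.
  rewrite Rintegral_cst// mul0r => /cvgrPdist_le/(_ (e / 2)).
  rewrite divr_gt0// => /(_ isT)[n _ /(_ n (leqnn n))] /=.
  by rewrite sub0r normrN ger0_norm ?Rintegral_ge0// => h; exists n%:R.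
have Mfin : (mu1 (`[- M, M]%classic : set R)%R < +oo)%E.
  by rewrite lebesgue_measure_itv; case: ifP => _; rewrite ltry.
have uiM : mu1.-integrable `[- M, M] (EFin \o u).
  by apply: integrableS ui.
have [g_ [cg gi]] := @approximation_continuous_integrable R _ u (measurable_itv _) Mfin uiM.
move=> /fine_cvg/cvgrPdist_le/(_ (e / 2)); rewrite divr_gt0// => /(_ isT)[n _ /(_ n (leqnn n))] /=.
rewrite sub0r normrN ger0_norm ?fine_ge0 ?integral_ge0// => gn.
exists M, (g_ n); split; first exact: cg.
pose h x := \1_(`[- M, M]%classic) x * `|u x - g_ n x|.
have hE : h = (fun x => `|u x - g_ n x|) \_ `[- M, M].
  apply/funext => x; rewrite patchE /h indicE.
  by case: ifPn => _; rewrite ?mul1r ?mul0r.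
have hi : intble mu1 h.
  rewrite /intble hE -restrict_EFin; apply/(integrable_mkcond _ _).1 => //.
  by apply: integrable_norm; exact: (integrableB _ uiM (gi n)).
have uMi : intble mu1 (fun x => u x - \1_(`[- M, M]%classic) x * u x).
  apply: intbleB => //; under eq_fun do rewrite mulrC; apply: (intbleM (c := 1)) => //.
  by move=> x; rewrite indicE; case: (_ \in _); rewrite ?normr1 ?normr0.
apply: (@le_trans _ _ (\int[mu1]_x (`|u x - \1_(`[- M, M]%classic) x * u x| + h x))).
  have hb x : `|u x - \1_(`[- M, M]%classic) x * g_ n x| <=
      `|u x - \1_(`[- M, M]%classic) x * u x| + h x.
    rewrite /h indicE; case: (_ \in _); first by rewrite !mul1r subrr normr0 add0r.
    by rewrite !mul0r addr0.
  apply: le_Rintegral => //.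
  - apply: intble_le (intbleD (intble_norm uMi) hi); last first.
      by move=> x; rewrite normr_id.
    apply: measurableT_comp => //; apply: measurable_funB => //.
    apply: measurable_funM; first exact: measurable_indic.
    exact: continuous_measurable_fun.
  - by apply: intbleD => //; exact: intble_norm.
rewrite RintegralD//; last exact: intble_norm.
rewrite [e in _ <= e]splitr lerD// hE -Rintegral_mkcond//.
Unshelve. all: by end_near.
Qed.

End shift_continuity.

Section slice_cvg.
Context d1 d2 (T1 : measurableType d1) (T2 : measurableType d2) (R : realType).
Variables (m1 : {sigma_finite_measure set T1 -> \bar R}).
Variables (m2 : {sigma_finite_measure set T2 -> \bar R}).
Variables (u : T1 * T2 -> R) (b : nat -> T2 -> T2).
Hypothesis mu_ : measurable_fun setT u.
Hypothesis uoo : (\int[m1]_x \int[m2]_y (`|u (x, y)|)%:E < +oo)%E.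
Hypothesis mb : forall k, measurable_fun setT (b k).
Hypothesis b_inv : forall k (f : T2 -> \bar R), measurable_fun setT f ->
  (forall y, 0 <= f y)%E -> (\int[m2]_y f (b k y) = \int[m2]_y f y)%E.
Hypothesis b_cvg : forall g : T2 -> R, intble m2 g ->
  \int[m2]_y `|g (b k y) - g y| @[k --> \oo] --> 0.

(** For almost every [x] the slice is integrable and the inner integral tends to 0; by the
    invariance [b_inv] it is at most twice the norm of the slice, which is integrable in [x]. The
    factors are kept abstract because either the first coordinate or the remaining ones may be the
    moving variable. *)
Lemma slice_cvg :
  (\int[m1]_x \int[m2]_y (`|u (x, b k y) - u (x, y)|)%:E)%E @[k --> \oo] --> 0%E.
Proof.
have mux x : measurable_fun setT (fun y => u (x, y)).
  exact: (measurableT_comp mu_ (pair1_measurable x)).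
have muxb x k : measurable_fun setT (fun y => u (x, b k y)).
  exact: (measurableT_comp (mux x) (mb k)).
have mnu x : measurable_fun setT (fun y => (`|u (x, y)|)%:E).
  by apply/measurable_EFinP; apply: measurableT_comp => //; exact: mux.
have mnub x k : measurable_fun setT (fun y => (`|u (x, b k y)|)%:E).
  have h := muxb x k.
  by apply/measurable_EFinP; apply: measurableT_comp => //.
pose G x := (\int[m2]_y (`|u (x, y)|)%:E)%E.
have mun : measurable_fun setT (fun p => (`|u p|)%:E).
  exact/measurable_EFinP/measurableT_comp.
have mG : measurable_fun setT G.
  exact: (measurable_fun_fubini_tonelli_F (fun p => (`|u p|)%:E)).
have G0 x : (0 <= G x)%E by exact: integral_ge0.
have iG : m1.-integrable setT G.
  apply/integrableP; split => //.
  by under eq_integral do rewrite gee0_abs//.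
pose F k x := (\int[m2]_y (`|u (x, b k y) - u (x, y)|)%:E)%E.
have mF k : measurable_fun setT (F k).
  apply: (measurable_fun_fubini_tonelli_F (fun p => (`|u (p.1, b k p.2) - u (p.1, p.2)|)%:E)) => //.
  have mbs : measurable_fun setT (fun p : T1 * T2 => b k p.2).
    exact: measurableT_comp (mb k) (@measurable_snd _ _ T1 T2).
  have mp : measurable_fun setT (fun p : T1 * T2 => (p.1, b k p.2)).
    exact: (measurable_fun_pair measurable_fst mbs).
  apply/measurable_EFinP; apply: measurableT_comp => //; apply: measurable_funB.
    exact: measurableT_comp mu_ mp.
  rewrite (_ : (fun p => _) = u)//; by apply/funext => -[].
have F0 k x : (0 <= F k x)%E by exact: integral_ge0.
have FG k x : (F k x <= G x + G x)%E.
  rewrite -[X in (_ <= X + _)%E](b_inv k (f := fun y => (`|u (x, y)|)%:E))//.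
  rewrite -ge0_integralD//.
  apply: ge0_le_integral => //.
  - by apply/measurable_EFinP; apply: measurableT_comp => //; exact: measurable_funB.
  - exact: emeasurable_funD.
  - by move=> y _; rewrite -EFinD lee_fin ler_normB.
have [|||||_ _ h] := @dominated_convergence _ _ _ m1 setT measurableT
  F (cst 0%E) (fun x => G x + G x)%E.
- exact: mF.
- exact: measurable_cst.
- have := integrable_ae measurableT iG; apply: filterS => x /= /(_ I) Gx _.
  have ux : intble m2 (fun y => u (x, y)).
    apply/intbleP; split; first exact: mux.
    by move: Gx; rewrite ge0_fin_numE.
  have uxb k : intble m2 (fun y => u (x, b k y)).
    apply/intbleP; split; first exact: muxb.
    rewrite (b_inv k (f := fun y => (`|u (x, y)|)%:E))//.
    by case/intbleP: ux.
  have -> : F ^~ x = (fun k => (\int[m2]_y `|u (x, b k y) - u (x, y)|)%:E).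
    by apply/funext => k; rewrite intbleE//; exact/intble_norm/intbleB.
  by apply: cvg_EFin; [exact: nearW|exact: b_cvg].
- exact: (integrableD _ iG iG).
- by apply: aeW => x k _; rewrite gee0_abs.
- by move: h; rewrite integral_cst// mul0e.
Qed.

End slice_cvg.

(** Induction on the dimension: the shift is split into [A k], which moves the first coordinate, and
    [B k], which moves the others. The triangle inequality combines the two, the first difference
    being translated back by [B k]. *)
Lemma shift_cvg (R : realType) n (u : 'rV[R]_n -> R) (z : nat -> 'rV[R]_n) :
  intble (leb R n) u -> (forall i, z k 0 i @[k --> \oo] --> (0 : R)) ->
  \int[leb R n]_x `|u (x + z k) - u x| @[k --> \oo] --> 0.
Proof.
elim: n u z => [|n IH] u z ui z0.
  apply: cvg_near_cst; near=> k; rewrite /Rintegral integral0_eq// => x _.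
  by rewrite (_ : x + z k = x) ?subrr ?normr0//; apply/rowP => -[].
pose A k : 'rV[R]_n.+1 := row_cons (z k 0 ord0) 0.
pose B k : 'rV[R]_n.+1 := row_cons 0 (row_split (z k)).2.
have zAB k : z k = B k + A k.
  by rewrite -{1}(row_splitK (z k)) row_consD add0r addr0.
have mu_ := intble_meas ui.
have mux (y : 'rV[R]_n.+1) : measurable_fun setT (fun x : 'rV[R]_n.+1 => u (x + y)).
  by apply: (measurableT_comp mu_); exact: measurable_rowD.
have msh (y : 'rV[R]_n.+1) : measurable_fun setT (fun x : 'rV[R]_n.+1 => (`|u (x + y) - u x|)%:E).
  by apply/measurable_EFinP/measurableT_comp => //; exact: measurable_funB.
have uxi (y : 'rV[R]_n.+1) : intble (leb R n.+1) (fun x : 'rV[R]_n.+1 => `|u (x + y) - u x|).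
  by apply/intble_norm/intbleB => //; exact: integrable_shift.
pose v (p : measurableTypeR R * 'rV[R]_n) := u (row_cons p.1 p.2).
have mv : measurable_fun setT v.
  exact: measurableT_comp mu_ (@measurable_row_cons R n).
have mun : measurable_fun setT (fun x => (`|u x|)%:E).
  exact/measurable_EFinP/measurableT_comp.
have un0 x : (0 <= (`|u x|)%:E)%E by rewrite lee_fin.
have sh0 y x : (0 <= (`|u (x + y)%R - u x|)%:E)%E by rewrite lee_fin.
have [_ uoo] := (intbleP _ _).1 ui.
have hB : \int[leb R n.+1]_x `|u (x + B k) - u x| @[k --> \oo] --> 0.
  apply/fine_cvg.
  rewrite (_ : (fun k => _) = fun k => (\int[@lebesgue_measure R]_x \int[leb R n]_y
     (`|v (x, y + (row_split (z k)).2) - v (x, y)|)%:E)%E); last first.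
    apply/funext => k; rewrite (leb_succ_integral (leb R n) (msh (B k)) (sh0 (B k))).
    apply: eq_integral => x _; apply: eq_integral => y _.
    by rewrite row_consD addr0.
  apply: slice_cvg => //.
  - by move: uoo; rewrite (leb_succ_integral (leb R n) mun un0).
  - by move=> k; exact: measurable_rowD.
  - by move=> k f mf f0; exact: integral_shift.
  - move=> g gi; apply: IH => // i; under eq_fun do rewrite mxE; exact: z0.
have hA : \int[leb R n.+1]_x `|u (x + A k) - u x| @[k --> \oo] --> 0.
  apply/fine_cvg.
  rewrite (_ : (fun k => _) = fun k => (\int[leb R n]_y \int[@lebesgue_measure R]_x
     (`|v ((x : R) + z k 0 ord0, y)%R - v (x, y)|)%:E)%E); last first.
    apply/funext => k; rewrite (leb_succ_integral_swap (leb R n) (msh (A k)) (sh0 (A k))).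
    apply: eq_integral => y _; apply: eq_integral => x _.
    by rewrite row_consD addr0.
  apply: (slice_cvg (m1 := leb R n) (m2 := @lebesgue_measure R)
    (u := fun p => v (p.2, p.1))
    (b := fun k (x : measurableTypeR R) => (x : R) + z k 0 ord0)) => //.
  - apply: (measurableT_comp mv).
    exact: (measurable_fun_pair measurable_snd measurable_fst).
  - by move: uoo; rewrite (leb_succ_integral_swap (leb R n) mun un0).
  - by move=> k; exact: measurable_shift.
  - by move=> k f mf f0; exact: integral_shift1.
  - by move=> g gi; exact: shift1_cvg.
apply: (@squeeze_cvgr _ _ _ _ (cst 0)
  (fun k => \int[leb R n.+1]_x `|u (x + A k) - u x| +
            \int[leb R n.+1]_x `|u (x + B k) - u x|)).
- apply: nearW => k; rewrite Rintegral_ge0//=.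
  rewrite -(Rintegral_shift (B k) (f := fun x => `|u (x + A k) - u x|)); last first.
    exact: intble_meas.
  have sA : intble (leb R n.+1)
      (fun x : 'rV[R]_n.+1 => `|u (x + B k + A k) - u (x + B k)|).
    exact: (integrable_shift (B k) (uxi (A k))).
  rewrite -(RintegralD _ sA (uxi (B k)))//.
  apply: le_Rintegral; [by []|exact: uxi|exact: (intbleD sA (uxi (B k)))|].
  move=> x _; rewrite zAB addrA.
  by rewrite (le_trans _ (ler_normD _ _))// addrA subrK.
- exact: cvg_cst.
- by rewrite -[X in _ --> X](addr0 0); exact: cvgD.
Unshelve. all: by end_near.
Qed.

(** * Continuously differentiable functions and mollification *)

Section row_norm.
Variables (R : realType) (n : nat).
Implicit Types (v x : 'rV[R]_n).

Lemma row_norm_le v (r : R) : 0 <= r -> (forall j, `|v 0 j| <= r) -> `|v| <= r.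
Proof.
move=> r0 vr; rewrite [leLHS]/Num.norm /= mx_normrE; apply/bigmax_leP; split => //.
by move=> [i j] _ /=; rewrite ord1.
Qed.

Lemma row_norm_ge v j : `|v 0 j| <= `|v|.
Proof.
rewrite [leRHS]/Num.norm /= mx_normrE.
by apply/bigmax_geP; right => /=; exists (0, j).
Qed.

End row_norm.

Section line_derivative.
Variables (R : realType) (n : nat).
Implicit Types (f g : 'rV[R]_n -> R) (x v : 'rV[R]_n).

Lemma is_derive_line f x v t d :
  is_derive (x + t *: v) v f d <-> is_derive t 1 (fun s : R => f (x + s *: v)) d.
Proof.
have E : (fun h : R => h^-1 *: ((f \o shift (x + t *: v)) (h *: v) - f (x + t *: v))) =
  (fun h : R => h^-1 *: (((fun s : R => f (x + s *: v)) \o shift t) (h *: (1 : R)) - f (x + t *: v))).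
  apply/funext => h /=; congr (_ *: (f _ - _)).
  by rewrite [_%:A]mulr1 scalerDl addrCA.
split=> -[fd fD]; split.
- by move: fd; rewrite /derivable E.
- by move: fD; rewrite /derive E.
- by rewrite /derivable E.
- by rewrite /derive E.
Qed.

Lemma is_derive_line0 f x v d :
  is_derive x v f d <-> is_derive (0 : R) 1 (fun s : R => f (x + s *: v)) d.
Proof. by rewrite -is_derive_line scale0r addr0. Qed.

Lemma is_derive_comp_real (h : R -> R) f x v dh df :
  is_derive (f x) 1 h dh -> is_derive x v f df ->
  is_derive x v (fun y => h (f y)) (dh * df).
Proof.
move=> hd /is_derive_line0 fd; apply/is_derive_line0.
set g := fun s : R => f (x + s *: v).
have g0 : g 0 = f x by rewrite /g scale0r addr0.
have hd' : derivable h (g 0) 1 by rewrite g0; case: hd.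
have gd' : derivable g 0 1 by case: fd.
split.
- apply/derivable1_diffP; apply: (@differentiable_comp _ _ _ _ g h).
    exact/derivable1_diffP.
  exact/derivable1_diffP.
- rewrite -derive1E (derive1_comp gd' hd') !derive1E g0.
  by case: hd => _ ->; case: fd => _ ->.
Qed.

Lemma is_derive_shift_arg f x v a d :
  is_derive (x + a) v f d <-> is_derive x v (fun y => f (y + a)) d.
Proof.
rewrite is_derive_line0 [in X in _ <-> X]is_derive_line0.
have -> // : (fun s : R => f (x + a + s *: v)) = (fun s : R => f (x + s *: v + a)).
by apply/funext => s; rewrite addrAC.
Qed.

Lemma is_derive_near0 f x v :
  (\forall y \near x, f y = 0) -> is_derive x v f 0.
Proof.
move=> fx0; have fx : f x = 0 by exact: nbhs_singleton fx0.
have E : (fun h : R => h^-1 *: ((f \o shift x) (h *: v) - f x)) @ 0^' --> (0 : R).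
  apply: cvg_near_cst.
  have sx : h *: v + x @[h --> (0 : R)^'] --> x.
    rewrite -[in X in _ --> X](add0r x) -[in X in _ --> X](scale0r v).
    apply: cvgD; last exact: cvg_cst.
    have i0 : (fun h : R => h) @ (0 : R)^' --> (0 : R) by exact: (@nbhs_dnbhs R 0).
    exact: cvgZr_tmp.
  near=> h; have fh : f (h *: v + x) = 0 by near: h; exact: sx _ fx0.
  by rewrite /= fh fx subrr scaler0.
by split; [apply/cvg_ex; exists 0|exact: (cvg_lim _ E)].
Unshelve. all: by end_near.
Qed.

End line_derivative.

Lemma line_lip (R : realType) (g dg : R -> R) (t C : R) :
  (forall s, `|s| <= `|t| -> is_derive (s : R) (1 : R) g (dg s)) ->
  (forall s, `|s| <= `|t| -> `|dg s| <= C) -> `|g t - g 0| <= C * `|t|.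
Proof.
move=> gd gC; have [t0|t0] := leP 0 t.
  have [s||c] := @MVT_segment _ g dg 0 t t0.
  - rewrite in_itv/= => /andP[s0 st]; apply: gd.
    by rewrite !ger0_norm// ltW.
  - apply: derivable_within_continuous => s; rewrite in_itv/= => /andP[s0 st].
    by apply: ex_derive; apply: gd; rewrite !ger0_norm.
  - rewrite in_itv/= => /andP[s0 st] ->; rewrite subr0 normrM ler_wpM2r//.
    by apply: gC; rewrite !ger0_norm.
have [s||c] := @MVT_segment _ g dg t 0 (ltW t0).
- rewrite in_itv/= => /andP[s0 st]; apply: gd.
  by rewrite !ltr0_norm// lerN2 ltW.
- apply: derivable_within_continuous => s; rewrite in_itv/= => /andP[s0 st].
  by apply: ex_derive; apply: gd; rewrite (ltr0_norm t0) ler0_norm ?lerN2.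
- rewrite in_itv/= => /andP[s0 st] E; rewrite distrC E sub0r normrM normrN ler_wpM2r//.
  by apply: gC; rewrite (ltr0_norm t0) ler0_norm ?lerN2.
Qed.

Section C1grad.
Variables (R : realType) (n : nat).
Implicit Types (f g : 'rV[R]_n -> R) (F G : 'I_n -> 'rV[R]_n -> R).

(** The class [C1N] with the partial derivatives named, so that gradients of products, compositions
    and translates are computed along with the proof of regularity. *)
Definition C1grad f G := forall j,
  (forall x, is_derive x (ebasis R j) f (G j x)) /\ continuous (G j).

Lemma C1N_grad f : C1N f -> C1grad f (fun j x => 'D_(ebasis R j) f x).
Proof. by move=> fC j; have [fd fc] := fC j; split. Qed.

Lemma C1grad_C1N f G : C1grad f G -> C1N f.
Proof.
move=> fG j; have [fd fc] := fG j; split.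
  by move=> x; exact: ex_derive.
rewrite (_ : (fun x => _) = G j)//.
by apply/funext => x; exact: derive_val.
Qed.

Lemma C1gradE f G j x : C1grad f G -> 'D_(ebasis R j) f x = G j x.
Proof. by move=> fG; have [fd _] := fG j; exact: derive_val. Qed.

Let trunc (z : 'rV[R]_n) k : 'rV[R]_n := \row_j (if (j < k)%N then z 0 j else 0).

(** The segment is replaced by a path that changes one coordinate at a time, through the points
    [x + trunc z k], and the mean value theorem is applied on each edge. The path stays in the ball
    because the norm is the maximum norm, which truncation does not increase. *)
Lemma C1grad_lip f G x r C : C1grad f G -> 0 <= r -> 0 <= C ->
  (forall y j, `|y - x| <= r -> `|G j y| <= C) ->
  forall z, `|z| <= r -> `|f (x + z) - f x| <= C * \sum_j `|z 0 j|.
Proof.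
move=> fG r0 C0 GC z zr.
have trn : trunc z n = z by apply/rowP => j; rewrite mxE ltn_ord.
have tr0 : trunc z 0 = 0 by apply/rowP => j; rewrite !mxE.
have trS (k : 'I_n) : trunc z k.+1 = trunc z k + z 0 k *: ebasis R k.
  apply/rowP => j; rewrite !mxE eqxx /= -val_eqE/= ltnS leq_eqVlt.
  case: (ltngtP j k) => [jk|jk|/val_inj ->]; rewrite ?mulr0 ?addr0 ?mulr1 ?add0r//.
suff H k : (k <= n)%N -> `|f (x + trunc z k) - f x| <= C * \sum_(j < n | (j < k)%N) `|z 0 j|.
  have := H n (leqnn n); rewrite trn => /le_trans; apply.
  by rewrite ler_wpM2l// (eq_bigl xpredT)// => j; rewrite ltn_ord.
elim: k => [|k IH] kn.
  by rewrite tr0 addr0 subrr normr0 mulr_ge0// sumr_ge0.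
pose i := Ordinal kn.
rewrite (trS i) (bigD1 i) ?ltnSn//= (eq_bigl (fun j : 'I_n => (j < k)%N)); last first.
  by move=> j; rewrite -val_eqE/= ltnS ltn_neqAle andbC.
rewrite mulrDr addrA.
have -> : f (x + trunc z k + z 0 i *: ebasis R i) - f x =
  (f (x + trunc z k + z 0 i *: ebasis R i) - f (x + trunc z k))
  + (f (x + trunc z k) - f x) by rewrite addrA subrK.
rewrite (le_trans (ler_normD _ _))// lerD ?IH// ?(ltnW kn)//.
have := @line_lip _ (fun s : R => f (x + trunc z k + s *: ebasis R i))
  (fun s => G i (x + trunc z k + s *: ebasis R i)) (z 0 i) C.
rewrite scale0r addr0; apply.
  by move=> s _; apply/is_derive_line; case: (fG i).
move=> s sz; apply: GC.
rewrite -[x + trunc z k + _]addrA [x + _]addrC addrK.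
apply: row_norm_le => // j; rewrite !mxE eqxx /=.
apply: le_trans zr; apply: le_trans (row_norm_ge z j).
case: ltnP => jk; last first.
  by rewrite add0r; have [->|_] := eqVneq j i; rewrite ?mulr1 ?mulr0 ?normr0.
by rewrite (_ : j == i = false) ?mulr0 ?addr0//; apply/negbTE; rewrite -val_eqE/= ltn_eqF.
Qed.

(** Only partial derivatives are given, so continuity of the function itself has to be derived: they
    are bounded near [x] by continuity, which makes [f] Lipschitz at [x]. *)
Lemma C1grad_continuous f G : C1grad f G -> continuous f.
Proof.
move=> fG x; apply/(@cvgrPdist_le _ _ _ (nbhs x) (nbhs_filter x)) => e e0.
pose C := 1 + \sum_j `|G j x|.
have C0 : 0 < C by rewrite ltr_pwDl// sumr_ge0.
have : \forall y \near x, forall j, `|G j y| <= C.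
  have FF := nbhs_filter x.
  apply: (@filter_forall _ _ (fun j y => `|G j y| <= C) (nbhs x) FF) => j.
  have [_ /(_ x)] := fG j.
  move=> /(@cvgrPdist_le _ _ _ (nbhs x) FF)/(_ 1 ltr01); apply: filterS => y Gy.
  have -> : G j y = (G j y - G j x) + G j x by rewrite subrK.
  rewrite (le_trans (ler_normD _ _))// lerD// 1?distrC// (bigD1 j)//= lerDl.
  exact: sumr_ge0.
move=> /nbhs_ballP[r /= r0 Gr].
have n0 : 0 < n%:R + 1 :> R by rewrite ltr_wpDl.
near=> y.
have yx : `|y - x| <= r / 2.
  rewrite distrC; near: y; apply: (@cvgr_dist_le _ _ _ _ _ id x) => //.
  by rewrite divr_gt0.
have yx2 : `|y - x| <= e / (C * (n%:R + 1)).
  rewrite distrC; near: y; apply: (@cvgr_dist_le _ _ _ _ _ id x) => //.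
  by rewrite divr_gt0// mulr_gt0.
have := @C1grad_lip f G x (r / 2) C fG (ltW (divr_gt0 r0 (ltr0n _ 2))) (ltW C0) _ (y - x) yx.
have xy : x + (y - x) = y by rewrite addrC subrK.
rewrite xy distrC => h.
apply: (le_trans (h _)) => [w j wx|].
  apply: Gr; rewrite -ball_normE /= distrC (le_lt_trans wx)//.
  by rewrite ltr_pdivrMr// ltr_pMr// ltr1n.
rewrite -ler_pdivlMl// (@le_trans _ _ (\sum_(j < n) `|y - x|))//.
  by apply: ler_sum => j _; exact: row_norm_ge.
rewrite sumr_const card_ord -[_ *+ _]mulr_natr.
apply: (@le_trans _ _ (`|y - x| * (n%:R + 1))); first by rewrite ler_wpM2l// lerDl.
by rewrite -ler_pdivlMr// (le_trans yx2)// invfM mulrA [C^-1 * e]mulrC.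
Unshelve. all: by end_near.
Qed.

Lemma C1grad_cst c : C1grad (fun=> c) (fun _ _ => 0).
Proof. by move=> j; split => [x|]; [exact: is_derive_cst|exact: cst_continuous]. Qed.

Lemma C1gradD f g F G : C1grad f F -> C1grad g G ->
  C1grad (fun x => f x + g x) (fun j x => F j x + G j x).
Proof.
move=> fF gG j; have [fd fc] := fF j; have [gd gc] := gG j; split => x.
  exact: is_deriveD.
exact: (@continuousD _ _ _ _ _ x (fc x) (gc x)).
Qed.

Lemma C1gradN f F : C1grad f F -> C1grad (fun x => - f x) (fun j x => - F j x).
Proof.
move=> fF j; have [fd fc] := fF j; split => x.
  exact: is_deriveN.
exact: (@continuousN _ _ _ _ x (fc x)).
Qed.

Lemma C1gradB f g F G : C1grad f F -> C1grad g G ->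
  C1grad (fun x => f x - g x) (fun j x => F j x - G j x).
Proof. by move=> fF gG; exact: C1gradD fF (C1gradN gG). Qed.

Lemma C1gradM f g F G : C1grad f F -> C1grad g G ->
  C1grad (fun x => f x * g x) (fun j x => f x * G j x + g x * F j x).
Proof.
move=> fF gG j; have [fd fc] := fF j; have [gd gc] := gG j; split => x.
  exact: is_deriveM.
have cf := C1grad_continuous fF; have cg := C1grad_continuous gG.
exact: (continuousD (continuousM (cf x) (gc x)) (continuousM (cg x) (fc x))).
Qed.

Lemma C1grad_comp (h dh : R -> R) f F :
  (forall s, is_derive (s : R) (1 : R) h (dh s)) -> continuous dh -> C1grad f F ->
  C1grad (fun x => h (f x)) (fun j x => dh (f x) * F j x).
Proof.
move=> hd hc fF j; have [fd fc] := fF j; split => x.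
  exact: is_derive_comp_real.
have cf := C1grad_continuous fF.
exact: (continuousM (continuous_comp (cf x) (hc (f x))) (fc x)).
Qed.

Lemma C1grad_shift f F a : C1grad f F ->
  C1grad (fun x => f (x + a)) (fun j x => F j (x + a)).
Proof.
move=> fF j; have [fd fc] := fF j; split => x.
  by apply/is_derive_shift_arg.
have ca : {for x, continuous (fun y : 'rV[R]_n => y + a)}.
  apply: (@continuousD _ _ _ id (cst a) x); first exact: cvg_id.
  exact: (@cst_continuous _ _ a x).
exact: (continuous_comp ca (fc (x + a))).
Qed.

Lemma C1grad_near0 f F j x : C1grad f F -> (\forall y \near x, f y = 0) -> F j x = 0.
Proof.
move=> fF fx; rewrite -(C1gradE j x fF).
by have [_ ->] := is_derive_near0 (ebasis R j) fx.
Qed.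

Lemma C1grad_coord i : C1grad (fun x : 'rV[R]_n => x 0 i) (fun j _ => (i == j)%:R).
Proof.
move=> j; split => [x|]; last exact: cst_continuous.
apply/is_derive_line0.
have -> : (fun s : R => (x + s *: ebasis R j) 0 i) =
    (fun s : R => x 0 i + s * (i == j)%:R).
  by apply/funext => s; rewrite !mxE eqxx.
have := is_deriveD (is_derive_cst (x 0 i) (0:R) (1:R))
   (is_deriveM (is_derive_id (0:R) (1:R)) (is_derive_cst ((i == j)%:R : R) (0:R) (1:R))).
by move=> h; apply: (is_derive_eq h); rewrite scaler0 !add0r [LHS]mulr1.
Qed.

End C1grad.

(** * Measurability of continuous functions *)

Section row_measurability.
Variables (R : realType) (n : nat).
Implicit Types (f : 'rV[R]_n -> R).

Let grid (k : nat) (x : 'rV[R]_n) : 'rV[int]_n :=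
  \row_i Num.floor (k.+1%:R * x 0 i).

Let ungrid (k : nat) (m : 'rV[int]_n) : 'rV[R]_n := \row_i ((m 0 i)%:~R / k.+1%:R).

Let grid_near k x : `|x - ungrid k (grid k x)| <= k.+1%:R^-1.
Proof.
apply: row_norm_le => // j; rewrite !mxE.
have /andP[h1 h2] : (Num.floor (k.+1%:R * x 0 j))%:~R <= k.+1%:R * x 0 j <
    (Num.floor (k.+1%:R * x 0 j) + 1)%:~R.
  exact: floor_itv.
have E : x 0 j = k.+1%:R * x 0 j / k.+1%:R by rewrite mulrC mulKf.
rewrite [X in `|X - _|]E.
rewrite -mulrBl normrM [X in _ * X <= _]ger0_norm//.
rewrite ger0_norm ?subr_ge0// ler_piMl//.
by move: h2; rewrite intrD => h2; lra.
Qed.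

Let measurable_grid k m : measurable (grid k @^-1` [set m]).
Proof.
rewrite (_ : _ @^-1` _ = \bigcap_(i in [set: 'I_n])
    ((fun x : 'rV[R]_n => k.+1%:R * x 0 i) @^-1` `[(m 0 i)%:~R, (m 0 i + 1)%:~R[)).
  apply: fin_bigcap_measurable => [|i _]; first exact: finite_finset.
  rewrite -[X in measurable X]setTI.
  by apply: (measurable_funM (measurable_cst _) (@measurable_coord R n i)).
apply/seteqP; split => x /=.
  by move=> <- i _; rewrite /= in_itv/= mxE; exact: floor_itv.
move=> xm; apply/rowP => i; rewrite mxE; apply: floor_def.
by have := xm i I; rewrite /= in_itv/=.
Qed.

(** [f] is the pointwise limit of functions constant on the cells of a cubic grid of mesh
    [k.+1%:R^-1]; these are measurable because there are countably many cells, each a product of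
    intervals. *)
Lemma continuous_measurable_row f : continuous f -> measurable_fun setT f.
Proof.
move=> cf.
apply: (measurable_fun_cvg (h := fun k x => f (ungrid k (grid k x)))) => [k|x _].
  move=> _ A mA; rewrite setTI.
  rewrite (_ : _ @^-1` _ = \bigcup_(m in [set m | A (f (ungrid k m))]) grid k @^-1` [set m]).
    rewrite bigcup_mkcond; apply: countable_bigcupT_measurable => [|m].
      exact: countableP.
    by case: ifP.
  apply/seteqP; split => x /=; first by move=> Ax; exists (grid k x).
  by move=> [m /= Am ->].
apply: (cvg_comp (fun k => ungrid k (grid k x)) f); last exact: (cf x).
apply/cvgrPdist_le => e e0; near=> k.
apply: (le_trans (grid_near k x)).
near: k; have := @near_infty_natSinv_lt R (PosNum e0); apply: filterS => k /= /ltW.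
by [].
Unshelve. all: by end_near.
Qed.

End row_measurability.

Section box_measure.
Variable R : realType.

Definition box n (r : R) : set 'rV[R]_n := [set x | forall i, `|x 0 i| <= r].
Arguments box n r : clear implicits.

Lemma boxE n (r : R) : 0 <= r -> box n r = [set x | `|x| <= r].
Proof.
move=> r0; apply/seteqP; split => x /= xr; first exact: row_norm_le.
by move=> i; rewrite (le_trans (row_norm_ge x i)).
Qed.

Lemma measurable_box n (r : R) : measurable (box n r).
Proof.
rewrite (_ : box n r = \bigcap_(i in [set: 'I_n])
    ((fun x : 'rV[R]_n => x 0 i) @^-1` `[- r, r])).
  apply: fin_bigcap_measurable => [|i _]; first exact: finite_finset.
  by rewrite -[X in measurable X]setTI; exact: measurable_coord.
apply/seteqP; split => x /= xr i; first by move=> _; rewrite /= in_itv/= -ler_norml.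
by have := xr i I; rewrite /= in_itv/= -ler_norml.
Qed.

Lemma leb_box n (r : R) : 0 <= r -> leb R n (box n r) = ((r *+ 2) ^+ n)%:E.
Proof.
move=> r0; elim: n => [|n IH] /=.
  by rewrite diracE mem_set ?expr0// => -[].
rewrite /leb_succ /pushforward.
rewrite (_ : _ @^-1` _ = `[- r, r] `*` box n r).
  have -> : ((r *+ 2) ^+ n.+1)%:E =
      (@lebesgue_measure R (`[- r, r]%classic : set R)%R * leb R n (box n r))%E.
    rewrite IH lebesgue_measure_itv/= lte_fin.
    case: ltP => [_|r1]; first by rewrite -EFinB opprK -EFinM exprS -mulr2n.
    have -> : r = 0 by lra.
    by rewrite mul0e mul0rn expr0n.
  by apply: product_measure1E => //; exact: measurable_box.
apply/seteqP; split => -[x y] /=.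
  move=> xy; split; first by have := xy ord0; rewrite !mxE unlift_none in_itv/= -ler_norml.
  by move=> i; have := xy (lift ord0 i); rewrite !mxE liftK.
rewrite in_itv/= -ler_norml => -[xr yr] i; rewrite mxE.
by case: unliftP => [j _|_]; rewrite ?xr.
Qed.

Lemma intble_box n (r : R) : 0 <= r -> intble (leb R n) \1_(box n r).
Proof.
move=> r0; apply/intbleP; split.
  by apply: measurable_indic; exact: measurable_box.
under eq_integral do rewrite ger0_norm//.
rewrite integral_indic; [|exact: measurableT|exact: measurable_box].
rewrite setIT [ltLHS](_ : _ = ((r *+ 2) ^+ n)%:E) ?ltry//.
exact: leb_box.
Qed.

Lemma intble_bounded_support n (f : 'rV[R]_n -> R) (C r : R) : measurable_fun setT f ->
  (forall x, `|f x| <= C) -> (forall x, r < `|x| -> f x = 0) -> intble (leb R n) f.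
Proof.
move=> mf fC fr.
apply: (intble_le (f := fun x => C * \1_(box n `|r|) x)) => //; last first.
  by apply: intbleZ; exact: intble_box.
move=> x; rewrite indicE; case: (boolP (_ \in _)) => [_|xr]; first by rewrite mulr1.
rewrite mulr0 fr ?normr0// ltNge; apply: contra xr => xr.
by rewrite boxE// inE /= (le_trans xr)// ler_norm.
Qed.

Lemma bounded_of_support n (f : 'rV[R]_n -> R) (r : R) : continuous f ->
  (forall x, r < `|x| -> f x = 0) -> exists2 C, 0 <= C & forall x, `|f x| <= C.
Proof.
move=> cf fr.
have cK : compact (closed_ball_ Num.norm (0 : 'rV[R]_n) `|r|).
  apply: bounded_closed_compact; last exact: closed_closed_ball_.
  exists `|r|; split; first exact: num_real.
  by move=> M rM x; rewrite /closed_ball_ /= sub0r normrN => /le_trans; apply; exact: ltW.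
have : bounded_set (f @` closed_ball_ Num.norm (0 : 'rV[R]_n) `|r|).
  apply: compact_bounded; apply: continuous_compact => //.
  exact: continuous_subspaceT.
move=> [M [_ fM]]; exists (`|M| + 1); first by rewrite addr_ge0.
move=> x; have [xr|xr] := leP `|x| r; last by rewrite fr// normr0 addr_ge0.
apply: (fM (`|M| + 1)); first by rewrite (le_lt_trans (ler_norm M))// ltrDl.
by exists x => //; rewrite /closed_ball_ /= sub0r normrN (le_trans xr)// ler_norm.
Qed.

End box_measure.
Arguments box {R} n r.

(** * Correlation with a smooth kernel; integrals of gradients vanish *)

Section correlation.
Variables (R : realType) (n : nat).
Implicit Types (f g w : 'rV[R]_n -> R) (G : 'I_n -> 'rV[R]_n -> R) (C r : R).

Lemma is_derive_oppdir f x v d : is_derive x v f d -> is_derive x (- v) f (- d).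
Proof.
move=> /is_derive_line0 fd; apply/is_derive_line0.
set g := fun s : R => f (x + s *: v) in fd.
have -> : (fun s : R => f (x + s *: - v)) = g \o -%R.
  by apply/funext => s /=; rewrite /g scalerN scaleNr.
have gd' : derivable g (- 0) 1 by rewrite oppr0; case: fd.
have hd' : derivable (-%R : R -> R) 0 1 by exact: ex_derive.
split.
- by apply/derivable1_diffP; apply: differentiable_comp; exact/derivable1_diffP.
- rewrite -derive1E (derive1_comp hd' gd') !derive1E oppr0.
  by case: fd => _ ->; rewrite derive_val mulrN1.
Qed.

(** Dominated convergence speaks of sequences only; this turns its conclusions into continuity. *)
Lemma row_seq_continuous f x :
  (forall u : nat -> 'rV[R]_n, u k @[k --> \oo] --> x -> f (u k) @[k --> \oo] --> f x) ->
  {for x, continuous f}.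
Proof.
move=> H; apply/(@cvgrPdist_lt _ _ _ (nbhs x) (nbhs_filter x)) => e e0.
apply: contrapT => nf.
have /choice[u ux] : forall k : nat, exists y, `|x - y| < k.+1%:R^-1 /\ e <= `|f x - f y|.
  move=> k; apply: contrapT => nk; apply: nf.
  apply/nbhs_ballP; exists k.+1%:R^-1; first by rewrite /= invr_gt0.
  move=> y; rewrite -ball_normE /= => xy; rewrite ltNge; apply/negP => ey.
  by apply: nk; exists y.
have ucv : u k @[k --> \oo] --> x.
  apply/cvgrPdist_lt => d d0.
  near=> k; apply: (lt_trans (ux k).1).
  by near: k; exact: (near_infty_natSinv_lt (PosNum d0)).
have /cvgrPdist_lt/(_ e e0)[k _ /(_ k (leqnn k))] := H u ucv.
by apply/negP; rewrite -leNgt; exact: (ux k).2.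
Unshelve. all: by end_near.
Qed.

(** Correlation instead of convolution: its values are the pairings of [w] with translates of [g],
    and a translate of a test function is again one. Derivatives fall on [g], with a minus sign. *)
Definition corr w g (x : 'rV[R]_n) : R := \int[leb R n]_y (w y * g (y - x)).

Lemma measurable_shift_row g x : measurable_fun setT g ->
  measurable_fun setT (fun y : 'rV[R]_n => g (y - x)).
Proof. by move=> mg; apply: (measurableT_comp mg); exact: measurable_rowD. Qed.

Lemma intble_corr w g x C : intble (leb R n) w -> measurable_fun setT g ->
  (forall y, `|g y| <= C) -> intble (leb R n) (fun y => w y * g (y - x)).
Proof.
by move=> wi mg gC; apply: (intbleM (c := C)) => //; exact: measurable_shift_row.
Qed.

Lemma corr_continuous w g C : intble (leb R n) w -> continuous g ->
  (forall y, `|g y| <= C) -> continuous (corr w g).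
Proof.
move=> wi cg gC x; apply: row_seq_continuous => u ux.
have mg := continuous_measurable_row cg.
have [||||_ //] := @Rintegral_dct _ _ _ (leb R n)
  (fun k y => w y * g (y - u k)) (fun y => w y * g (y - x)) (fun y => C * `|w y|).
- by move=> k; apply: intble_meas; exact: (intble_corr _ wi mg gC).
- move=> y; apply: cvgM; first exact: cvg_cst.
  apply: (cvg_comp (fun k => y - u k) g); last exact: cg.
  by apply: cvgB => //; exact: cvg_cst.
- by move=> k y; rewrite normrM mulrC ler_wpM2r.
- exact/intbleZ/intble_norm.
Qed.

Lemma corr_C1grad w g G C C' : intble (leb R n) w -> C1grad g G ->
  (forall y, `|g y| <= C) -> (forall j y, `|G j y| <= C') ->
  C1grad (corr w g) (fun j x => - corr w (G j) x).
Proof.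
move=> wi gG gC GC j; have [gd Gc] := gG j.
have mg := continuous_measurable_row (C1grad_continuous gG).
split; last first.
  move=> x; apply: (@continuousN _ _ _ _ x); exact: (corr_continuous wi Gc (GC j) (x:=x)).
move=> x; apply/is_derive_line0.
pose F (s : R) (y : 'rV[R]_n) := w y * g (y - (x + s *: ebasis R j)).
have Fd (s : R) y : is_derive (s : R) (1 : R) (F ^~ y) (w y * - G j (y - (x + s *: ebasis R j))).
  have E t : y - (x + t *: ebasis R j) = (y - x) + t *: - ebasis R j.
    by rewrite scalerN opprD addrA.
  have h : is_derive (s : R) (1 : R) (fun t : R => g ((y - x) + t *: - ebasis R j))
      (- G j (y - (x + s *: ebasis R j))).
    by apply/is_derive_line; rewrite E; apply: is_derive_oppdir; exact: gd.
  have -> : F ^~ y = (w y \*: (fun t : R => g ((y - x) + t *: - ebasis R j))).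
    by apply/funext => t; rewrite /F E.
  exact: is_deriveZ.
have I0 : `]-1, 1[%classic (0 : R) by rewrite /= in_itv/= ltrN10 ltr01.
have FD (s : R) y : partial1of2 F s y = w y * - G j (y - (x + s *: ebasis R j)).
  by rewrite partial1of2E; case: (Fd s y).
have Fi (s : R) : `]-1, 1[%classic s -> (leb R n).-integrable setT (EFin \o F s).
  by move=> _; exact: (intble_corr _ wi mg gC).
have Fdr (s : R) (y : 'rV[R]_n) : `]-1, 1[%classic s -> setT y -> derivable (F ^~ y) s 1.
  by move=> _ _; case: (Fd s y).
have G0 (y : 'rV[R]_n) : 0 <= `|w y| * `|C'| by rewrite mulr_ge0.
have Gi : (leb R n).-integrable setT (EFin \o (fun y => `|w y| * `|C'|)).
  have := intbleZ (`|C'|) (intble_norm wi); rewrite /intble.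
  by congr (_.-integrable _ _); apply/funext => y /=; rewrite mulrC.
have Gub (s : R) (y : 'rV[R]_n) : `]-1, 1[%classic s -> setT y ->
    `|partial1of2 F s y| <= `|w y| * `|C'|.
  move=> _ _; rewrite FD normrM normrN ler_wpM2l// (le_trans (GC _ _))//.
  exact: ler_norm.
have D1 := derivable_under_integral measurableT I0 Fi Fdr G0 Gi Gub.
have D2 := differentiation_under_integral measurableT I0 Fi Fdr G0 Gi Gub.
split; first exact: D1.
rewrite -derive1E [LHS]D2 /corr.
rewrite -[RHS]mulN1r -RintegralZl//; last exact: (intble_corr _ wi (continuous_measurable_row Gc) (GC j)).
apply: eq_Rintegral => y _; rewrite FD scale0r addr0; ring.
Qed.

(** Near 0 the correlation of the indicator of a large box with [g] is the integral of [g], by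
    translation invariance, so its derivative at 0 is zero; differentiating under the integral, that
    derivative is also minus the integral of [G j]. *)
Lemma integral_grad0 g G r C C' : C1grad g G -> 
  (forall y, `|g y| <= C) -> (forall j y, `|G j y| <= C') ->
  (forall x, r < `|x| -> g x = 0) ->
  forall j, \int[leb R n]_x G j x = 0.
Proof.
move=> gG gC GC gr j.
have mg := continuous_measurable_row (C1grad_continuous gG).
have Gr i x : r < `|x| -> G i x = 0.
  move=> xr; apply: (C1grad_near0 i gG).
  have : \forall y \near x, r < `|y|.
    exact: (@cvgr_gt _ _ (nbhs x) (nbhs_filter x) (fun y => `|y|) `|x|
      (@norm_continuous _ _ x) r xr).
  by apply: filterS => y /gr.
(* The margin 1 keeps the support of [g] inside the box under every translation of norm less than
   1. *)
pose w : 'rV[R]_n -> R := \1_(box n (`|r| + 1)).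
have wi : intble (leb R n) w by apply: intble_box; rewrite addr_ge0.
have w1 (y : 'rV[R]_n) : `|y| <= `|r| + 1 -> w y = 1.
  by move=> yr; rewrite /w indicE mem_set// boxE ?addr_ge0.
have := corr_C1grad wi gG gC GC j => -[/(_ 0) h _].
have h0 : is_derive (0 : 'rV[R]_n) (ebasis R j) (corr w g) 0.
  pose c := \int[leb R n]_x g x.
  have E : \forall x \near (0 : 'rV[R]_n), corr w g x - c = 0.
    apply/nbhs_ballP; exists 1 => //= x; rewrite -ball_normE /= sub0r normrN => x1.
    apply/eqP; rewrite subr_eq0; apply/eqP; rewrite /c -(Rintegral_shift (- x) mg).
    apply: eq_Rintegral => y _.
    have [yr|yr] := leP `|y| (`|r| + 1); first by rewrite w1 ?mul1r.
    rewrite gr ?mulr0//.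
    have := ler_normB (y - x) (- x); rewrite opprK subrK normrN => h1.
    have := ler_norm r; lra.
  have := is_deriveD (is_derive_near0 (ebasis R j) E) (is_derive_cst c (0 : 'rV[R]_n) (ebasis R j)).
  rewrite addr0; congr is_derive.
  by apply/funext => x /=; rewrite fctE subrK.
have [_ e1] := h; have [_ e2] := h0.
have /eqP := etrans (esym e1) e2; rewrite oppr_eq0 => /eqP <-.
apply: eq_Rintegral => y _; rewrite subr0.
have [yr|yr] := leP `|y| (`|r| + 1); first by rewrite w1 ?mul1r.
by rewrite Gr ?mulr0//; have := ler_norm r; lra.
Qed.

End correlation.

(** * A C^1 approximation of the indicator of the positive axis *)

Section positive_part_square.
Variable R : realType.

Definition sqpos (s : R) : R := Num.max s 0 ^+ 2.
Definition dsqpos (s : R) : R := 2 * Num.max s 0.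

Lemma is_derive_quad (q : R -> R) (s d C : R) :
  (forall h, `|q (s + h) - q s - d * h| <= C * h ^+ 2) ->
  is_derive (s : R) (1 : R) q d.
Proof.
move=> qC.
have E : (fun h : R => h^-1 *: ((q \o shift s) (h *: (1 : R)) - q s)) @ 0^' --> d.
  apply/cvgrPdist_le => e e0.
  have C0 : 0 < `|C| + 1 by rewrite ltr_pwDr.
  have hs : \forall h \near (0 : R), `|h| <= e / (`|C| + 1).
    apply/nbhs_ballP; exists (e / (`|C| + 1)); first by rewrite /= divr_gt0.
    by move=> y; rewrite -ball_normE /= sub0r normrN => /ltW.
  near=> h.
  have h0 : h != 0 by near: h; exact: nbhs_dnbhs_neq.
  have he : `|h| <= e / (`|C| + 1) by near: h; exact: nbhs_dnbhs hs.
  rewrite /= [_%:A]mulr1 [h + s]addrC -[h^-1 *: _]/(h^-1 * _).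
  have -> : d - h^-1 * (q (s + h) - q s) = - (h^-1 * (q (s + h) - q s - d * h)).
    by field.
  rewrite normrN normrM normfV ler_pdivrMl ?normr_gt0//.
  rewrite (le_trans (qC h))// -[h ^+ 2]real_normK ?num_real// expr2 mulrA mulrC.
  rewrite ler_wpM2l// (@le_trans _ _ ((`|C| + 1) * `|h|))//.
    by rewrite ler_wpM2r// (le_trans (ler_norm C))// lerDl.
  by rewrite -ler_pdivlMl// mulrC.
by split; [apply/cvg_ex; exists d|exact: (cvg_lim _ E)].
Unshelve. all: by end_near.
Qed.

Lemma is_derive_sqpos s : is_derive (s : R) (1 : R) sqpos (dsqpos s).
Proof.
apply: (is_derive_quad (C := 1)) => h; rewrite /sqpos /dsqpos mul1r ler_norml.
by case: (leP (s + h) 0) => sh; case: (leP s 0) => s0; apply/andP; split; nra.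
Qed.

Lemma continuous_pos : continuous (fun s : R => Num.max s 0).
Proof. by move=> s; apply: continuous_max; [exact: cvg_id|exact: cvg_cst]. Qed.

Lemma continuous_dsqpos : continuous dsqpos.
Proof. by move=> s; apply: cvgM; [exact: cvg_cst|exact: continuous_pos]. Qed.

Lemma sqpos_ge0 s : 0 <= sqpos s. Proof. exact: sqr_ge0. Qed.

Lemma sqpos_le0 s : s <= 0 -> sqpos s = 0.
Proof. by move=> s0; rewrite /sqpos max_r ?expr0n. Qed.

Lemma sqpos_gt0 s : 0 < s -> sqpos s = s ^+ 2.
Proof. by move=> s0; rewrite /sqpos max_l// ltW. Qed.

(* [step a] is a C^1 function vanishing on the negative axis; as [a -> 0] it tends to the
   indicator of the positive axis while [s * dstep a s] stays bounded and tends to 0. *)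
Definition step (a s : R) : R := sqpos s / (sqpos s + a).
Definition dstep (a s : R) : R := a * dsqpos s / (sqpos s + a) ^+ 2.

Section step.
Variable a : R.
Hypothesis a0 : 0 < a.

Let den s : 0 < sqpos s + a. Proof. by rewrite ltr_wpDl// sqpos_ge0. Qed.

Lemma is_derive_step s : is_derive (s : R) (1 : R) (step a) (dstep a s).
Proof.
have den0 := lt0r_neq0 (den s).
have d1 : is_derive s 1 (fun t => sqpos t + a) (dsqpos s + 0).
  exact: (is_deriveD (is_derive_sqpos s) (is_derive_cst a s 1)).
have d2 := @is_deriveV _ (fun t : R => sqpos t + a) s _ 1 den0 d1.
have := is_deriveM (is_derive_sqpos s) d2.
move=> h; apply: (is_derive_eq h).
rewrite /dstep /= -![_ *: _]/(_ * _).
by field.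
Qed.

Lemma continuous_dstep : continuous (dstep a).
Proof.
move=> s; have den0 := lt0r_neq0 (den s).
have csq : {for s, continuous sqpos}.
  apply: differentiable_continuous; apply/derivable1_diffP.
  by case: (is_derive_sqpos s).
apply: cvgM; first by apply: cvgM; [exact: cvg_cst|exact: continuous_dsqpos].
apply: cvgV; first by rewrite expf_neq0.
by apply: cvgM; apply: cvgD => //; exact: cvg_cst.
Qed.

Lemma step_ge0 s : 0 <= step a s.
Proof. by rewrite divr_ge0 ?sqpos_ge0// ltW. Qed.

Lemma step_le1 s : step a s <= 1.
Proof. by rewrite ler_pdivrMr// mul1r lerDl ltW. Qed.

Lemma dstep_bound s : `|s * dstep a s| <= 2.
Proof.
have dn := den s; rewrite /dstep /dsqpos /sqpos in dn *.
case: (leP s 0) dn => s0 dn; first by rewrite !mulr0 mul0r mulr0 normr0.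
rewrite ger0_norm; last by rewrite mulr_ge0 ?divr_ge0 ?exprn_ge0 ?mulr_ge0// ltW.
by rewrite mulrA ler_pdivrMr ?exprn_gt0//; nra.
Qed.

End step.

Lemma step_cvg s :
  step k.+1%:R^-1 s @[k --> \oo] --> (if 0 < s then 1 else 0 : R).
Proof.
case: ifPn => s0; last first.
  rewrite (_ : (fun k => _) = cst 0); first exact: cvg_cst.
  by apply/funext => k; rewrite /step sqpos_le0 ?mul0r// leNgt.
have q0 : 0 < sqpos s by rewrite sqpos_gt0// exprn_gt0.
have h : sqpos s + k.+1%:R^-1 @[k --> \oo] --> sqpos s.
  rewrite -[in X in _ --> X](addr0 (sqpos s)).
  exact: (cvgD (cvg_cst (sqpos s)) (@cvg_harmonic R)).
rewrite -[in X in _ --> X](divff (lt0r_neq0 q0)).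
apply: cvgM; first exact: cvg_cst.
by apply: cvgV => //; exact: lt0r_neq0.
Qed.

Lemma dstep_cvg s : s * dstep k.+1%:R^-1 s @[k --> \oo] --> (0 : R).
Proof.
have [s0|s0] := leP s 0.
  rewrite (_ : (fun k => _) = cst 0); first exact: cvg_cst.
  by apply/funext => k; rewrite /dstep /dsqpos max_r// !(mulr0, mul0r).
have q0 : 0 < sqpos s by rewrite sqpos_gt0// exprn_gt0.
have h : sqpos s + k.+1%:R^-1 @[k --> \oo] --> sqpos s.
  rewrite -[in X in _ --> X](addr0 (sqpos s)).
  exact: (cvgD (cvg_cst (sqpos s)) (@cvg_harmonic R)).
rewrite -[in X in _ --> X](mulr0 s); apply: cvgM; first exact: cvg_cst.
have -> : 0 = 0 * dsqpos s / sqpos s ^+ 2 :> R by rewrite !mul0r.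
apply: cvgM; first by apply: cvgM; [exact: (@cvg_harmonic R)|exact: cvg_cst].
apply: cvgV; first by rewrite expf_neq0// lt0r_neq0.
exact: (cvgM h h).
Qed.

End positive_part_square.

(** * Mollifiers *)

Section mollifier.
Variables (R : realType) (n : nat).

Record mollifier (r : R) (rho : 'rV[R]_n -> R) := Mollifier {
  moll_C1 : C1N rho ;
  moll_ge0 : forall x, 0 <= rho x ;
  moll_supp : forall x, r < `|x| -> rho x = 0 ;
  moll_int : \int[leb R n]_x rho x = 1 }.

Let q (K : R) (x : 'rV[R]_n) : R := 1 - K * \sum_i x 0 i ^+ 2.

Let C1_q K : exists G, C1grad (q K) G.
Proof.
suff [G hG] : exists G, C1grad (fun x : 'rV[R]_n => \sum_i x 0 i ^+ 2) G.
  by eexists; apply: C1gradB (C1grad_cst 1) (C1gradM (C1grad_cst K) hG).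
elim: (index_enum _) => [|i s [G IH]].
  exists (fun _ _ => 0); rewrite (_ : (fun x => _) = fun=> 0).
    exact: C1grad_cst.
  by apply/funext => x; rewrite big_nil.
have h := C1gradD (C1gradM (C1grad_coord R i) (C1grad_coord R i)) IH.
rewrite (_ : (fun x : 'rV[R]_n => \sum_(j <- i :: s) x 0 j ^+ 2) =
  (fun x => x 0 i * x 0 i + \sum_(j <- s) x 0 j ^+ 2)).
  by eexists; exact: h.
by apply/funext => x; rewrite big_cons expr2.
Qed.

(** Test fields are only required to be C^1, so the squared positive part of the paraboloid
    [1 - r ^- 2 * \sum_i x 0 i ^+ 2], normalized, is smooth enough. *)
Lemma mollifierP (r : R) : 0 < r -> exists rho, mollifier r rho.
Proof.
move=> r0; pose K : R := r ^- 2; pose b x := sqpos (q K x).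
have K0 : 0 < K by rewrite invr_gt0 exprn_gt0.
have [G hG] := C1_q K.
have bC : C1grad b (fun j x => dsqpos (q K x) * G j x).
  exact: C1grad_comp (@is_derive_sqpos R) (@continuous_dsqpos R) hG.
have bs x : r < `|x| -> b x = 0.
  move=> rx; apply: sqpos_le0; rewrite /q subr_le0.
  have [i ri] : exists i, r < `|x 0 i|.
    apply: contrapT => /forallNP nx; move: rx; rewrite ltNge => /negP; apply.
    by apply: row_norm_le => [|i]; [exact: ltW|rewrite leNgt; exact/negP].
  rewrite -[1](mulVf (lt0r_neq0 (exprn_gt0 2 r0))) ler_wpM2l// ?(ltW K0)//.
  rewrite (bigD1 i)//= -[x 0 i ^+ 2]real_normK ?num_real//.
  rewrite (@le_trans _ _ (`|x 0 i| ^+ 2))// ?lerDl ?sumr_ge0//.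
    by rewrite lerXn2r// ?nnegrE ltW.
  by move=> j _; exact: sqr_ge0.
have cb := C1grad_continuous bC.
have mb := continuous_measurable_row cb.
have [C C0 bb] := bounded_of_support cb bs.
have bi : intble (leb R n) b by exact: (intble_bounded_support mb bb bs).
have I0 : 0 < \int[leb R n]_x b x.
  (* A half-width for which [q K] is at least 1/2, hence [b] at least 1/4, on the box; [t <= 1]
     allows [t ^+ 2] to be bounded by [t]. *)
  pose t : R := (K * (n%:R + 1) * 2 + 1)^-1.
  have t0' : 0 < K * (n%:R + 1) * 2 + 1 by rewrite ltr_pwDr// !mulr_ge0 ?addr_ge0// ltW.
  have t0 : 0 < t by rewrite invr_gt0.
  have t1 : t <= 1.
    by rewrite invf_le1// lerDr !mulr_ge0 ?addr_ge0// ltW.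
  apply: (@lt_le_trans _ _ (\int[leb R n]_x (4^-1 * \1_(box n t) x))).
    rewrite RintegralZl//; last exact: (intble_box _ (ltW t0)).
    rewrite mulr_gt0// /Rintegral integral_indic; [|by []|exact: measurable_box].
    rewrite setIT (_ : fine _ = (t *+ 2) ^+ n); first by rewrite exprn_gt0// mulrn_wgt0.
    by rewrite [X in fine X](leb_box n (ltW t0)).
  apply: le_Rintegral => //; first exact: (intbleZ _ (intble_box _ (ltW t0))).
  move=> x _; rewrite indicE; case: (boolP (_ \in _)) => [|_]; last first.
    by rewrite mulr0 sqpos_ge0.
  rewrite inE /= => xt.
  have S : \sum_i x 0 i ^+ 2 <= (n%:R + 1) * t.
    apply: (@le_trans _ _ (\sum_(i < n) t)).
      apply: ler_sum => i _; rewrite -[x 0 i ^+ 2]real_normK ?num_real//.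
      apply: (@le_trans _ _ (t ^+ 2)); first by rewrite lerXn2r ?nnegrE// ltW.
      by rewrite expr2 ler_piMl// ltW.
    by rewrite sumr_const card_ord -[_ *+ _]mulr_natl ler_wpM2r ?(ltW t0)// lerDl.
  have qx : 2^-1 <= q K x.
    rewrite /q; have : K * \sum_i x 0 i ^+ 2 <= K * ((n%:R + 1) * t).
      by rewrite ler_wpM2l// ltW.
    have : K * ((n%:R + 1) * t) <= 2^-1.
      by rewrite mulrA /t ler_pdivrMr//; lra.
    lra.
  have q0 : 0 < q K x by rewrite (lt_le_trans _ qx).
  by rewrite /b sqpos_gt0// mulr1; nra.
pose c := (\int[leb R n]_x b x)^-1.
have c0 : 0 < c by rewrite invr_gt0.
exists (fun x => c * b x); split.
- exact: C1grad_C1N (C1gradM (C1grad_cst c) bC).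
- by move=> x; rewrite mulr_ge0 ?sqpos_ge0// ltW.
- by move=> x xr; rewrite bs// mulr0.
- by rewrite RintegralZl// /c mulVf// lt0r_neq0.
Qed.

End mollifier.

(** Integrability on the product is deduced from an integrable bound [B] of the inner absolute
    integrals. All sections, not just almost all, are integrable here, so every inner integral is a
    genuine real number. *)
Lemma Rfubini d1 d2 (T1 : measurableType d1) (T2 : measurableType d2) (R : realType)
    (m1 : {sigma_finite_measure set T1 -> \bar R})
    (m2 : {sigma_finite_measure set T2 -> \bar R})
    (F : T1 -> T2 -> R) (B : T2 -> R) :
  measurable_fun setT (fun p : T1 * T2 => F p.1 p.2) ->
  (forall x, intble m2 (F x)) -> (forall z, intble m1 (F^~ z)) ->
  (forall z, \int[m1]_x `|F x z| <= B z) -> intble m2 B ->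
  [/\ intble m1 (fun x => \int[m2]_z F x z),
      intble m2 (fun z => \int[m1]_x F x z) &
      \int[m1]_x \int[m2]_z F x z = \int[m2]_z \int[m1]_x F x z].
Proof.
move=> mF F1 F2 FB iB.
pose f (p : T1 * T2) := (F p.1 p.2)%:E.
have mf : measurable_fun setT f by exact/measurable_EFinP.
have mfa : measurable_fun setT (fun p => `|f p|%E) by exact: measurableT_comp.
have fi : (product_measure1 m1 m2).-integrable setT f.
  apply/(integrable21ltyP _ _ mf).
  have E z : (\int[m1]_x `|f (x, z)| = (\int[m1]_x `|F x z|)%:E)%E.
    by rewrite intbleE//; exact/intble_norm/F2.
  rewrite (eq_integral (fun z => (\int[m1]_x `|F x z|)%:E)); last by move=> z _; rewrite E.
  have mI : measurable_fun setT (fun z => (\int[m1]_x `|F x z|)%:E).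
    rewrite (_ : (fun z => _) = (fun z => \int[m1]_x `|f (x, z)|)%E).
      exact: (measurable_fun_fubini_tonelli_G (fun p => `|f p|%E)).
    by apply/funext => z; rewrite E.
  apply: (@le_lt_trans _ _ (\int[m2]_z (`|B z|)%:E)%E).
    apply: ge0_le_integral => //.
    - by move=> z _; rewrite lee_fin Rintegral_ge0.
    - by apply/measurable_EFinP; apply: measurableT_comp => //; exact: intble_meas iB.
    - by move=> z _; rewrite lee_fin (le_trans (FB z))// ler_norm.
  by have [_] := (intbleP _ _).1 iB.
have E1 x : (\int[m2]_z f (x, z) = (\int[m2]_z F x z)%:E)%E by rewrite intbleE.
have E2 z : (\int[m1]_x f (x, z) = (\int[m1]_x F x z)%:E)%E by rewrite intbleE.
have i1 : intble m1 (fun x => \int[m2]_z F x z).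
  have := integrable_fubini_F fi; congr (_.-integrable _ _).
  by apply/funext => x; rewrite /= -E1.
have i2 : intble m2 (fun z => \int[m1]_x F x z).
  apply: (intble_le _ _ iB) => [|z].
    apply/measurable_EFinP; rewrite (_ : _ \o _ = fun z => \int[m1]_x f (x, z))%E.
      exact: (measurable_fubini_G fi).
    by apply/funext => z; rewrite /= E2.
  rewrite (le_trans _ (FB z))//; exact: (le_normr_Rintegral measurableT (F2 z)).
split => //; have := Fubini fi.
rewrite (eq_integral (fun x => (\int[m2]_z F x z)%:E)); last by move=> x _; rewrite E1.
rewrite [X in _ = X -> _](eq_integral (fun z => (\int[m1]_x F x z)%:E)); last first.
  by move=> z _; rewrite E2.
by rewrite -!intbleE// => -[].
Qed.

(** * Approximation in L^1 by mollification *)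

Section mollification.
Variables (R : realType) (n : nat).
Notation m := (leb R n).
Implicit Types (u h rho : 'rV[R]_n -> R) (r C e : R).

Lemma mollifier_data r rho : mollifier r rho -> exists G C, [/\ C1grad rho G,
  forall x, `|rho x| <= C, forall j x, `|G j x| <= C & intble m rho].
Proof.
move=> [/C1N_grad rC r0 rs r1]; exists (fun j x => 'D_(ebasis R j) rho x).
have cr := C1grad_continuous rC.
have [C C0 rb] := bounded_of_support cr rs.
have Gb j : exists C', forall x, `|'D_(ebasis R j) rho x| <= C'.
  have [_ Gc] := rC j.
  have [x xr|C' _ ?] := bounded_of_support Gc (r := r); last by exists C'.
  apply: (C1grad_near0 j rC).
  have : \forall y \near x, r < `|y|.
    exact: (@cvgr_gt _ _ (nbhs x) (nbhs_filter x) (fun y => `|y|) `|x|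
      (@norm_continuous _ _ x) r xr).
  by apply: filterS => y /rs.
have [C' GC] := choice Gb.
exists (C + \sum_j `|C' j|); split => //.
- by move=> x; rewrite (le_trans (rb x))// lerDl sumr_ge0.
- move=> j x; rewrite (le_trans (GC j x))// (le_trans (ler_norm _))//.
  by rewrite (bigD1 j)//= addrCA lerDl addr_ge0// sumr_ge0.
- exact: (intble_bounded_support (continuous_measurable_row cr) rb rs).
Qed.

Lemma measurable_addr_pair u : measurable_fun setT u ->
  measurable_fun setT (fun p : 'rV[R]_n * 'rV[R]_n => u (p.1 + p.2)).
Proof. by move=> mu_; apply: (measurableT_comp mu_); exact: measurable_rowD. Qed.

Lemma corrE u rho x : measurable_fun setT u -> measurable_fun setT rho ->
  corr u rho x = \int[m]_z (rho z * u (x + z)).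
Proof.
move=> mu_ mr; rewrite /corr -(Rintegral_shift x); last first.
  by apply: measurable_funM => //; exact: measurable_shift_row.
by apply: eq_Rintegral => z _; rewrite addrK mulrC [z + x]addrC.
Qed.

Lemma intble_shiftl u z : intble m u -> intble m (fun x => u (x + z)).
Proof. by move=> ui; exact: integrable_shift. Qed.

(** Expresses a pairing with the mollified function as the average, with weight [rho], of the
    pairings with the translates of [u]; estimates uniform over translates then pass to
    [corr u rho]. *)
Lemma corr_fubini u rho h r C : intble m u -> mollifier r rho ->
  measurable_fun setT h -> (forall x, `|h x| <= C) ->
  intble m (fun x => corr u rho x * h x) /\
  \int[m]_x (corr u rho x * h x) = \int[m]_z (rho z * \int[m]_x (u (x + z) * h x)) /\
  intble m (fun z => rho z * \int[m]_x (u (x + z) * h x)).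
Proof.
move=> ui rm mh hC; have [G [C' [rC rb Gb ri]]] := mollifier_data rm.
have mu_ := intble_meas ui; have mr := intble_meas ri.
have C0 : 0 <= C by rewrite (le_trans _ (hC 0)).
pose F (x z : 'rV[R]_n) := rho z * u (x + z) * h x.
have uxi x : intble m (fun z => rho z * u (x + z)).
  have uz : intble m (fun z => u (x + z)).
    by under eq_fun do rewrite addrC; exact: intble_shiftl.
  by have := intbleM uz mr rb; under eq_fun do rewrite mulrC.
have uhi z : intble m (fun x => u (x + z) * h x).
  exact: (intbleM (intble_shiftl z ui) mh hC).
have iF2 z : intble m (F^~ z).
  by rewrite /F; under eq_fun do rewrite -mulrA; exact: intbleZ.
have [] := @Rfubini _ _ _ _ _ m m F (fun z => (C * \int[m]_x `|u x|) * rho z).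
- apply: measurable_funM; last exact: (measurableT_comp mh measurable_fst).
  apply: measurable_funM; first exact: (measurableT_comp mr measurable_snd).
  exact: measurable_addr_pair.
- by move=> x; rewrite /F; under eq_fun do rewrite mulrC; exact: intbleZ.
- exact: iF2.
- move=> z; apply: (@le_trans _ _ (\int[m]_x (rho z * C * `|u (x + z)|))).
    apply: le_Rintegral => //; first exact/intble_norm/iF2.
      exact/intbleZ/intble_norm/intble_shiftl.
    move=> x _; rewrite /F !normrM (ger0_norm (moll_ge0 rm z)).
    rewrite mulrAC ler_wpM2r// ler_wpM2l//; exact: (moll_ge0 rm z).
  rewrite RintegralZl//; last exact/intble_norm/intble_shiftl.
  rewrite (Rintegral_shift z (f := fun x => `|u x|)); last exact: measurableT_comp.
  by rewrite -mulrA mulrC.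
- exact: intbleZ.
have E1 : (fun x => \int[m]_z F x z) = (fun x => corr u rho x * h x).
  apply/funext => x; rewrite /F corrE// mulrC -RintegralZl//; last exact: uxi.
  by apply: eq_Rintegral => y _; rewrite mulrC.
have E2 : (fun z => \int[m]_x F x z) = (fun z => rho z * \int[m]_x (u (x + z) * h x)).
  apply/funext => z; rewrite -RintegralZl//; last exact: uhi.
  by apply: eq_Rintegral => y _; rewrite /F mulrA.
by rewrite E1 E2.
Qed.

Lemma intble_corr_moll u rho r : intble m u -> mollifier r rho -> intble m (corr u rho).
Proof.
move=> ui rm.
have h1 (x : 'rV[R]_n) : `|cst 1 x| <= 1 :> R by rewrite normr1.
have [+ _] := corr_fubini ui rm (measurable_cst (1 : R)) h1.
by under eq_fun do rewrite mulr1.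
Qed.

(** The uniform form of [shift_cvg]: shifts violating it at every scale would form a sequence
    tending to 0. *)
Lemma shift_small u e : intble m u -> 0 < e ->
  exists2 d, 0 < d & forall z, `|z| <= d -> \int[m]_x `|u (x + z) - u x| <= e.
Proof.
move=> ui e0; apply: contrapT => nd.
have /choice[z zP] : forall k : nat, exists z : 'rV[R]_n,
    `|z| <= k.+1%:R^-1 /\ e < \int[m]_x `|u (x + z) - u x|.
  move=> k; apply: contrapT => nk; apply: nd; exists k.+1%:R^-1; first by rewrite invr_gt0.
  by move=> z zk; rewrite leNgt; apply/negP => ez; apply: nk; exists z.
have z0 i : z k 0 i @[k --> \oo] --> (0 : R).
  apply/cvgrPdist_lt => d d0; near=> k; rewrite sub0r normrN.
  apply: (le_lt_trans (row_norm_ge _ _)); apply: (le_lt_trans (zP k).1).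
  by near: k; exact: (near_infty_natSinv_lt (PosNum d0)).
have /cvgrPdist_lt/(_ e e0)[k _ /(_ k (leqnn k))] := shift_cvg ui z0.
rewrite /= sub0r normrN ger0_norm ?Rintegral_ge0// ltNge => /negP; apply.
exact/ltW/(zP k).2.
Unshelve. all: by end_near.
Qed.

(** Since [rho] has unit mass, the error is an average of the differences [u (x + z) - u x] over
    [|z| <= r]; Fubini moves the average outside the norm. *)
Lemma corr_close u rho r e : intble m u -> mollifier r rho ->
  (forall z, `|z| <= r -> \int[m]_x `|u (x + z) - u x| <= e) ->
  \int[m]_x `|corr u rho x - u x| <= e.
Proof.
move=> ui rm ue; have [G [C' [rC rb Gb ri]]] := mollifier_data rm.
have mu_ := intble_meas ui; have mr := intble_meas ri.
pose F (x z : 'rV[R]_n) := rho z * (u (x + z) - u x).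
have uxi x : intble m (fun z => rho z * u (x + z)).
  have uz : intble m (fun z => u (x + z)).
    by under eq_fun do rewrite addrC; exact: intble_shiftl.
  by have := intbleM uz mr rb; under eq_fun do rewrite mulrC.
have rxi x : intble m (fun z => rho z * u x).
  by under eq_fun do rewrite mulrC; exact: intbleZ.
have iF1 x : intble m (F x).
  by rewrite /F; under eq_fun do rewrite mulrBr; exact: intbleB.
have iD z : intble m (fun x => u (x + z) - u x) by apply: intbleB => //; exact: intble_shiftl.
have iF2 z : intble m (F^~ z) by exact: intbleZ.
have mF : measurable_fun setT (fun p : 'rV[R]_n * 'rV[R]_n => F p.1 p.2).
  apply: measurable_funM; first exact: (measurableT_comp mr measurable_snd).
  apply: measurable_funB; first exact: measurable_addr_pair.
  exact: (measurableT_comp mu_ measurable_fst).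
have FB z : \int[m]_x `| `|F x z| | <= e * rho z.
  rewrite (@eq_Rintegral _ _ _ m setT (fun x => rho z * `|u (x + z) - u x|)); last first.
    by move=> x _; rewrite normr_id /F normrM (ger0_norm (moll_ge0 rm z)).
  rewrite RintegralZl//; last exact: intble_norm.
  have [zr|zr] := leP `|z| r; last by rewrite (moll_supp rm zr) mul0r mulr0.
  by rewrite mulrC ler_wpM2r ?ue// (moll_ge0 rm z).
have [] := @Rfubini _ _ _ _ _ m m (fun x z => `|F x z|) (fun z => e * rho z).
- exact: measurableT_comp.
- by move=> x; exact: intble_norm.
- by move=> z; exact/intble_norm/iF2.
- exact: FB.
- exact: intbleZ.
move=> i1 i2 FE.
have ci : intble m (fun x => `|corr u rho x - u x|).
  exact: (intble_norm (intbleB (intble_corr_moll ui rm) ui)).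
have cF x : corr u rho x - u x = \int[m]_z F x z.
  transitivity (\int[m]_z (rho z * u (x + z)) - \int[m]_z (rho z * u x)).
    by rewrite (RintegralZr _ measurableT ri) (moll_int rm) mul1r (corrE x mu_ mr).
  rewrite -(RintegralB measurableT (uxi x) (rxi x)).
  by apply: eq_Rintegral => z _; rewrite /F mulrBr.
apply: (@le_trans _ _ (\int[m]_x \int[m]_z `|F x z|)).
  apply: (le_Rintegral measurableT ci i1) => x _; rewrite cF.
  exact: (le_normr_Rintegral measurableT (iF1 x)).
rewrite FE; apply: (@le_trans _ _ (\int[m]_z (e * rho z))).
  apply: (le_Rintegral measurableT i2 (intbleZ e ri)) => z _; rewrite (le_trans _ (FB z))//.
  by rewrite [leRHS](@eq_Rintegral _ _ _ m setT (fun x => `|F x z|))// => x _; rewrite normr_id.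
by rewrite (RintegralZl _ measurableT ri) (moll_int rm) mulr1.
Qed.

End mollification.

(** * Total variation *)

Section test_fields.
Variables (R : realType) (n : nat).
Notation m := (leb R n).
Implicit Types (u v w : 'rV[R]_n -> R) (phi psi : 'I_n -> 'rV[R]_n -> R) (c r C : R).

Lemma near_norm_gt (x : 'rV[R]_n) r : r < `|x| -> \forall y \near x, r < `|y|.
Proof.
move=> xr; exact: (@cvgr_gt _ _ (nbhs x) (nbhs_filter x) (fun y => `|y|) `|x|
  (@norm_continuous _ _ x) r xr).
Qed.

Lemma C1grad_support g (G : 'I_n -> 'rV[R]_n -> R) r : C1grad g G ->
  (forall x, r < `|x| -> g x = 0) ->
  (forall j x, r < `|x| -> G j x = 0) /\
  exists C, (forall x, `|g x| <= C) /\ (forall j x, `|G j x| <= C).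
Proof.
move=> gG gr.
have Gr j x : r < `|x| -> G j x = 0.
  move=> xr; apply: (C1grad_near0 j gG).
  by have := near_norm_gt xr; apply: filterS => y /gr.
split => //.
have [C C0 gb] := bounded_of_support (C1grad_continuous gG) gr.
have /choice[C' GC] : forall j, exists C', forall x, `|G j x| <= C'.
  move=> j; have [_ Gc] := gG j.
  by have [C' _ ?] := bounded_of_support Gc (Gr j); exists C'.
exists (C + \sum_j `|C' j|); split.
- by move=> x; rewrite (le_trans (gb x))// lerDl sumr_ge0.
- move=> j x; rewrite (le_trans (GC j x))// (le_trans (ler_norm _))//.
  by rewrite (bigD1 j)//= addrCA lerDl addr_ge0// sumr_ge0.
Qed.

Lemma test_fieldP phi : test_field phi -> exists r C,
  [/\ (forall i, C1grad (phi i) (fun j x => 'D_(ebasis R j) (phi i) x)),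
      (forall x, r < `|x| -> forall i, phi i x = 0),
      continuous (divergence phi),
      (forall x, r < `|x| -> divergence phi x = 0) &
      0 <= C /\ (forall x, `|divergence phi x| <= C)].
Proof.
move=> [pC [pK p1]].
have pG i := C1N_grad (pC i).
have [M [_ KM]] := compact_bounded pK.
pose r := `|M| + 1; exists r.
have pr x : r < `|x| -> forall i, phi i x = 0.
  move=> xr i; apply/eqP; apply: contraTT xr => pix; rewrite -leNgt.
  apply: (KM r); first by rewrite (le_lt_trans (ler_norm M))// ltrDl.
  by apply: subset_closure; exists i.
have dc : continuous (divergence phi).
  rewrite /divergence; elim: (index_enum _) => [|i s IH] x.
    under eq_fun do rewrite big_nil; exact: cst_continuous.
  under eq_fun do rewrite big_cons.
  by have [_ cG] := pG i i; exact: (continuousD (cG x) (IH x)).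
have dr x : r < `|x| -> divergence phi x = 0.
  move=> xr; rewrite /divergence big1// => i _.
  have [Gr _] := C1grad_support (pG i) (fun y yr => pr y yr i).
  exact: (Gr i x xr).
have [C C0 dC] := bounded_of_support dc dr.
by exists C; split.
Qed.

Lemma enorm_le1 (x : 'rV[R]_n) : (enorm x <= 1) = (\sum_i x 0 i ^+ 2 <= 1).
Proof. by rewrite /enorm -[X in _ <= X]sqrtr1 ler_sqrt// ler01. Qed.

Lemma test_field_le1 phi x : test_field phi -> \sum_i phi i x ^+ 2 <= 1.
Proof.
move=> [_ [_ /(_ x)]]; rewrite enorm_le1.
by under eq_bigr do rewrite mxE.
Qed.

Lemma test_field_norm1 phi i x : test_field phi -> `|phi i x| <= 1.
Proof.
move=> tp; have := test_field_le1 x tp; rewrite (bigD1 i)//= => h.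
rewrite -(@ler_pXn2r _ 2)// ?nnegrE// expr1n real_normK ?num_real//.
apply: le_trans h; rewrite lerDl; apply: sumr_ge0 => j _; exact: sqr_ge0.
Qed.

Lemma test_field_intro phi (G : 'I_n -> 'I_n -> 'rV[R]_n -> R) r :
  (forall i, C1grad (phi i) (G i)) -> (forall x, r < `|x| -> forall i, phi i x = 0) ->
  (forall x, \sum_i phi i x ^+ 2 <= 1) ->
  test_field phi /\ forall x, divergence phi x = \sum_i G i i x.
Proof.
move=> pG pr p1; split; last first.
  by move=> x; apply: eq_bigr => i _; exact: C1gradE.
split; first by move=> i; exact: C1grad_C1N (pG i).
split; last by move=> x; rewrite enorm_le1; under eq_bigr do rewrite mxE.
apply: bounded_closed_compact; last exact: closed_closure.
have sub : closure [set x | exists i, phi i x != 0] `<=` closed_ball_ Num.norm (0 : 'rV[R]_n) r.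
  rewrite [X in _ `<=` X](closure_id _).1; last exact: closed_closed_ball_.
  apply: closureS.
  move=> x [i pix]; rewrite /closed_ball_ /= sub0r normrN leNgt; apply/negP => xr.
  by move: pix; rewrite pr ?eqxx.
exists r; split; first exact: num_real.
by move=> M rM x /sub; rewrite /closed_ball_ /= sub0r normrN => /le_trans; apply; exact: ltW.
Qed.

Lemma test_field_shift phi a : test_field phi ->
  test_field (fun i x => phi i (x + a)) /\
  forall x, divergence (fun i x => phi i (x + a)) x = divergence phi (x + a).
Proof.
move=> tp; have [r [C [pG pr _ _ _]]] := test_fieldP tp.
apply: (@test_field_intro _ (fun i j x => 'D_(ebasis R j) (phi i) (x + a)) (`|r| + `|a|)).
- by move=> i; exact: (C1grad_shift a (pG i)).
- move=> x xr i; apply: pr; rewrite (le_lt_trans (ler_norm r))//.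
  have := ler_normB (x + a) a; rewrite addrK => h; lra.
- by move=> x; exact: test_field_le1.
Qed.

Lemma test_field0 : test_field (fun (_ : 'I_n) (_ : 'rV[R]_n) => 0).
Proof.
have [] // := @test_field_intro (fun _ _ => 0) (fun _ _ _ => 0) 0.
- by move=> i; exact: C1grad_cst.
- by move=> x; rewrite big1// => i _; rewrite expr0n.
Qed.

Lemma divergence0 (x : 'rV[R]_n) : divergence (fun (_ : 'I_n) (_ : 'rV[R]_n) => 0) x = 0.
Proof. by rewrite /divergence big1// => i _; exact: (C1gradE _ _ (C1grad_cst 0)). Qed.

Lemma measurable_div phi : test_field phi -> measurable_fun setT (divergence phi).
Proof. by move=> /test_fieldP[r [C [_ _ dc _ _]]]; exact: continuous_measurable_row. Qed.

Lemma intble_div phi : test_field phi -> intble m (divergence phi).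
Proof.
move=> tp; have [r [C [_ _ dc dr [_ dC]]]] := test_fieldP tp.
exact: (intble_bounded_support (measurable_div tp) dC dr).
Qed.

Lemma intble_mul_div u phi : intble m u -> test_field phi ->
  intble m (fun x => u x * divergence phi x).
Proof.
move=> ui tp; have [r [C [_ _ _ _ [_ dC]]]] := test_fieldP tp.
exact: (intbleM ui (measurable_div tp) dC).
Qed.

Lemma integral_divergence phi : test_field phi -> \int[m]_x divergence phi x = 0.
Proof.
move=> tp; have [r [C [pG pr _ _ _]]] := test_fieldP tp.
have pb i := C1grad_support (pG i) (fun y yr => pr y yr i).
rewrite /divergence Rintegral_sum; last first.
  move=> i; have [Gr [C' [gC GC]]] := pb i; have [_ Gc] := pG i i.
  exact: (intble_bounded_support (continuous_measurable_row Gc) (GC i) (Gr i)).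
rewrite big1// => i _; have [Gr [C' [gC GC]]] := pb i.
exact: (integral_grad0 (pG i) gC GC (fun y yr => pr y yr i)).
Qed.

(* Real-valued upper bounds for the total variation, so that inequalities
   between sums of total variations involve no infinite values. *)
Definition TVle u c := forall phi, test_field phi -> \int[m]_x (u x * divergence phi x) <= c.

Lemma total_variation_le u (c : \bar R) : intble m u ->
  (Defs.total_variation u <= c)%E <->
  forall phi, test_field phi -> ((\int[m]_x (u x * divergence phi x))%:E <= c)%E.
Proof.
move=> ui.
have E phi : test_field phi ->
    iint (fun x => (u x * divergence phi x)%:E) = (\int[m]_x (u x * divergence phi x))%:E.
  move=> tp; have ip := intble_mul_div ui tp.
  by rewrite iint_integrable// intbleE.
split => [h phi tp|h].
  by apply: le_trans h; apply: ereal_sup_ubound; exists phi; rewrite E.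
by apply: ub_ereal_sup => _ [phi [tp ->]]; rewrite E//; exact: h.
Qed.

Lemma TVleP u c : intble m u -> (Defs.total_variation u <= c%:E)%E <-> TVle u c.
Proof.
by move=> ui; rewrite total_variation_le.
Qed.

Lemma TVle_ge0 u c : TVle u c -> 0 <= c.
Proof.
move=> /(_ _ test_field0); rewrite /Rintegral integral0_eq// => x _.
by rewrite divergence0 mulr0.
Qed.

Lemma TVleZ u a c : intble m u -> 0 <= a -> TVle u c -> TVle (fun x => a * u x) (a * c).
Proof.
move=> ui a0 uc phi tp; rewrite (@eq_Rintegral _ _ _ m setT (fun x => a * (u x * divergence phi x))).
  by rewrite (RintegralZl _ measurableT (intble_mul_div ui tp)) ler_wpM2l// uc.
by move=> y _; rewrite mulrA.
Qed.

(** For a fixed field the pairing passes to the limit by dominated convergence, the divergence being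
    bounded; an upper bound valid for every field survives. *)
Lemma TVle_lsc (u_ : nat -> 'rV[R]_n -> R) u w c :
  (forall k, measurable_fun setT (u_ k)) -> (forall x, u_ k x @[k --> \oo] --> u x) ->
  (forall k x, `|u_ k x| <= w x) -> intble m w ->
  (\forall k \near \oo, TVle (u_ k) c) -> TVle u c.
Proof.
move=> mu_ uu uw wi uc phi tp; have [r [C [_ _ _ _ [C0 dC]]]] := test_fieldP tp.
have [||||_ h] := @Rintegral_dct _ _ _ m (fun k x => u_ k x * divergence phi x)
  (fun x => u x * divergence phi x) (fun x => C * w x).
- by move=> k; apply: measurable_funM => //; exact: measurable_div.
- by move=> x; apply: cvgM; [exact: uu|exact: cvg_cst].
- by move=> k x; rewrite normrM mulrC ler_pM.
- exact: intbleZ.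
have <- := cvg_lim (@Rhausdorff R) h.
apply: limr_le; first by apply/cvg_ex; eexists; exact: h.
by near=> k; apply: (_ : TVle (u_ k) c) => //; near: k.
Unshelve. all: by end_near.
Qed.

Lemma TVle_shift u c a : intble m u -> TVle u c -> TVle (fun x => u (x + a)) c.
Proof.
move=> ui uc phi tp; have [tpa dpa] := test_field_shift (- a) tp.
apply: le_trans (uc _ tpa).
rewrite -(Rintegral_shift a (intble_meas (intble_mul_div ui tpa))).
by under [leRHS]eq_Rintegral do rewrite dpa addrK.
Qed.

(** An average of translates, each of which has the bound [c]. *)
Lemma TVle_corr u rho r c : intble m u -> mollifier r rho -> TVle u c -> TVle (corr u rho) c.
Proof.
move=> ui rm uc phi tp; have [r' [C [_ _ _ _ [C0 dC]]]] := test_fieldP tp.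
have [G [C' [rC rb Gb ri]]] := mollifier_data rm.
have [i1 [-> i2]] := corr_fubini ui rm (measurable_div tp) dC.
apply: (@le_trans _ _ (\int[m]_z (c * rho z))).
  apply: (le_Rintegral measurableT i2 (intbleZ c ri)) => z _.
  rewrite mulrC ler_wpM2r ?(moll_ge0 rm)//.
  exact: (TVle_shift z ui uc).
by rewrite (RintegralZl _ measurableT ri) (moll_int rm) mulr1.
Qed.

End test_fields.

Lemma Rintegral_lin3 d (T : measurableType d) (R : realType)
    (mu : {measure set T -> \bar R}) (f g h : T -> R) (c : R) :
  intble mu f -> intble mu g -> intble mu h ->
  \int[mu]_x (f x + (g x + c * h x)) =
  \int[mu]_x f x + (\int[mu]_x g x + c * \int[mu]_x h x).
Proof.
move=> fi gi hi; rewrite RintegralD//; last exact: (intbleD gi (intbleZ c hi)).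
by rewrite RintegralD ?RintegralZl//; exact: intbleZ.
Qed.

(** * Submodularity of the total variation *)

Section submodularity.
Variables (R : realType) (n : nat).
Notation m := (leb R n).
Implicit Types (u v w : 'rV[R]_n -> R) (phi psi : 'I_n -> 'rV[R]_n -> R) (a b c r C : R).

(** Meant for functions such as [max (u, v + c)], which need not be integrable; the compact support
    of the divergence takes care of the constant. *)
Lemma intble_mul_div_loc u w c phi : measurable_fun setT u -> intble m w ->
  (forall x, 0 <= w x) -> (forall x, `|u x| <= w x + c) -> test_field phi ->
  intble m (fun x => u x * divergence phi x).
Proof.
move=> mu_ wi w0 uw tp; have [r [C [_ _ _ dr [C0 dC]]]] := test_fieldP tp.
apply: (intble_le (f := fun x => C * w x + c * `|divergence phi x|)).
- by apply: measurable_funM => //; exact: measurable_div.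
- move=> x; rewrite normrM.
  apply: (@le_trans _ _ ((w x + c) * `|divergence phi x|)); first by rewrite ler_wpM2r.
  by rewrite mulrDl lerD2r mulrC ler_wpM2r.
- by apply: intbleD; apply: intbleZ => //; apply: intble_norm; exact: intble_div.
Qed.

Let mix_sqr (s p q : R) : 0 <= s -> s <= 1 ->
  (s * p + (1 - s) * q) ^+ 2 <= s * p ^+ 2 + (1 - s) * q ^+ 2.
Proof.
move=> s0 s1; rewrite -subr_ge0.
have -> : s * p ^+ 2 + (1 - s) * q ^+ 2 - (s * p + (1 - s) * q) ^+ 2 =
  s * (1 - s) * (p - q) ^+ 2 by ring.
by rewrite mulr_ge0 ?sqr_ge0// mulr_ge0// subr_ge0.
Qed.

(** The Euclidean unit ball is convex, so a pointwise convex combination is still admissible. The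
    price is the last sum, the gradient of the weight against [phi - psi]. *)
Lemma test_field_mix (s : 'rV[R]_n -> R) (S : 'I_n -> 'rV[R]_n -> R) phi psi :
  C1grad s S -> (forall x, 0 <= s x <= 1) -> test_field phi -> test_field psi ->
  let chi := fun i x => s x * phi i x + (1 - s x) * psi i x in
  test_field chi /\ forall x, divergence chi x =
    s x * divergence phi x + (1 - s x) * divergence psi x
    + \sum_i S i x * (phi i x - psi i x).
Proof.
move=> sS s01 tp tq chi.
have [r [C [pG pr _ _ _]]] := test_fieldP tp.
have [r' [C' [qG qr _ _ _]]] := test_fieldP tq.
have G i := C1gradD (C1gradM sS (pG i)) (C1gradM (C1gradB (C1grad_cst (1:R)) sS) (qG i)).
have [] := test_field_intro (r := Num.max r r') G.
- move=> x; rewrite gt_max => /andP[xr xr'] i.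
  by rewrite pr// qr// !mulr0 addr0.
- move=> x; have /andP[s0 s1] := s01 x.
  apply: (@le_trans _ _ (\sum_i (s x * phi i x ^+ 2 + (1 - s x) * psi i x ^+ 2))).
    by apply: ler_sum => i _; exact: mix_sqr.
  rewrite big_split/= -!mulr_sumr.
  have := test_field_le1 x tp; have := test_field_le1 x tq.
  set A := \sum_i _; set B := \sum_i _ => hA hB.
  apply: (@le_trans _ _ (s x * 1 + (1 - s x) * 1)); last by lra.
  by rewrite lerD// ler_wpM2l// subr_ge0.
move=> tchi dchi; split => // x; rewrite dchi /divergence !mulr_sumr -!big_split/=.
by apply: eq_bigr => i _; ring.
Qed.

(** With [s] close to the indicator of [u < v + c], the field [s phi + (1 - s) psi] tests [u] and
    [(1 - s) phi + s psi] tests [v + c]. In the limit [phi] meets the smaller function and [psi] the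
    larger one. The gradient terms combine to [- z * dstep (e k) (z) * T] with [z = v + c - u],
    which is dominated and tends to 0. The fields [phi] and [psi] stay independent, so separate
    suprema may be taken afterwards. *)
Lemma TVle_submod_smooth u v (U V : 'I_n -> 'rV[R]_n -> R) a b c (B : R) phi psi :
  intble m u -> intble m v -> C1grad u U -> C1grad v V ->
  (forall j x, `|U j x| <= B) -> (forall j x, `|V j x| <= B) ->
  TVle u a -> TVle v b -> test_field phi -> test_field psi ->
  \int[m]_x (Num.min (u x) (v x + c) * divergence phi x) +
  \int[m]_x (Num.max (u x) (v x + c) * divergence psi x) <= a + b.
Proof.
move=> ui vi uU vV UB VB ua vb tp tq.
have mu_ := intble_meas ui; have mv := intble_meas vi.
pose z x := v x + c - u x.
have zZ : C1grad z (fun j x => V j x + 0 - U j x).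
  exact: (C1gradB (C1gradD vV (C1grad_cst c)) uU).
pose e k : R := k.+1%:R^-1.
have e0 k : 0 < e k by rewrite invr_gt0.
pose s k x := step (e k) (z x).
pose S k j x := dstep (e k) (z x) * (V j x + 0 - U j x).
have sS k : C1grad (s k) (S k).
  exact: (C1grad_comp (is_derive_step (e0 k)) (continuous_dstep (e0 k)) zZ).
have s01 k x : 0 <= s k x <= 1 by rewrite step_ge0// step_le1.
have [r [Cp [_ pr _ dpr [Cp0 dp]]]] := test_fieldP tp.
have [r' [Cq [_ qr _ dqr [Cq0 dq]]]] := test_fieldP tq.
pose A k i x := s k x * phi i x + (1 - s k x) * psi i x.
pose A' k i x := (1 - s k x) * phi i x + (1 - (1 - s k x)) * psi i x.
have AP k := test_field_mix (sS k) (s01 k) tp tq.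
have s01' k x : 0 <= 1 - s k x <= 1.
  by have /andP[? ?] := s01 k x; apply/andP; split; lra.
have AP' k := test_field_mix (C1gradB (C1grad_cst (1 : R)) (sS k)) (s01' k) tp tq.
pose T x := \sum_i (V i x + 0 - U i x) * (phi i x - psi i x).
pose g k x := u x * divergence (A k) x + (v x + c) * divergence (A' k) x.
pose q k x := (s k x * u x + (1 - s k x) * (v x + c)) * divergence phi x
  + ((1 - s k x) * u x + s k x * (v x + c)) * divergence psi x
  - z x * dstep (e k) (z x) * T x.
have gq k x : g k x = q k x.
  have [_ dA] := AP k; have [_ dA'] := AP' k.
  rewrite /g /q dA dA'.
  have -> : \sum_i S k i x * (phi i x - psi i x) = dstep (e k) (z x) * T x.
    by rewrite /T mulr_sumr; apply: eq_bigr => i _; rewrite mulrA.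
  have -> : \sum_i (0 - S k i x) * (phi i x - psi i x) = - (dstep (e k) (z x) * T x).
    by rewrite /T mulr_sumr -sumrN; apply: eq_bigr => i _; rewrite /S; ring.
  by rewrite {3}/z; ring.
(* The constant [c] contributes nothing, since a divergence has zero integral. *)
have gle k : \int[m]_x g k x <= a + b.
  have [tA _] := AP k; have [tA' _] := AP' k.
  have -> : \int[m]_x g k x = \int[m]_x (u x * divergence (A k) x) +
      (\int[m]_x (v x * divergence (A' k) x) + c * \int[m]_x (divergence (A' k) x)).
    apply: etrans (Rintegral_lin3 c (intble_mul_div ui tA) (intble_mul_div vi tA') (intble_div tA')).
    by apply: eq_Rintegral => x _; rewrite /g mulrDl.
  have -> : \int[m]_x divergence (A' k) x = 0 by exact: (integral_divergence tA').
  apply: lerD; first exact: ua.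
  by rewrite mulr0 (addr0 (\int[m]_x (v x * divergence (A' k) x))); exact: vb.
pose T0 := \sum_(i < n) (B + B) * 2.
(* [T] is bounded through the gradient bound [B] and vanishes off a box containing both supports,
   which makes it a dominating factor. *)
have Tb x : `|T x| <= T0 * \1_(box n (Num.max `|r| `|r'|)) x.
  rewrite indicE; case: (boolP (_ \in _)) => [_|xr].
    rewrite mulr1 /T (le_trans (ler_norm_sum _ _ _))//; apply: ler_sum => i _.
    rewrite normrM addr0 ler_pM//.
      by rewrite (le_trans (ler_normB _ _))// lerD.
    by rewrite (le_trans (ler_normB _ _))// (_ : 2 = 1 + 1)// lerD ?test_field_norm1.
  rewrite mulr0 /T big1 ?normr0// => i _.
  have xr' : Num.max `|r| `|r'| < `|x|.
    rewrite ltNge; apply: contra xr => xr.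
    by rewrite boxE ?le_max ?normr_ge0// inE.
  move: xr'; rewrite gt_max => /andP[xr1 xr2].
  by rewrite pr ?qr ?subrr ?mulr0// (le_lt_trans (ler_norm _)).
pose L x := Num.min (u x) (v x + c) * divergence phi x +
            Num.max (u x) (v x + c) * divergence psi x.
have mphi := measurable_div tp; have mpsi := measurable_div tq.
have mvc : measurable_fun setT (fun x => v x + c) by exact: measurable_funD.
pose w x := `|u x| + `|v x|.
have wi : intble m w by apply: intbleD; exact: intble_norm.
have w0 x : 0 <= w x by rewrite addr_ge0.
have minw x : `|Num.min (u x) (v x + c)| <= w x + `|c|.
  have := ler_normD (v x) c; have := normr_ge0 (u x); have := normr_ge0 (v x).
  have := normr_ge0 c; rewrite /w; case: (leP (u x)); lra.
have maxw x : `|Num.max (u x) (v x + c)| <= w x + `|c|.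
  have := ler_normD (v x) c; have := normr_ge0 (u x); have := normr_ge0 (v x).
  have := normr_ge0 c; rewrite /w; case: (leP (u x)); lra.
have [||||Li h] := @Rintegral_dct _ _ _ m g L (fun x => (Cp + Cq) * w x +
   (`|c| * `|divergence phi x| + `|c| * `|divergence psi x|) +
   2 * (T0 * \1_(box n (Num.max `|r| `|r'|)) x)).
- move=> k; have [tA _] := AP k; have [tA' _] := AP' k.
  by apply: measurable_funD; apply: measurable_funM => //; exact: measurable_div.
- move=> x; under eq_fun do rewrite gq.
  have sl := @step_cvg R (z x); have dl := @dstep_cvg R (z x).
  set l := (if 0 < z x then 1 else 0 : R) in sl.
  have sl' : 1 - s k x @[k --> \oo] --> 1 - l by apply: cvgB => //; exact: cvg_cst.
  have -> : L x = (l * u x + (1 - l) * (v x + c)) * divergence phi x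
    + ((1 - l) * u x + l * (v x + c)) * divergence psi x - 0 * T x.
    rewrite /L /l /z subr_gt0; case: ltP => _; ring.
  apply: cvgB; last by apply: cvgM => //; exact: cvg_cst.
  by apply: cvgD; apply: cvgM; try exact: cvg_cst; apply: cvgD; apply: cvgM; try exact: cvg_cst.
- move=> k x; rewrite gq /q; have /andP[s0 s1] := s01 k x.
  have mixw (t : R) : 0 <= t -> t <= 1 -> `|t * u x + (1 - t) * (v x + c)| <= w x + `|c|.
    move=> t0 t1; rewrite (le_trans (ler_normD _ _))// !normrM (ger0_norm t0).
    rewrite (ger0_norm (_ : 0 <= 1 - t)) ?subr_ge0// /w -addrA lerD//.
      by rewrite ler_piMl.
    rewrite (le_trans _ (ler_normD _ _))// ler_piMl//; lra.
  have h1 := mixw _ s0 s1.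
  have h2 : `|(1 - s k x) * u x + s k x * (v x + c)| <= w x + `|c|.
    by have := mixw (1 - s k x); rewrite opprB addrCA subrr addr0; apply; lra.
  rewrite (le_trans (ler_normB _ _))// lerD//; last first.
    by rewrite normrM ler_pM// dstep_bound.
  rewrite (le_trans (ler_normD _ _))// !normrM.
  apply: (@le_trans _ _ ((w x + `|c|) * `|divergence phi x| + (w x + `|c|) * `|divergence psi x|)).
    by rewrite lerD// ler_wpM2r.
  have := ler_wpM2l (w0 x) (dp x); have := ler_wpM2l (w0 x) (dq x); lra.
- apply: intbleD; last by apply: intbleZ; apply: intbleZ; apply: intble_box; rewrite le_max normr_ge0.
  apply: intbleD; first exact: intbleZ.
  by apply: intbleD; apply: intbleZ; apply: intble_norm; exact: intble_div.
have <- : \int[m]_x L x = \int[m]_x (Num.min (u x) (v x + c) * divergence phi x) +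
  \int[m]_x (Num.max (u x) (v x + c) * divergence psi x).
  rewrite RintegralD//.
  - by apply: (intble_mul_div_loc _ wi w0 minw tp); exact: measurable_minr.
  - by apply: (intble_mul_div_loc _ wi w0 maxw tq); exact: measurable_maxr.
have <- := cvg_lim (@Rhausdorff R) h.
apply: limr_le; first by apply/cvg_ex; eexists; exact: h.
by near=> k; exact: gle.
Unshelve. all: by end_near.
Qed.

(** Mollification increases neither bound and produces bounded gradients, so the smooth case
    applies. The error is controlled because minimum and maximum change by at most the sum of the
    changes of their arguments. *)
Theorem TVle_submod u v a b c phi psi :
  intble m u -> intble m v -> TVle u a -> TVle v b -> test_field phi -> test_field psi ->
  \int[m]_x (Num.min (u x) (v x + c) * divergence phi x) +
  \int[m]_x (Num.max (u x) (v x + c) * divergence psi x) <= a + b.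
Proof.
move=> ui vi ua vb tp tq.
have [r [Cp [_ _ _ _ [Cp0 dp]]]] := test_fieldP tp.
have [r' [Cq [_ _ _ _ [Cq0 dq]]]] := test_fieldP tq.
have mphi := measurable_div tp; have mpsi := measurable_div tq.
have mu_ := intble_meas ui; have mv := intble_meas vi.
pose I u v := \int[m]_x (Num.min (u x) (v x + c) * divergence phi x) +
  \int[m]_x (Num.max (u x) (v x + c) * divergence psi x).
rewrite -/(I u v); apply/ler_addgt0Pl => e e0.
(* [Cp + Cq] multiplies the total L^1 error in the end; the summand 1 only keeps the divisor
   positive. *)
pose K := Cp + Cq + 1.
have K0 : 0 < K by rewrite ltr_pwDr// addr_ge0.
have eK : 0 < e / (2 * K) by rewrite divr_gt0// mulr_gt0.
have [d d0 ud] := shift_small ui eK.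
have [d' d0' vd] := shift_small vi eK.
have dd : 0 < Num.min d d' by rewrite lt_min d0.
have [rho rm] := mollifierP n dd.
pose u' := corr u rho; pose v' := corr v rho.
have ui' : intble m u' := intble_corr_moll ui rm.
have vi' : intble m v' := intble_corr_moll vi rm.
have du : \int[m]_x `|u' x - u x| <= e / (2 * K).
  by apply: (corr_close ui rm) => z; rewrite le_min => /andP[zd _]; exact: ud.
have dv : \int[m]_x `|v' x - v x| <= e / (2 * K).
  by apply: (corr_close vi rm) => z; rewrite le_min => /andP[_ zd]; exact: vd.
have H : I u' v' <= a + b.
  have [G [C [rC rb Gb ri]]] := mollifier_data rm.
  have bnd w : intble m w -> forall j x, `|- corr w (G j) x| <= C * \int[m]_y `|w y|.
    move=> wi j x; have [_ Gc] := rC j.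
    rewrite normrN (le_trans (le_normr_Rintegral measurableT
      (intble_corr x wi (continuous_measurable_row Gc) (Gb j))))//.
    rewrite -(RintegralZl _ measurableT (intble_norm wi)).
    apply: (le_Rintegral measurableT) => [||y _].
    - exact: intble_norm (intble_corr x wi (continuous_measurable_row Gc) (Gb j)).
    - exact: intbleZ (intble_norm wi).
    - by rewrite normrM mulrC ler_wpM2r.
  pose B := Num.max (C * \int[m]_y `|u y|) (C * \int[m]_y `|v y|).
  apply: (@TVle_submod_smooth u' v' (fun j x => - corr u (G j) x) (fun j x => - corr v (G j) x)
    a b c B) => //.
  - exact: corr_C1grad ui rC rb Gb.
  - exact: corr_C1grad vi rC rb Gb.
  - by move=> j x; rewrite le_max bnd.
  - by move=> j x; rewrite le_max bnd ?orbT.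
  - exact: TVle_corr ui rm ua.
  - exact: TVle_corr vi rm vb.
pose w x := `|u' x - u x| + `|v' x - v x|.
have wi : intble m w by apply: intbleD; apply: intble_norm; exact: intbleB.
have Iw : \int[m]_x w x <= e / K.
  rewrite /w (RintegralD measurableT (intble_norm (intbleB ui' ui)) (intble_norm (intbleB vi' vi))).
  rewrite (le_trans (lerD du dv))//.
  have -> : e / K = e / (2 * K) + e / (2 * K) by field; rewrite lt0r_neq0.
  by [].
have mlip (p q p' q' : R) : Num.min p q <= Num.min p' q' + (`|p' - p| + `|q' - q|).
  have := ler_norm (p' - p); have := ler_norm (q' - q).
  have := ler_norm (- (p' - p)); have := ler_norm (- (q' - q)); rewrite !normrN => *.
  by case: (leP p q) => ?; case: (leP p' q') => ?; lra.
have Mlip (p q p' q' : R) : Num.max p q <= Num.max p' q' + (`|p' - p| + `|q' - q|).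
  have := ler_norm (p' - p); have := ler_norm (q' - q).
  have := ler_norm (- (p' - p)); have := ler_norm (- (q' - q)); rewrite !normrN => *.
  by case: (leP p q) => ?; case: (leP p' q') => ?; lra.
have ww x : `|u' x - u x| + `|v' x + c - (v x + c)| = w x.
  by rewrite /w; congr (_ + `|_|); rewrite opprD addrACA subrr addr0.
have ww' x : `|u x - u' x| + `|v x + c - (v' x + c)| = w x.
  by rewrite -ww; congr (_ + _); exact: distrC.
have iloc (f : R -> R -> R) (chi : 'I_n -> 'rV[R]_n -> R) p q : test_field chi ->
    measurable_fun setT (fun x => f (p x) (q x + c)) -> intble m p -> intble m q ->
    (forall s t, `|f s t| <= `|s| + `|t|) -> intble m (fun x => f (p x) (q x + c) * divergence chi x).
  move=> tc mf ip iq fst; apply: (intble_mul_div_loc (w := fun x => `|p x| + `|q x|) (c := `|c|) mf _ _ _ tc).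
  - by apply: intbleD; exact: intble_norm.
  - by move=> x; rewrite addr_ge0.
  - by move=> x; rewrite (le_trans (fst _ _))// -addrA lerD// ler_normD.
have minb (s t : R) : `|Num.min s t| <= `|s| + `|t|.
  by have := normr_ge0 s; have := normr_ge0 t; case: (leP s) => *; lra.
have maxb (s t : R) : `|Num.max s t| <= `|s| + `|t|.
  by have := normr_ge0 s; have := normr_ge0 t; case: (leP s) => *; lra.
have mm p q : intble m p -> intble m q -> measurable_fun setT (fun x => Num.min (p x) (q x + c)).
  move=> /intble_meas mp /intble_meas mq; apply: measurable_minr => //.
  exact: measurable_funD.
have mM p q : intble m p -> intble m q -> measurable_fun setT (fun x => Num.max (p x) (q x + c)).
  move=> /intble_meas mp /intble_meas mq; apply: measurable_maxr => //.
  exact: measurable_funD.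
have key (f : R -> R -> R) (chi : 'I_n -> 'rV[R]_n -> R) D : test_field chi ->
    0 <= D -> (forall x, `|divergence chi x| <= D) ->
    (forall p q, intble m p -> intble m q -> intble m (fun x => f (p x) (q x + c) * divergence chi x)) ->
    (forall p q p' q', f p q <= f p' q' + (`|p' - p| + `|q' - q|)) ->
    \int[m]_x (f (u x) (v x + c) * divergence chi x) <=
    \int[m]_x (f (u' x) (v' x + c) * divergence chi x) + D * \int[m]_x w x.
  move=> tc D0 dD fi flip.
  rewrite -(RintegralZl _ measurableT wi) -(RintegralD measurableT (fi _ _ ui' vi') (intbleZ D wi)).
  apply: (le_Rintegral measurableT (fi _ _ ui vi) (intbleD (fi _ _ ui' vi') (intbleZ D wi))) => x _.
  rewrite -lerBlDl -mulrBl (le_trans (ler_norm _))// normrM mulrC ler_pM//.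
  have := flip (u x) (v x + c) (u' x) (v' x + c); rewrite ww.
  have := flip (u' x) (v' x + c) (u x) (v x + c); rewrite ww'.
  by rewrite ler_norml => *; apply/andP; split; lra.
have k1 := key Num.min phi Cp tp Cp0 dp
  (fun p q ip iq => iloc Num.min phi p q tp (mm p q ip iq) ip iq minb) mlip.
have k2 := key Num.max psi Cq tq Cq0 dq
  (fun p q ip iq => iloc Num.max psi p q tq (mM p q ip iq) ip iq maxb) Mlip.
have w0 : 0 <= \int[m]_x w x by apply: Rintegral_ge0 => x _; rewrite addr_ge0.
have : K * \int[m]_x w x <= e by rewrite -ler_pdivlMl// mulrC.
move: k1 k2 H w0; rewrite /I /K; set i1 := Rintegral _ _ _; set i2 := Rintegral _ _ _.
set i3 := Rintegral _ _ _; set i4 := Rintegral _ _ _; set i5 := Rintegral _ _ _.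
move=> k1 k2 H w0 KW; nra.
Qed.

End submodularity.

(** * Minimization of submodular energies *)

Section energy.
Context d (T : measurableType d) (R : realType) (mu : {measure set T -> \bar R}).
Implicit Types (u v w : T -> R) (c s : R).

Definition admissible w := intble mu w /\ forall x, 0 <= w x.

(* [Qle w c] stands for [Q w <= c]: a functional with values in [[0, +oo]] is encoded
   by its real upper bounds. *)
Record energy (Qle : (T -> R) -> R -> Prop) := Energy {
  en_mono : forall w c c', Qle w c -> c <= c' -> Qle w c' ;
  en_scale : forall w a c, admissible w -> 0 < a -> Qle w c ->
    Qle (fun x => a * w x) (a * c) ;
  en_submod : forall u v a b, admissible u -> admissible v -> Qle u a -> Qle v b ->
    exists c d, [/\ Qle (fun x => Num.min (u x) (v x)) c,
      Qle (fun x => Num.max (u x) (v x)) d & c + d <= a + b] ;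
  en_cut : forall u s a, admissible u -> 0 <= s -> Qle u a ->
    exists c d, [/\ Qle (fun x => Num.min (u x) s) c,
      Qle (fun x => Num.max (u x - s) 0) d & c + d <= a] ;
  en_lsc : forall (w_ : nat -> T -> R) w g (c_ : nat -> R) c,
    (forall k, admissible (w_ k)) -> (forall x, w_ k x @[k --> \oo] --> w x) ->
    (forall k x, w_ k x <= g x) -> intble mu g -> (forall k, Qle (w_ k) (c_ k)) ->
    c_ k @[k --> \oo] --> c -> Qle w c ;
  en_coer : exists2 V0, 0 < V0 & forall w c, admissible w -> Qle w c ->
    V0 * \int[mu]_x w x <= c ;
  en_iso : forall C, exists2 delta, 0 < delta & forall w, admissible w ->
    \int[mu]_x w x = 1 -> Qle w C -> delta <= \int[mu]_x Num.min (w x) 1 ;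
  en_bump : exists w c (K : set T), [/\ admissible w, measurable K, (0 < mu K)%E,
    (forall x, K x -> 1 <= w x) & Qle w c] }.

Lemma admissible_min u v : admissible u -> admissible v ->
  admissible (fun x => Num.min (u x) (v x)).
Proof.
move=> [ui u0] [vi v0]; split => [|x]; last by rewrite le_min u0 v0.
apply: (intble_le _ _ ui) => [|x].
  by apply: measurable_minr; [exact: (intble_meas ui)|exact: (intble_meas vi)].
by rewrite ger0_norm ?le_min ?u0 ?v0// ge_min lexx.
Qed.

Lemma admissible_max u v : admissible u -> admissible v ->
  admissible (fun x => Num.max (u x) (v x)).
Proof.
move=> [ui u0] [vi v0]; split => [|x]; last by rewrite le_max u0.
apply: (intble_le _ _ (intbleD ui vi)) => [|x].
  by apply: measurable_maxr; [exact: (intble_meas ui)|exact: (intble_meas vi)].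
rewrite ger0_norm ?le_max ?u0//.
by have := u0 x; have := v0 x; case: (leP (u x)); lra.
Qed.

Lemma admissible_mins u s : admissible u -> 0 <= s -> admissible (fun x => Num.min (u x) s).
Proof.
move=> [ui u0] s0; split => [|x]; last by rewrite le_min u0.
apply: (intble_le _ _ ui) => [|x].
  by apply: measurable_minr => //; exact: (intble_meas ui).
by rewrite ger0_norm ?le_min ?u0 ?s0// ge_min lexx.
Qed.

Lemma admissible_cut u s : admissible u -> 0 <= s ->
  admissible (fun x => Num.max (u x - s) 0).
Proof.
move=> [ui u0] s0; split => [|x]; last by rewrite le_max lexx orbT.
apply: (intble_le _ _ ui) => [|x].
  apply: measurable_maxr => //; apply: measurable_funB => //; exact: (intble_meas ui).
by rewrite ger0_norm ?le_max ?lexx ?orbT//; have := u0 x; case: (leP (u x - s)) => *; lra.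
Qed.

Lemma admissibleZ u a : admissible u -> 0 <= a -> admissible (fun x => a * u x).
Proof. by move=> [ui u0] a0; split => [|x]; [exact: intbleZ|rewrite mulr_ge0]. Qed.

Lemma admissible_indic (A : set T) : measurable A -> intble mu \1_A -> admissible \1_A.
Proof. by move=> mA iA; split. Qed.

Lemma Rintegral_indicE (A : set T) : measurable A -> intble mu \1_A ->
  (\int[mu]_x \1_A x)%:E = mu A.
Proof. by move=> mA iA; rewrite intbleE// integral_indic// setIT. Qed.

Lemma Rintegral_minmax u v : admissible u -> admissible v ->
  \int[mu]_x Num.min (u x) (v x) + \int[mu]_x Num.max (u x) (v x) =
  \int[mu]_x u x + \int[mu]_x v x.
Proof.
move=> ua va; have [mi _] := admissible_min ua va; have [Mi _] := admissible_max ua va.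
case: ua va => ui _ [vi _]; rewrite -(RintegralD measurableT mi Mi) -(RintegralD measurableT ui vi).
by apply: eq_Rintegral => x _; rewrite addr_min_max.
Qed.

Lemma Rintegral_cut u s : admissible u -> 0 <= s ->
  \int[mu]_x Num.min (u x) s + \int[mu]_x Num.max (u x - s) 0 = \int[mu]_x u x.
Proof.
move=> ua s0; have [mi _] := admissible_mins ua s0; have [Mi _] := admissible_cut ua s0.
rewrite -(RintegralD measurableT mi Mi).
by apply: eq_Rintegral => x _; case: (leP (u x) s); case: (leP (u x - s)) => *; lra.
Qed.

Lemma monotone_sup (f : nat -> T -> R) (M : R) :
  (forall k, admissible (f k)) -> (forall k x, f k x <= 1) ->
  (forall k x, f k x <= f k.+1 x) -> (forall k, \int[mu]_x f k x <= M) ->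
  exists F, [/\ admissible F, forall x, f k x @[k --> \oo] --> F x,
    forall k x, f k x <= F x & forall x, F x <= 1].
Proof.
move=> fa f1 fS fM.
have nd x : nondecreasing_seq (f ^~ x) by apply/nondecreasing_seqP => k; exact: fS.
have cf x : cvgn (f ^~ x).
  by apply: nondecreasing_is_cvgn => //; exists 1 => _ [k _ <-].
pose F x := limn (f ^~ x).
have fF k x : f k x <= F x by exact: nondecreasing_cvgn_le.
have mf k : measurable_fun setT (f k) by case: (fa k) => /intble_meas.
have mF : measurable_fun setT F.
  by apply: (measurable_fun_cvg (h := f)) => // x _; exact: cf.
have F0 x : 0 <= F x by rewrite (le_trans _ (fF 0 x))//; case: (fa 0%N).
exists F; split => //; last first.
  by move=> x; apply: limr_le; [exact: cf|exact: nearW].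
split => //; apply/intbleP; split => //.
under eq_integral do rewrite ger0_norm//.
have h : (\int[mu]_x (f k x)%:E)%E @[k --> \oo] --> (\int[mu]_x (F x)%:E)%E.
  have -> : (\int[mu]_x (F x)%:E)%E = (\int[mu]_x limn (fun k => (f k x)%:E))%E.
    apply: eq_integral => x _; apply/esym/cvg_lim => //.
    by apply: cvg_EFin; [exact: nearW|exact: cf].
  apply: cvg_monotone_convergence => //.
  - by move=> k; exact/measurable_EFinP.
  - by move=> k x _; rewrite lee_fin; case: (fa k).
  - by move=> x _ k l kl; rewrite lee_fin; exact: nd.
apply: (@le_lt_trans _ _ M%:E); last exact: ltry.
rewrite -(cvg_lim (@ereal_hausdorff R) h); apply: lime_le.
  by apply/cvg_ex; eexists; exact: h.
apply: nearW => k; rewrite -intbleE ?lee_fin ?fM//.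
by case: (fa k).
Qed.

(* Submodularity replaces compactness: unions of almost minimizers are almost minimizers, so the
   upper limit of a minimizing sequence is a minimizer. *)
Lemma limsup_minimizer Qle (lam m M : R) (K O : set T) (w : nat -> T -> R) :
  let D u := (forall x, K x -> 1 <= u x) /\ (forall x, ~ O x -> u x = 0) in
  energy Qle -> 0 <= lam ->
  (forall u c, admissible u -> D u -> Qle u c -> m + lam * \int[mu]_x u x <= c) ->
  (forall u, admissible u -> D u -> (forall x, u x <= 1) ->
     Qle u (m + lam * \int[mu]_x u x + 1) -> \int[mu]_x u x <= M) ->
  (forall k, [/\ admissible (w k), D (w k), forall x, w k x <= 1 &
     Qle (w k) (m + lam * \int[mu]_x w k x + 2 ^- k.+1)]) ->
  exists z, [/\ admissible z, D z, forall x, z x <= 1,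
    Qle z (m + lam * \int[mu]_x z x) &
    forall e, (forall k, e <= \int[mu]_x w k x) -> e <= \int[mu]_x z x].
Proof.
move=> D Q lam0 lb bd wP.
(* [v n k] is the maximum of [w n], ..., [w (n + k)]. Its excess over [m + lam * \int] is at most
   the sum of the excesses [2 ^- j.+1] for [j] from [n] to [n + k], which telescopes to
   [2 ^- n - 2 ^- (n + k).+1]. *)
pose v n := fix v k := if k is k'.+1 then (fun x => Num.max (v k' x) (w (n + k'.+1)%N x)) else w n.
have vP n k : [/\ admissible (v n k), D (v n k), forall x, v n k x <= 1 &
    Qle (v n k) (m + lam * \int[mu]_x v n k x + (2 ^- n - 2 ^- (n + k).+1))].
  elim: k => [|k [va [vK vO] v1 Qv]].
    rewrite /= addn0; have [wa wD w1 Qw] := wP n; split => //.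
    apply: en_mono Qw _ => //; rewrite lerD2l exprS invfM.
    have : 0 < (2 : R) ^- n by rewrite invr_gt0 exprn_gt0.
    by set t := 2 ^- n => t0; lra.
  have [wa [wK wO] w1 Qw] := wP (n + k.+1)%N.
  have [c [d' [Qc Qd cd]]] := en_submod Q va wa Qv Qw.
  have ma := admissible_min va wa; have Ma := admissible_max va wa.
  have mD : D (fun x => Num.min (v n k x) (w (n + k.+1)%N x)).
    split => x xK; first by rewrite le_min vK// wK.
    by rewrite vO// wO// minxx.
  have MD : D (fun x => Num.max (v n k x) (w (n + k.+1)%N x)).
    split => x xK; first by rewrite le_max vK.
    by rewrite vO// wO// maxxx.
  split => //=; first by move=> x; rewrite ge_max v1 w1.
  apply: (en_mono Q Qd).
  (* The minimum is a competitor too and has nonnegative excess, so the excess of the maximum is at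
     most the sum of the two given ones. *)
  have h1 := lb _ _ ma mD Qc; have h2 := Rintegral_minmax va wa.
  have h3 : lam * \int[mu]_x Num.min (v n k x) (w (n + k.+1)%N x) +
    lam * \int[mu]_x Num.max (v n k x) (w (n + k.+1)%N x) =
    lam * \int[mu]_x v n k x + lam * \int[mu]_x w (n + k.+1)%N x.
    by rewrite -!mulrDr h2.
  have -> : 2 ^- (n + k.+1).+1 = 2 ^- (n + k).+1 / 2 :> R.
    by rewrite addnS exprS invfM mulrC.
  move: h1 h3 cd; rewrite [in 2 ^- (n + k.+1).+1]addnS [2 ^+ (n + k).+2]exprS invfM.
  set i1 := lam * _; set i2 := lam * _; set i3 := lam * _; set i4 := lam * _.
  set t := 2 ^- (n + k).+1; set t' := 2 ^- n => h1 h3 cd; lra.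
have half n : 0 < 2 ^- n :> R by rewrite invr_gt0 exprn_gt0.
have half1 n : 2 ^- n <= 1 :> R by rewrite invf_le1 ?exprn_gt0// exprn_ege1// ler1n.
have vM n k : \int[mu]_x v n k x <= M.
  have [va vD v1 Qv] := vP n k; apply: bd => //; apply: (en_mono Q Qv).
  by rewrite lerD2l; have := half (n + k).+1; have := half1 n; lra.
have vS n k x : v n k x <= v n k.+1 x by rewrite /= le_max lexx.
have /choice[V VP] n : exists F, [/\ admissible F, forall x, v n k x @[k --> \oo] --> F x,
    forall k x, v n k x <= F x & forall x, F x <= 1].
  by apply: (monotone_sup _ _ (vS n) (vM n)) => k; have [] := vP n k.
have vle n k x : v n.+1 k x <= v n k.+1 x.
  elim: k => [|k IH] /=; first by rewrite addn1 le_max lexx orbT.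
  by rewrite ge_max !le_max; move: IH; rewrite /= le_max addSnnS lexx orbT => ->.
have Vle n x : V n.+1 x <= V n x.
  have [_ cv _ _] := VP n.+1; have [_ _ vn _] := VP n.
  rewrite -(cvg_lim (@Rhausdorff R) (cv x)); apply: limr_le.
    by apply/cvg_ex; eexists; exact: cv.
  by apply: nearW => k; exact: (le_trans (vle n k x)).
have V0 n x : 0 <= V n x by have [[_]] := VP n.
have cV x : cvgn (V ^~ x).
  apply: nonincreasing_is_cvgn; first by apply/nonincreasing_seqP => n; exact: Vle.
  by exists 0 => _ [n _ <-].
(* [V n] is the supremum of the tail from [n] on, so [z] is the upper limit of [w]; all is dominated
   by the integrable [V 0]. *)
pose z x := limn (V ^~ x).
have VzD n x : V n x <= V 0%N x.
  by elim: n => [//|n]; apply: le_trans.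
have iV n : intble mu (V n) by have [[]] := VP n.
have [||||zi Iz] := @Rintegral_dct _ _ _ mu V z (V 0%N).
- by move=> n; exact: (intble_meas (iV n)).
- exact: cV.
- by move=> n x; rewrite ger0_norm.
- exact: iV.
have z0 x : 0 <= z x by apply: limr_ge; [exact: cV|exact: nearW].
have zV n x : z x <= V n x.
  by apply: nonincreasing_cvgn_ge => //; apply/nonincreasing_seqP => k; exact: Vle.
have QV n : Qle (V n) (m + lam * \int[mu]_x V n x + 2 ^- n).
  have [[Vi Vp] cv vn _] := VP n.
  have [||||_ Iv] := @Rintegral_dct _ _ _ mu (v n) (V n) (V n).
  - by move=> k; have [[/intble_meas]] := vP n k.
  - exact: cv.
  - by move=> k x; rewrite ger0_norm//; have [[_]] := vP n k.
  - exact: Vi.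
  apply: (en_lsc Q (w_ := v n) (g := V n) (c_ := fun k => m + lam * \int[mu]_x v n k x + 2 ^- n)) => //.
  - by move=> k; have [] := vP n k.
  - move=> k; have [_ _ _ Qv] := vP n k; apply: (en_mono Q Qv).
    by rewrite lerD2l gerBl ltW.
  - by apply: cvgD; [apply: cvgD; [exact: cvg_cst|apply: cvgM => //; exact: cvg_cst]|exact: cvg_cst].
exists z; split => //.
- split => x xK.
    apply: limr_ge; first exact: cV.
    apply: nearW => n; have [_ _ vn _] := VP n; apply: (le_trans _ (vn 0%N x)).
    by have [_ [vK _] _ _] := vP n 0%N; exact: vK.
  apply/eqP; rewrite eq_le z0 andbT (le_trans (zV 0%N x))//.
  have [_ cv _ _] := VP 0%N; rewrite -(cvg_lim (@Rhausdorff R) (cv x)); apply: limr_le.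
    by apply/cvg_ex; eexists; exact: cv.
  by apply: nearW => k; have [_ [_ vO] _ _] := vP 0%N k; rewrite vO.
- by move=> x; apply: (le_trans (zV 0%N x)); have [_ _ _] := VP 0%N.
- apply: (en_lsc Q (w_ := V) (g := V 0%N) (c_ := fun n => m + lam * \int[mu]_x V n x + 2 ^- n)).
  + by move=> n; have [] := VP n.
  + exact: cV.
  + by move=> n x; exact: VzD.
  + exact: iV.
  + exact: QV.
  + have h2 : (fun n : nat => (2 : R) ^- n) n @[n --> \oo] --> (0 : R).
      have -> : (fun n : nat => (2 : R) ^- n) = geometric (1 : R) (2^-1 : R).
        by apply/funext => n; rewrite /geometric /= mul1r exprVn.
      by apply: cvg_geometric; rewrite ger0_norm// invf_lt1// ltr1n.
    rewrite -(addr0 (m + lam * _)); apply: cvgD => //.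
    by apply: cvgD; [exact: cvg_cst|apply: cvgM => //; exact: cvg_cst].
(* No mass is lost: the tail supremum [V n] lies above [w n], and the integrals of [V n] converge to
   that of [z]. *)
- move=> e we.
  have <- : limn (fun n => \int[mu]_x V n x) = \int[mu]_x z x by exact: cvg_lim Iz.
  apply: limr_ge; first by apply/cvg_ex; eexists; exact: Iz.
  apply: nearW => n; apply: (le_trans (we n)).
  have [[Vi _] _ vn _] := VP n; have [[wi _] _ _ _] := wP n.
  by apply: (le_Rintegral measurableT wi Vi) => x _; exact: (vn 0%N x).
Qed.

End energy.

(** * Cuts of the total variation and the mass left by truncation *)

Section energy_lemmas.
Variables (R : realType) (n : nat).
Notation m := (leb R n).
Implicit Types (u v w : 'rV[R]_n -> R) (phi psi : 'I_n -> 'rV[R]_n -> R) (a b c r C : R).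

(** Submodularity bounds a sum for every pair of fields. Taking for [p] the supremum over [phi] and
    for [q] the remainder decouples the pair. *)
Lemma TVle_split u v a b c : intble m u -> intble m v -> TVle u a -> TVle v b ->
  exists p q, [/\ forall phi, test_field phi ->
      \int[m]_x (Num.min (u x) (v x + c) * divergence phi x) <= p,
    forall psi, test_field psi ->
      \int[m]_x (Num.max (u x) (v x + c) * divergence psi x) <= q & p + q <= a + b].
Proof.
move=> ui vi ua vb.
pose A : set R := [set \int[m]_x (Num.min (u x) (v x + c) * divergence phi x) |
  phi in (@test_field R n)].
have A0 : A !=set0 by eexists; exists (fun _ _ => 0); [exact: test_field0|reflexivity].
have Aub psi : test_field psi ->
    ubound A (a + b - \int[m]_x (Num.max (u x) (v x + c) * divergence psi x)).
  by move=> tq _ [phi tp <-]; rewrite lerBrDr; exact: TVle_submod.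
have sA : has_sup A.
  by split => //; exact: (ex_intro _ _ (Aub _ (@test_field0 R n))).
exists (sup A), (a + b - sup A); split.
- by move=> phi tp; apply: (ub_le_sup sA.2); exists phi.
- by move=> psi tq; rewrite lerBrDr addrC -lerBrDr; apply: ge_sup => //; exact: Aub.
- by rewrite addrC subrK.
Qed.

Lemma TVle_minmax u v a b : intble m u -> intble m v -> TVle u a -> TVle v b ->
  exists p q, [/\ TVle (fun x => Num.min (u x) (v x)) p,
    TVle (fun x => Num.max (u x) (v x)) q & p + q <= a + b].
Proof.
move=> ui vi ua vb; have [p [q [hp hq pq]]] := TVle_split 0 ui vi ua vb.
exists p, q; split => //.
  by move=> phi tp; have := hp _ tp; under eq_Rintegral do rewrite addr0.
by move=> phi tp; have := hq _ tp; under eq_Rintegral do rewrite addr0.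
Qed.

Lemma TVle0 : TVle (fun _ : 'rV[R]_n => 0) 0.
Proof.
by move=> phi tp; rewrite /Rintegral integral0_eq// => x _; rewrite mul0r.
Qed.

(** Submodularity against the constant [s], that is with [v = 0] and [c = s]. The larger function
    [max (u, s)] is [max (u - s, 0)] plus a constant, which no divergence detects. *)
Lemma TVle_cut u s a : admissible m u -> 0 <= s -> TVle u a ->
  exists p q, [/\ TVle (fun x => Num.min (u x) s) p,
    TVle (fun x => Num.max (u x - s) 0) q & p + q <= a].
Proof.
move=> ua s0 Tu.
have [p [q [hp hq pq]]] := TVle_split s ua.1 (intble0 m) Tu TVle0.
exists p, q; split; last by rewrite addr0 in pq.
  by move=> phi tp; have := hp _ tp; under eq_Rintegral do rewrite add0r.
move=> phi tp; apply: le_trans (hq _ tp).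
have [ci _] := admissible_cut ua s0.
have -> : \int[m]_x (Num.max (u x) (0 + s) * divergence phi x) =
    \int[m]_x (Num.max (u x - s) 0 * divergence phi x + s * divergence phi x).
  apply: eq_Rintegral => x _; rewrite add0r -mulrDl; congr (_ * _).
  by case: (leP (u x) s); case: (leP (u x - s)) => *; lra.
rewrite (RintegralD measurableT (intble_mul_div ci tp) (intbleZ s (intble_div tp))).
by rewrite (RintegralZl _ measurableT (intble_div tp)) integral_divergence// mulr0 lerDl.
Qed.

Lemma TVle_C1 g (G : 'I_n -> 'rV[R]_n -> R) r : C1grad g G ->
  (forall x, r < `|x| -> g x = 0) -> TVle g (\sum_i \int[m]_x `|G i x|).
Proof.
move=> gG gr; have [Gr [C [gC GC]]] := C1grad_support gG gr.
move=> phi tp; have [r' [C' [pG pr _ _ _]]] := test_fieldP tp.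
have mg := continuous_measurable_row (C1grad_continuous gG).
have mG j : measurable_fun setT (G j) by have [_ /continuous_measurable_row] := gG j.
have iG j : intble m (G j) := intble_bounded_support (mG j) (GC j) (Gr j).
have mp i : measurable_fun setT (phi i) := continuous_measurable_row (C1grad_continuous (pG i)).
have pb i := C1grad_support (pG i) (fun y yr => pr y yr i).
pose P i := C1gradM gG (pG i).
have Pr i x : r < `|x| -> g x * phi i x = 0 by move=> /gr ->; rewrite mul0r.
have P0 i : \int[m]_x (g x * 'D_(ebasis R i) (phi i) x + phi i x * G i x) = 0.
  have [_ [D [h1 h2]]] := C1grad_support (P i) (Pr i).
  exact: (integral_grad0 (P i) h1 h2 (Pr i)).
have i1 i : intble m (fun x => g x * 'D_(ebasis R i) (phi i) x).
  have [_ [D [_ h2]]] := pb i; have [_ Gc] := pG i i.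
  exact: (intbleM (intble_bounded_support mg gC gr) (continuous_measurable_row Gc) (h2 i)).
have i2 i : intble m (fun x => phi i x * G i x).
  have := intbleM (iG i) (mp i) (fun x => test_field_norm1 i x tp).
  by under eq_fun do rewrite mulrC.
have -> : \int[m]_x (g x * divergence phi x) = \sum_i \int[m]_x (g x * 'D_(ebasis R i) (phi i) x).
  by rewrite -Rintegral_sum//; apply: eq_Rintegral => x _; rewrite /divergence mulr_sumr.
apply: ler_sum => i _.
have := P0 i; rewrite (RintegralD measurableT (i1 i) (i2 i)) => /eqP; rewrite addr_eq0 => /eqP ->.
apply: le_trans (ler_norm _) _; rewrite normrN.
apply: le_trans (le_normr_Rintegral measurableT (i2 i)) _.
apply: (le_Rintegral measurableT (intble_norm (i2 i)) (intble_norm (iG i))) => x _.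
by rewrite normrM ler_piMl// test_field_norm1.
Qed.

(** Both [g] and [- g], placed in the single component [j] and translated by [x], are test fields.
    Hence the pairing of [w] with translates of [g] is Lipschitz with constant [a] for the sum
    norm. *)
Lemma corr_grad_le w a g (G : 'I_n -> 'rV[R]_n -> R) r : intble m w -> TVle w a ->
  C1grad g G -> (forall x, `|g x| <= 1) -> (forall x, r < `|x| -> g x = 0) ->
  forall j x, `|corr w (G j) x| <= a.
Proof.
move=> wi wa gG g1 gr j x.
have half (h : 'rV[R]_n -> R) H : C1grad h H -> (forall x, `|h x| <= 1) ->
    (forall x, r < `|x| -> h x = 0) -> \int[m]_y (w y * H j (y - x)) <= a.
  move=> hH h1 hr.
  pose phi (i : 'I_n) (y : 'rV[R]_n) := if i == j then h (y - x) else 0.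
  pose Phi (i k : 'I_n) (y : 'rV[R]_n) := if i == j then H k (y - x) else 0.
  have [] := @test_field_intro R n phi Phi (`|r| + `|x|).
  - move=> i; rewrite /phi /Phi; case: eqP => _; last exact: C1grad_cst.
    exact: (C1grad_shift (- x) hH).
  - move=> y yr i; rewrite /phi; case: eqP => // _; apply: hr.
    rewrite (le_lt_trans (ler_norm r))//.
    by have := lerB_dist y x; lra.
  - move=> y; rewrite (bigD1 j)//= big1 ?addr0 => [|i ij]; last first.
      by rewrite /phi (negbTE ij) expr0n.
    by rewrite /phi eqxx -real_normK ?num_real// expr_le1.
  move=> tp dp; apply: le_trans (wa _ tp); rewrite le_eqVlt; apply/orP; left; apply/eqP.
  apply: eq_Rintegral => y _; rewrite dp (bigD1 j)//= big1 ?addr0 => [|i ij]; last first.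
    by rewrite /Phi (negbTE ij).
  by rewrite /Phi eqxx.
rewrite ler_norml /corr; apply/andP; split; last exact: half gG g1 gr.
have h1 y : `|- g y| <= 1 by rewrite normrN.
have hr y : r < `|y| -> - g y = 0 by move=> /gr ->; rewrite oppr0.
have := half _ _ (C1gradN gG) h1 hr.
have [_ [C [_ GC]]] := C1grad_support gG gr; have [_ Gc] := gG j.
have iw := intble_corr x wi (continuous_measurable_row Gc) (GC j).
have -> : \int[m]_y (w y * - G j (y - x)) = - 1 * \int[m]_y (w y * G j (y - x)).
  rewrite -(RintegralZl _ measurableT iw); apply: eq_Rintegral => y _.
  by rewrite mulN1r mulrN.
by rewrite mulN1r => ?; rewrite lerNl.
Qed.

(* Translating [w] by [z] changes its integral against a test function by at most
   [a * \sum_j |z_j|]; averaging over [z] with weight [rho] turns [w] into a function bounded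
   by [C * \int w]. *)
Lemma smooth_weight_le w a g (G : 'I_n -> 'rV[R]_n -> R) r h C (rho : 'rV[R]_n -> R) :
  admissible m w -> TVle w a -> C1grad g G -> (forall x, 0 <= g x <= 1) ->
  (forall x, r < `|x| -> g x = 0) -> 0 <= h -> mollifier h rho -> (forall x, rho x <= C) ->
  \int[m]_x (w x * g x) <= C * \int[m]_x w x * \int[m]_x g x + a * (n%:R * h).
Proof.
move=> [wi w0] wa gG g01 gr h0 rm rC.
have [_ r0 rs r1] := rm; have [_ [_ [_ _ _ ri]]] := mollifier_data rm.
have g1 x : `|g x| <= 1 by have /andP[? ?] := g01 x; rewrite ger0_norm.
have mg := continuous_measurable_row (C1grad_continuous gG).
have ig : intble m g := intble_bounded_support mg g1 gr.
have C0 : 0 <= C := le_trans (r0 0) (rC 0).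
have iw0 : 0 <= \int[m]_x w x by apply: Rintegral_ge0 => x _; exact: w0.
have [i1 [e1 i2]] := corr_fubini wi rm mg g1.
pose F z := \int[m]_x (w (x + z) * g x).
have FE z : F z = corr w g z.
  rewrite corrE//; last exact: intble_meas wi.
  by apply: eq_Rintegral => x _; rewrite mulrC addrC.
have a0 := TVle_ge0 wa.
have cle := corr_grad_le wi wa gG g1 gr.
have [_ [D [gD GD]]] := C1grad_support gG gr.
(* [C1grad_lip] with the gradient bound [a]; the sum of the coordinates of [z] is at most [n%:R * h]
   in absolute value. *)
have Flip z : `|z| <= h -> F 0 - a * (n%:R * h) <= F z.
  move=> zh; have := C1grad_lip (x := 0) (corr_C1grad wi gG g1 GD) h0 a0 _ zh.
  rewrite add0r -!FE ler_norml => /(_ _)/andP[|+ _].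
    by move=> y j _; rewrite normrN.
  have : a * \sum_j `|z 0 j| <= a * (n%:R * h).
    rewrite ler_wpM2l// -[n in n%:R]card_ord -sumr_const mulr_suml ler_sum// => j _.
    by rewrite mul1r (le_trans (row_norm_ge z j)).
  by set p := a * _; set q := a * _; move=> *; lra.
have F0E : F 0 = \int[m]_x (w x * g x) by apply: eq_Rintegral => x _; rewrite addr0.
rewrite -lerBlDr -F0E.
have <- : \int[m]_z (rho z * (F 0 - a * (n%:R * h))) = F 0 - a * (n%:R * h).
  under eq_Rintegral do rewrite mulrC.
  by rewrite (RintegralZl _ measurableT ri) r1 mulr1.
(* [Flip] is averaged with weight [rho]; afterwards [corr w rho] is bounded by [C * \int w], because
   [rho <= C]. *)
apply: (@le_trans _ _ (\int[m]_x (corr w rho x * g x))).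
  rewrite e1; apply: le_Rintegral => //.
    have := intbleZ (F 0 - a * (n%:R * h)) ri.
    by under eq_fun do rewrite mulrC.
  move=> z _; case: (leP `|z| h) => zh; last by rewrite rs// !mul0r.
  by rewrite ler_wpM2l// Flip.
rewrite -(RintegralZl _ measurableT ig).
apply: (le_Rintegral measurableT i1 (intbleZ _ ig)) => x _.
have /andP[gx _] := g01 x; rewrite ler_wpM2r// /corr -(RintegralZl _ measurableT wi).
apply: le_Rintegral => //; first last.
- by move=> y _; rewrite mulrC ler_wpM2r.
- exact: intbleZ.
- apply: (@intble_corr _ _ w rho x C) => //; first exact: intble_meas ri.
  by move=> y; rewrite ger0_norm.
Qed.

(** Reduction to a C^1 weight: [u] is restricted to a box and mollified. Changing the weight in L^1
    is harmless only against a bounded function, so [w] is cut at a height [L] first. Box and height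
    then grow together. *)
Lemma weight_le w a u h C (rho : 'rV[R]_n -> R) :
  admissible m w -> TVle w a -> admissible m u -> (forall x, u x <= 1) ->
  0 <= h -> mollifier h rho -> (forall x, rho x <= C) ->
  \int[m]_x (w x * u x) <= C * \int[m]_x w x * \int[m]_x u x + a * (n%:R * h).
Proof.
move=> wa Ta [ui u0] u1 h0 rm rC.
have [wi w0] := wa; have mu_ := intble_meas ui; have mw := intble_meas wi.
have C0 : 0 <= C := le_trans (moll_ge0 rm 0) (rC 0).
have iw0 : 0 <= \int[m]_x w x by apply: Rintegral_ge0 => x _; exact: w0.
have a0 := TVle_ge0 Ta.
have key L r : 0 <= L -> 0 <= r ->
    \int[m]_x (Num.min (w x) L * (\1_(box n r) x * u x)) <=
    C * \int[m]_x w x * \int[m]_x u x + a * (n%:R * h).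
  move=> L0 r0.
  pose v x := \1_(box n r) x * u x.
  have v0 x : 0 <= v x by rewrite mulr_ge0.
  have vu x : v x <= u x by rewrite /v ler_piMl// indicE lern1 leq_b1.
  have v1 x : v x <= 1 := le_trans (vu x) (u1 x).
  have mv : measurable_fun setT v.
    by apply: measurable_funM => //; apply: measurable_indic; exact: measurable_box.
  have vi : intble m v by apply: (intble_le mv _ ui) => x; rewrite ger0_norm.
  have vr x : r < `|x| -> v x = 0.
    move=> rx; rewrite /v indicE memNset ?mul0r// boxE//= => /(lt_le_trans rx).
    by rewrite ltxx.
  have ma := admissible_mins wa L0.
  have [p [q [Tp Tq pq]]] := TVle_cut wa L0 Ta.
  have pa : p <= a by have := TVle_ge0 Tq; lra.
  have {Tp} Tp : TVle (fun x => Num.min (w x) L) a.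
    by move=> phi tp; rewrite (le_trans (Tp _ tp)).
  have iv0 : 0 <= \int[m]_x v x by apply: Rintegral_ge0 => x _; exact: v0.
  have ivu : \int[m]_x v x <= \int[m]_x u x by apply: le_Rintegral.
  apply/ler_addgt0Pr => e e0.
  (* The replacement costs [L * e'] on the left and [C * \int w * e'] on the right; together these
     stay below [e]. *)
  pose e' := e / (L + C * \int[m]_x w x + 1).
  have P0 : 0 < L + C * \int[m]_x w x + 1 by rewrite ltr_wpDl// addr_ge0// mulr_ge0.
  have e'0 : 0 < e' by rewrite divr_gt0.
  have [d d0 dP] := shift_small vi e'0.
  have [rh hm] := mollifierP n d0.
  have close := corr_close vi hm dP.
  have [G [B [rhC rhB GB rhi]]] := mollifier_data hm.
  pose g := corr v rh.
  have gG : C1grad g (fun j x => - corr v (G j) x) := corr_C1grad vi rhC rhB GB.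
  have mrh := intble_meas rhi.
  have [_ rh0 rhs rh1] := hm.
  have gE x : g x = \int[m]_z (rh z * v (x + z)) by rewrite /g corrE.
  have ivz x : intble m (fun z => rh z * v (x + z)).
    apply: (intble_le _ _ rhi) => [|z].
      apply: measurable_funM => //; have := measurable_shift_row (- x) mv.
      by under eq_fun do rewrite opprK addrC.
    by rewrite ger0_norm ?mulr_ge0// ler_piMr.
  have g01 x : 0 <= g x <= 1.
    rewrite gE; apply/andP; split.
      by apply: Rintegral_ge0 => z _; rewrite mulr_ge0.
    by rewrite -rh1; apply: (le_Rintegral measurableT (ivz x) rhi) => z _; rewrite ler_piMr.
  have gr x : r + d < `|x| -> g x = 0.
    move=> rx; rewrite gE /Rintegral integral0_eq// => z _.
    case: (leP `|z| d) => zd; last by rewrite rhs// mul0r.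
    by rewrite vr ?mulr0//; have := lerB_normD x z; lra.
  have ig : intble m g := intble_corr_moll vi hm.
  have idiff : intble m (fun x => `|g x - v x|) by apply: intble_norm; exact: intbleB.
  have := smooth_weight_le ma Tp gG g01 gr h0 rm rC.
  set I := \int[m]_x Num.min (w x) L.
  have I0 : 0 <= I by apply: Rintegral_ge0 => x _; case: ma.
  have Iw : I <= \int[m]_x w x.
    by apply: (le_Rintegral measurableT ma.1 wi) => x _; rewrite ge_min lexx.
  have ming f : intble m f -> intble m (fun x => Num.min (w x) L * f x).
    move=> fi; have mL x : `|Num.min (w x) L| <= L.
      by rewrite ger0_norm ?ge_min ?lexx ?orbT//; case: ma.
    by have := intbleM fi (intble_meas ma.1) mL; under eq_fun do rewrite mulrC.
  have s1 : \int[m]_x (Num.min (w x) L * v x) <=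
      \int[m]_x (Num.min (w x) L * g x) + L * e'.
    apply: (@le_trans _ _ (\int[m]_x (Num.min (w x) L * g x + L * `|g x - v x|))).
      apply: (le_Rintegral measurableT (ming _ vi) (intbleD (ming _ ig) (intbleZ L idiff))) => x _.
      rewrite -lerBlDl -mulrBr; apply: (le_trans (ler_norm _)); rewrite normrM distrC.
      rewrite ler_wpM2r// ger0_norm ?ge_min ?lexx ?orbT//; by case: ma.
    rewrite (RintegralD measurableT (ming _ ig) (intbleZ L idiff)) (RintegralZl _ measurableT idiff).
    by rewrite lerD2l ler_wpM2l.
  have s2 : \int[m]_x g x <= \int[m]_x u x + e'.
    apply: (@le_trans _ _ (\int[m]_x (u x + `|g x - v x|))).
      apply: (le_Rintegral measurableT ig (intbleD ui idiff)) => x _.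
      by have := ler_norm (g x - v x); have := vu x; lra.
    by rewrite (RintegralD measurableT ui idiff) lerD2l.
  have g0 : 0 <= \int[m]_x g x by apply: Rintegral_ge0 => x _; have /andP[] := g01 x.
  have s3 : C * I * \int[m]_x g x <= C * \int[m]_x w x * (\int[m]_x u x + e').
    by apply: ler_pM => //; [exact: mulr_ge0|exact: ler_wpM2l].
  have s4 : L * e' + C * \int[m]_x w x * e' <= e.
    rewrite -mulrDl /e' mulrCA ger_pMr// ler_pdivrMr// mul1r lerDl; exact: ler01.
  rewrite mulrDr in s3; move=> s5.
  apply: (le_trans s1); move: s3 s4 s5.
  set i1 := L * e'; set i2 := C * _ * e'; set i4 := C * I * _; set i3 := C * _ * _.
  set i5 := a * _; set i6 := \int[m]_x _; move=> *; lra.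
have [||||_ lim] := @Rintegral_dct _ _ _ m
  (fun k x => Num.min (w x) k%:R * (\1_(box n k%:R) x * u x)) (fun x => w x * u x) w.
- move=> k; apply: measurable_funM; first exact: measurable_minr.
  by apply: measurable_funM => //; apply: measurable_indic; exact: measurable_box.
- move=> x; apply: cvg_near_cst; near=> k.
  rewrite min_l; last by near: k; exact: nbhs_infty_ger.
  rewrite indicE mem_set ?mul1r// boxE//=; near: k; exact: nbhs_infty_ger.
- move=> k x; rewrite ger0_norm.
    rewrite -[leRHS]mulr1; apply: ler_pM; rewrite ?le_min ?w0// ?ge_min ?lexx// ?mulr_ge0//.
      by rewrite /=.
    by rewrite mulr_ile1// indicE lern1 leq_b1.
  by rewrite !mulr_ge0// le_min w0/=.
- exact: wi.
rewrite -(cvg_lim (@Rhausdorff R) lim); apply: limr_le.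
  by apply/cvg_ex; eexists; exact: lim.
by apply: nearW => k; exact: key.
Unshelve. all: by end_near.
Qed.

(** Stands in for an isoperimetric inequality. With [u = min (w, 1)] as the weight and [h] so small
    that the variation term is at most 1/2, the mass [I] of [u] satisfies
    [1 - I <= \int w u <= C * I + 1/2], so [I] is at least [(2 * (1 + C))^-1]. *)
Lemma mass_truncation a0 : exists2 delta, 0 < delta & forall w a, admissible m w ->
  TVle w a -> a <= a0 -> \int[m]_x w x = 1 -> delta <= \int[m]_x Num.min (w x) 1.
Proof.
have [h h0 hP] : exists2 h : R, 0 < h & a0 * (n%:R * h) <= 2^-1.
  exists (2 * (`|a0| * n%:R + 1))^-1; first by rewrite invr_gt0 mulr_gt0// ltr_wpDl// mulr_ge0.
  have P0 : 0 < `|a0| * n%:R + 1 by rewrite ltr_wpDl// mulr_ge0.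
  rewrite mulrA invfM mulrCA ger_pMr// ler_pdivrMr// mul1r.
  rewrite (@le_trans _ _ (`|a0| * n%:R))// ?lerDl ?ler01// ler_wpM2r// ler_norm//.
have [rho rm] := mollifierP n h0.
have [G [C [_ rC _ _]]] := mollifier_data rm.
have C0 : 0 <= C := le_trans (normr_ge0 _) (rC 0).
exists (2 * (1 + C))^-1; first by rewrite invr_gt0 mulr_gt0// ltr_wpDr.
move=> w a wa Ta aa w1.
have ua := admissible_mins wa ler01.
have u1 x : Num.min (w x) 1 <= 1 by rewrite ge_min lexx orbT.
have := weight_le wa Ta ua u1 (ltW h0) rm (fun x => le_trans (ler_norm _) (rC x)).
rewrite w1 mulr1.
have wui : intble m (fun x => w x * Num.min (w x) 1).
  have u1' x : `|Num.min (w x) 1| <= 1 by rewrite ger0_norm//; case: ua.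
  exact: (intbleM wa.1 (intble_meas ua.1) u1').
(* Pointwise [w <= w * min (w, 1) + min (w, 1)]: where [w <= 1] the last term suffices, elsewhere
   the first one does. *)
have : 1 - \int[m]_x Num.min (w x) 1 <= \int[m]_x (w x * Num.min (w x) 1).
  rewrite lerBlDr -(RintegralD measurableT wui ua.1) -[leLHS]w1.
  apply: (le_Rintegral measurableT wa.1 (intbleD wui ua.1)) => x _.
  have := wa.2 x; case: (leP (w x) 1) => *; nra.
have : a * (n%:R * h) <= a0 * (n%:R * h) by rewrite ler_wpM2r// mulr_ge0// ltW.
set I := \int[m]_x Num.min _ _; set p := a * _; set q := \int[m]_x _ => *.
rewrite -[_^-1]mul1r ler_pdivrMr ?mulr_gt0 ?ltr_wpDr//.
lra.
Qed.

(** A multiple of a mollifier. If all the sets where [k%:R * rho] is at least 1 were null,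
    exhausting [rho] by them would give it zero integral. *)
Lemma bump_exists : exists w c (K : set 'rV[R]_n), [/\ admissible m w, measurable K,
  (0 < m K)%E, (forall x, K x -> 1 <= w x) & TVle w c].
Proof.
have [rho rm] := mollifierP n (@ltr01 R).
have [G [C [rG rC GC ri]]] := mollifier_data rm.
have [_ r0 rs r1] := rm.
have mr := intble_meas ri.
pose K (k : nat) := [set x | 1 <= k%:R * rho x].
have mK k : measurable (K k).
  have mk : measurable_fun setT (fun x => k%:R * rho x) by exact: measurable_funM.
  rewrite (_ : K k = (fun x => k%:R * rho x) @^-1` `[1, +oo[).
    by rewrite -[X in measurable X]setTI; exact: mk.
  by apply/seteqP; split => x; rewrite /K /= in_itv/= andbT.
have [k Kk] : exists k, (0 < m (K k))%E.
  apply: contrapT => nk.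
  have K0 k : m (K k) = 0%E.
    apply/eqP; rewrite eq_le measure_ge0 andbT leNgt; apply/negP => ?; apply: nk; by exists k.
  have iK k : intble m \1_(K k).
    apply: (intble_le _ _ (intbleZ k%:R ri)) => [|x]; first exact: measurable_indic.
    rewrite indicE; case: (boolP (x \in K k)) => [|_]; first by rewrite inE normr1.
    by rewrite normr0 mulr_ge0.
  have iKr k : intble m (fun x => rho x * \1_(K k) x).
    have K1 x : `|\1_(K k) x : R| <= 1 by rewrite ger0_norm// indicE lern1 leq_b1.
    exact: (intbleM ri (measurable_indic (mK k)) K1).
  have [||||_ lim] := @Rintegral_dct _ _ _ m (fun k x => rho x * \1_(K k) x) rho rho.
  - by move=> k; exact: (intble_meas (iKr k)).
  - move=> x; apply: cvg_near_cst; have := r0 x; rewrite le_eqVlt => /predU1P[<-|rx].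
      by apply: nearW => k; rewrite mul0r.
    near=> k; rewrite indicE mem_set ?mulr1// /K/= -ler_pdivrMr// mul1r.
    near: k; exact: nbhs_infty_ger.
  - by move=> k x; rewrite ger0_norm ?mulr_ge0// ler_piMr// indicE lern1 leq_b1.
  - exact: ri.
  have : \int[m]_x rho x <= 0.
    rewrite -(cvg_lim (@Rhausdorff R) lim); apply: limr_le.
      by apply/cvg_ex; eexists; exact: lim.
    apply: nearW => k.
    apply: (@le_trans _ _ (\int[m]_x (C * \1_(K k) x))).
      apply: (le_Rintegral measurableT (iKr k) (intbleZ C (iK k))) => x _.
      by rewrite ler_wpM2r// (le_trans (ler_norm _)).
    have K0' : \int[m]_x \1_(K k) x = 0.
      by apply: EFin_inj; rewrite (Rintegral_indicE (mK k) (iK k)); exact: K0.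
    by rewrite (RintegralZl _ measurableT (iK k)) K0' mulr0.
  by rewrite r1 ler10.
exists (fun x => k%:R * rho x), (k%:R * \sum_i \int[m]_x `|G i x|), (K k).
split => //; last exact: (TVleZ ri _ (TVle_C1 rG rs)).
by apply: admissibleZ.
Unshelve. all: by end_near.
Qed.

End energy_lemmas.

(** * From minimizing functions to minimizing sets *)

Section calibrable_set.
Context d (T : measurableType d) (R : realType) (mu : {measure set T -> \bar R}).
Implicit Types (u v w : T -> R) (c s : R).
Variable Qle : (T -> R) -> R -> Prop.
Hypothesis Q : energy mu Qle.

Let adm w := admissible mu w.

Lemma en_ge0 w c : adm w -> Qle w c -> 0 <= c.
Proof.
move=> wa Qw; have [V0 V00 co] := en_coer Q.
apply: le_trans (co _ _ wa Qw); rewrite mulr_ge0 ?(ltW V00)// Rintegral_ge0// => x _.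
by case: wa.
Qed.

(** [O] is the set where a minimizer [om] of [Q] among functions at least 1 on [K] attains the value
    1. Once [1_O] has the minimal energy [m], submodularity concludes: [max (u, 1_O)] is a
    competitor with energy at least [m], so [min (u, 1_O)] has at most the energy of [u]. *)
Lemma outward_minimizing_set : exists O m, [/\ measurable O, intble mu \1_O,
  0 < \int[mu]_x \1_O x, Qle \1_O m &
  forall u c, adm u -> Qle u c -> Qle (fun x => Num.min (u x) (\1_O x)) c].
Proof.
have [wb [cb [K [wba mK K0 wbK Qb]]]] := en_bump Q.
have [V0 V00 co] := en_coer Q.
pose S : set R := [set c | exists w, [/\ adm w, (forall x, K x -> 1 <= w x) & Qle w c]].
have S0 : lbound S 0 by move=> c [w [wa _ Qw]]; exact: en_ge0 wa Qw.
have iS : has_inf S by split; [exists cb, wb|exists 0].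
pose m := inf S.
have mle w c : adm w -> (forall x, K x -> 1 <= w x) -> Qle w c -> m <= c.
  by move=> wa wK Qw; apply: (ge_inf iS.2); exists w.
have m0 : 0 <= m by apply: lb_le_inf => //; exact: iS.1.
pose D u := (forall x, K x -> 1 <= u x) /\ (forall x, ~ [set: T] x -> u x = 0).
have /choice[w wP] : forall k : nat, exists w, [/\ adm w, D w, forall x, w x <= 1 &
    Qle w (m + 0 * \int[mu]_x w x + 2 ^- k.+1)].
  move=> k; have k0 : 0 < 2 ^- k.+1 :> R by rewrite invr_gt0 exprn_gt0.
  have [c [w [wa wK Qw]] cm] := inf_adherent k0 iS.
  have [c1 [d1 [Q1 Q2 cd]]] := en_cut Q wa ler01 Qw.
  exists (fun x => Num.min (w x) 1); split.
  - exact: admissible_mins.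
  - by split => [x xK|x /(_ I)//]; rewrite le_min wK/=.
  - by move=> x; rewrite ge_min lexx orbT.
  - apply: (en_mono Q Q1); rewrite mul0r addr0.
    have := en_ge0 (admissible_cut wa ler01) Q2; move: cm; rewrite -/m; lra.
have lb u c : adm u -> D u -> Qle u c -> m + 0 * \int[mu]_x u x <= c.
  by move=> ua [uK _] Qu; rewrite mul0r addr0; exact: mle ua uK Qu.
have bd u : adm u -> D u -> (forall x, u x <= 1) -> Qle u (m + 0 * \int[mu]_x u x + 1) ->
    \int[mu]_x u x <= (m + 1) / V0.
  move=> ua _ _ Qu; rewrite ler_pdivlMr// mulrC.
  by have := co _ _ ua Qu; rewrite mul0r addr0.
have [om [oma [omK _] om1 Qom _]] := limsup_minimizer Q (lexx 0) lb bd wP.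
move: Qom; rewrite mul0r addr0 => Qom.
have mom : measurable_fun setT om by case: oma => /intble_meas.
pose O := [set x | 1 <= om x].
have mO : measurable O.
  rewrite (_ : O = om @^-1` `[1, +oo[); first by rewrite -[X in measurable X]setTI; exact: mom.
  by apply/seteqP; split => x; rewrite /O /= in_itv/= andbT.
have Oom x : \1_O x <= om x.
  rewrite indicE; case: (boolP (x \in O)) => [|_]; first by rewrite inE.
  by case: oma.
have iO : intble mu \1_O.
  apply: (intble_le _ _ (oma.1)) => [|x]; first exact: measurable_indic.
  by rewrite ger0_norm.
have KO x : K x -> \1_O x = 1 :> R by move=> Kx; rewrite indicE mem_set//; exact: omK.
have QO : Qle \1_O m.
  (* The slice of [om] above [s k], rescaled by [t k] to height 1, tends to [1_O]. Starting at 2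
     gives [s k >= 1/2], whence the domination by [2 * om]. *)
  pose t k : R := k.+2%:R; pose s k : R := 1 - (t k)^-1.
  have t0 k : 0 < t k by [].
  have s2 k : 2^-1 <= s k.
    rewrite /s lerBrDl -lerBrDr (_ : 1 - 2^-1 = 2^-1 :> R); last by field.
    by rewrite lef_pV2 ?posrE// ler_nat.
  have s0 k : 0 < s k by rewrite (lt_le_trans _ (s2 k)).
  have ts k : t k * (1 - s k) = 1 by rewrite /s subKr mulfV// lt0r_neq0.
  have s1 k : s k < 1 by rewrite /s gtrBl invr_gt0.
  apply: (en_lsc Q (w_ := fun k x => t k * Num.max (om x - s k) 0)
    (g := fun x => 2 * om x) (c_ := fun=> m)).
  + move=> k; apply: admissibleZ; last exact: ltW.
    by apply: admissible_cut => //; exact: ltW.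
  + move=> x; rewrite indicE; case: (boolP (x \in O)) => [|xO].
      rewrite inE => xO; have {}xO : om x = 1 by apply/eqP; rewrite eq_le om1 xO.
      rewrite (_ : (fun k => _) = cst 1); first exact: cvg_cst.
      by apply/funext => k; rewrite xO max_l ?ts//= subr_ge0 ltW.
    have {}xO : om x < 1 by rewrite ltNge; apply: contra xO => xO; rewrite inE.
    have xO' : 0 < 1 - om x by rewrite subr_gt0.
    apply: cvg_near_cst; near=> k.
    rewrite max_r ?mulr0// subr_le0 /s lerBrDl -lerBrDr.
    rewrite (@le_trans _ _ k.+1%:R^-1)//.
      by rewrite lef_pV2 ?posrE// ler_nat.
    by apply: ltW; near: k; exact: (near_infty_natSinv_lt (PosNum xO')).
  + move=> k x; have := om1 x; have := ts k; have := s2 k; have := s1 k; have := t0 k.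
    have : 0 <= om x by case: oma.
    by case: (leP (om x - s k) 0) => *; nra.
  + exact: (intbleZ _ oma.1).
  + move=> k; have [c [d' [Qc Qd cd]]] := en_cut Q oma (ltW (s0 k)) Qom.
    have ac := admissible_mins oma (ltW (s0 k)).
    have ad := admissible_cut oma (ltW (s0 k)).
    have si0 : 0 < (s k)^-1 by rewrite invr_gt0.
    (* The lower slice divided by [s k] is again a competitor, so it uses at least [s k * m],
       leaving at most [(1 - s k) * m] for the upper slice; multiplication by [t k] restores [m]. *)
    have h1 : m <= (s k)^-1 * c.
      apply: (mle _ _ (admissibleZ ac (ltW si0)) _ (en_scale Q ac si0 Qc)) => x xK.
      rewrite min_r ?mulVf ?lt0r_neq0//.
      by rewrite (le_trans (ltW (s1 k)))// omK.
    have h2 : s k * m <= c by rewrite -ler_pdivlMl.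
    apply: (en_mono Q (en_scale Q ad (t0 k) Qd)).
    rewrite -[leRHS]mul1r -(ts k) -mulrA ler_pM2l//; lra.
  + exact: cvg_cst.
exists O, m; split => //.
- rewrite -lte_fin (Rintegral_indicE mO iO) (lt_le_trans K0)//.
  by apply: le_measure; rewrite ?inE// => x /omK.
- move=> u c ua Qu.
  have oa : adm \1_O by exact: admissible_indic.
  have [c' [d' [Qc' Qd' cd]]] := en_submod Q ua oa Qu QO.
  apply: (en_mono Q Qc'); have : m <= d'; last by lra.
  by apply: (mle _ _ (admissible_max ua oa) _ Qd') => x Kx; rewrite le_max KO// lexx orbT.
Unshelve. all: by end_near.
Qed.

(** A Cheeger problem relative to [O]: [lam] is the least energy per unit mass among functions
    vanishing off [O], and [E] attains it. The final inequality concerns all [u], and there the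
    outward minimality of [O] enters. *)
Theorem calibrable_set : exists E lam, 0 < lam /\ [/\ measurable E, intble mu \1_E,
  0 < \int[mu]_x \1_E x, Qle \1_E (lam * \int[mu]_x \1_E x) &
  forall u c, adm u -> Qle u c -> lam * \int[mu]_x (\1_E x * u x) <= c].
Proof.
have [ O [cO [mO iO O0 QO outO]]] := outward_minimizing_set.
have [V0 V00 co] := en_coer Q.
have oa : adm \1_O by exact: admissible_indic.
pose S : set R := [set c | exists w,
  [/\ adm w, forall x, ~ O x -> w x = 0, \int[mu]_x w x = 1 & Qle w c]].
have S0 : lbound S V0.
  by move=> c [w [wa _ w1 Qw]]; have := co _ _ wa Qw; rewrite w1 mulr1.
have iS : has_inf S.
  split; last by exists V0.
  have i0 : 0 < (\int[mu]_x \1_O x)^-1 by rewrite invr_gt0.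
  exists ((\int[mu]_x \1_O x)^-1 * cO), (fun x => (\int[mu]_x \1_O x)^-1 * \1_O x).
  split; [exact: (admissibleZ oa (ltW i0))| | |exact: (en_scale Q oa i0 QO)].
  - by move=> x xO; rewrite indicE memNset// mulr0.
  - by rewrite (RintegralZl _ measurableT iO) mulVf// lt0r_neq0.
pose lam := inf S.
have lam0 : 0 < lam by rewrite (lt_le_trans V00)//; apply: lb_le_inf => //; exact: iS.1.
have lamle w c : adm w -> (forall x, ~ O x -> w x = 0) -> Qle w c ->
    lam * \int[mu]_x w x <= c.
  move=> wa wO Qw; have : 0 <= \int[mu]_x w x by apply: Rintegral_ge0 => x _; case: wa.
  rewrite le_eqVlt => /predU1P[<-|w0]; first by rewrite mulr0; exact: en_ge0 wa Qw.
  have i0 : 0 < (\int[mu]_x w x)^-1 by rewrite invr_gt0.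
  rewrite -ler_pdivlMr// mulrC; apply: (ge_inf iS.2).
  exists (fun x => (\int[mu]_x w x)^-1 * w x).
  split; [exact: (admissibleZ wa (ltW i0))| | |exact: (en_scale Q wa i0 Qw)].
  - by move=> x /wO ->; rewrite mulr0.
  - by rewrite (RintegralZl _ measurableT (wa.1)) mulVf// lt0r_neq0.
have /choice[w wP] k : exists w, [/\ adm w, forall x, ~ O x -> w x = 0,
    \int[mu]_x w x = 1 & Qle w (lam + 2 ^- k.+1)].
  have k0 : 0 < 2 ^- k.+1 :> R by rewrite invr_gt0 exprn_gt0.
  have [c [w [wa wO w1 Qw]] cm] := inf_adherent k0 iS.
  by exists w; split => //; apply: (en_mono Q Qw); exact: ltW.
(* The part of [u] above [s] also vanishes off [O], so it uses at least [lam] times its mass; hence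
   cutting does not increase the excess of [Q] over [lam * \int]. *)
have cutle u s c : adm u -> (forall x, ~ O x -> u x = 0) -> 0 <= s -> Qle u c ->
    Qle (fun x => Num.min (u x) s) (c - lam * \int[mu]_x u x + lam * \int[mu]_x Num.min (u x) s).
  move=> ua uO s0 Qu; have [c1 [d1 [Qc Qd cd]]] := en_cut Q ua s0 Qu.
  have h : lam * \int[mu]_x Num.max (u x - s) 0 <= d1.
    apply: (lamle _ _ (admissible_cut ua s0) _ Qd) => x /uO ->.
    by rewrite sub0r max_r// oppr_le0.
  apply: (en_mono Q Qc); rewrite -(Rintegral_cut ua s0) mulrDr.
  by move: h cd; set i1 := lam * _; set i2 := lam * _ => h cd; lra.
pose D u := (forall x, @set0 T x -> 1 <= u x) /\ (forall x, ~ O x -> u x = 0).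
(* Truncation at height 1 keeps the excess and makes the mass of all maxima at most that of
   [1_O]. *)
have zP k : [/\ adm (fun x => Num.min (w k x) 1), D (fun x => Num.min (w k x) 1),
    forall x, Num.min (w k x) 1 <= 1 & Qle (fun x => Num.min (w k x) 1)
     (0 + lam * \int[mu]_x Num.min (w k x) 1 + 2 ^- k.+1)].
  have [wa wO w1 Qw] := wP k; split.
  - exact: admissible_mins.
  - by split => [//|x /wO ->]; rewrite min_l.
  - by move=> x; rewrite ge_min lexx orbT.
  - by apply: (en_mono Q (cutle _ _ _ wa wO ler01 Qw)); rewrite w1; lra.
have lb u c : adm u -> D u -> Qle u c -> 0 + lam * \int[mu]_x u x <= c.
  by move=> ua [_ uO] Qu; rewrite add0r; exact: lamle.
have bd u : adm u -> D u -> (forall x, u x <= 1) -> Qle u (0 + lam * \int[mu]_x u x + 1) ->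
    \int[mu]_x u x <= \int[mu]_x \1_O x.
  move=> [ui _] [_ uO] u1 _; apply: (le_Rintegral measurableT ui iO) => x _.
  by rewrite indicE; case: (boolP (x \in O)) => [//|xO]; rewrite uO// => /mem_set; apply/negP.
have [z [za [_ zO] z1 Qz zint]] := limsup_minimizer Q (ltW lam0) lb bd zP.
rewrite add0r in Qz.
have [del del0 iso] := en_iso Q (lam + 1).
(* All [w k] have unit mass and energy at most [lam + 1], so their truncations retain the common
   mass [del], and [z] is not zero. *)
have zdel : del <= \int[mu]_x z x.
  apply: zint => k; have [wa wO w1 Qw] := wP k; apply: (iso _ wa w1).
  apply: (en_mono Q Qw); rewrite lerD2l invf_le1 ?exprn_gt0// exprn_ege1// ler1n//.
pose E := [set x | 0 < z x].
have z0 x : 0 <= z x by case: za.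
have mz : measurable_fun setT z by case: za => /intble_meas.
have mE : measurable E.
  rewrite (_ : E = z @^-1` `]0, +oo[); first by rewrite -[X in measurable X]setTI; exact: mz.
  by apply/seteqP; split => x; rewrite /E /= in_itv/= andbT.
have zE x : z x <= \1_E x.
  rewrite indicE; case: (boolP (x \in E)) => [//|xE]; rewrite leNgt; apply: contra xE => xE.
  exact: mem_set.
have EO x : \1_E x <= \1_O x :> R.
  rewrite !indicE; case: (boolP (x \in E)) => [|//]; rewrite inE /E/= => zx.
  rewrite mem_set//; apply: contrapT => /zO zx0; by rewrite zx0 ltxx in zx.
have iE : intble mu \1_E.
  apply: (intble_le _ _ iO) => [|x]; first exact: measurable_indic.
  by rewrite ger0_norm.
pose t k : R := k.+1%:R.
have t0 k : 0 < t k by [].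
exists E, lam; split => //; split => //.
- by rewrite (lt_le_trans del0)// (le_trans zdel)//; apply: (le_Rintegral measurableT (za.1) iE).
(* Thin slices at the bottom of [z], rescaled to height 1, increase to the indicator of its
   positivity set. Since [z] has no excess, neither do they. *)
- pose y k x : R := t k * Num.min (z x) (t k)^-1.
  have ya k : adm (y k).
    by apply: admissibleZ; [apply: admissible_mins => //; rewrite invr_ge0 ltW|exact: ltW].
  have yO k x : y k x <= \1_E x.
    rewrite /y indicE; case: (boolP (x \in E)) => [_|xE].
      by rewrite -ler_pdivlMl// mulr1 ge_min lexx orbT.
    rewrite (_ : z x = 0) ?min_l ?mulr0// ?invr_ge0 ?ltW//; apply/eqP.
    by rewrite eq_le z0 andbT leNgt; apply: contra xE => xE; exact: mem_set.
  have ycvg x : y k x @[k --> \oo] --> (\1_E x : R).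
    rewrite indicE; case: (boolP (x \in E)) => [|xE].
      rewrite inE /E/= => zx; apply: cvg_near_cst; near=> k.
      rewrite /y min_r ?mulfV ?lt0r_neq0//; apply: ltW; near: k.
      exact: (near_infty_natSinv_lt (PosNum zx)).
    apply: cvg_near_cst; apply: nearW => k; apply/eqP; rewrite eq_le (ya k).2 andbT.
    by have := yO k x; rewrite indicE (negbTE xE).
  have [||||_ Iy] := @Rintegral_dct _ _ _ mu y \1_E \1_E.
  + by move=> k; exact: (intble_meas (ya k).1).
  + exact: ycvg.
  + by move=> k x; rewrite ger0_norm//; exact: (ya k).2.
  + exact: iE.
  apply: (en_lsc Q (w_ := y) (g := \1_E) (c_ := fun k => lam * \int[mu]_x y k x)) => //.
  + move=> k; have tk0 : 0 <= (t k)^-1 by rewrite invr_ge0 ltW.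
    have ma := admissible_mins za tk0.
    have := en_scale Q ma (t0 k) (cutle _ _ _ za zO tk0 Qz).
    by rewrite subrr add0r mulrCA -(RintegralZl _ measurableT (ma.1)).
  + by apply: cvgM => //; exact: cvg_cst.
- move=> u c ua Qu.
  (* This is [min (u, t k * 1_O)], written so that outward minimality applies to a multiple of [u];
     it tends to [1_O * u]. *)
  pose h k x : R := t k * Num.min ((t k)^-1 * u x) (\1_O x).
  have ti k : 0 < (t k)^-1 by rewrite invr_gt0.
  have ta k := admissibleZ ua (ltW (ti k)).
  have na k := admissible_min (ta k) oa.
  have ha k : adm (h k) by apply: admissibleZ; [exact: na|exact: ltW].
  have hu k x : h k x <= u x by rewrite /h -ler_pdivlMl// ge_min lexx.
  have hO k x : O x -> u x <= t k -> h k x = u x.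
    move=> xO ut; rewrite /h min_l ?mulrA ?mulfV ?mul1r ?lt0r_neq0//.
    by rewrite indicE mem_set// -ler_pdivlMl ?invrK ?mulr1.
  have hcvg x : h k x @[k --> \oo] --> \1_O x * u x.
    apply: cvg_near_cst; rewrite indicE; case: (boolP (x \in O)) => [|xO].
      rewrite inE mul1r => xO; near=> k; apply: hO => //.
      rewrite /t (@le_trans _ _ k%:R)//; last by rewrite ler_nat.
      near: k; exact: nbhs_infty_ger.
    apply: nearW => k; rewrite mul0r /h indicE (negbTE xO) min_r ?mulr0//.
    by rewrite mulr_ge0 ?(ltW (ti k))//; case: ua.
  have [||||iOu Ih] := @Rintegral_dct _ _ _ mu h (fun x => \1_O x * u x) u.
  + by move=> k; exact: (intble_meas (ha k).1).
  + exact: hcvg.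
  + by move=> k x; rewrite ger0_norm//; exact: (ha k).2.
  + exact: ua.1.
  have le1 : lam * \int[mu]_x (\1_O x * u x) <= c.
    have cl : lam * \int[mu]_x h k x @[k --> \oo] --> lam * \int[mu]_x (\1_O x * u x).
      by apply: cvgM => //; exact: cvg_cst.
    rewrite -(cvg_lim (@Rhausdorff R) cl); apply: limr_le.
      by apply/cvg_ex; eexists; exact: cl.
    apply: nearW => k; rewrite (RintegralZl _ measurableT (na k).1) mulrCA -ler_pdivlMl//.
    apply: (lamle _ _ (na k) _ (outO _ _ (ta k) (en_scale Q ua (ti k) Qu))) => x xO.
    by rewrite indicE memNset// min_r//; case: (ta k).
  apply: le_trans le1; rewrite ler_pM2l//; apply: le_Rintegral => //.
    apply: (intble_le _ _ ua.1) => [|x].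
      by apply: measurable_funM; [exact: measurable_indic|exact: (intble_meas ua.1)].
    have ux : 0 <= u x by case: ua.
    rewrite normrM [`|u x|]ger0_norm// -[leRHS]mul1r ler_wpM2r//.
    by rewrite indicE ger0_norm// lern1 leq_b1.
  by move=> x _; rewrite ler_wpM2r//; case: ua.
Unshelve. all: by end_near.
Qed.

End calibrable_set.

(** * The weighted perimeter and the equation *)

Section weighted_perimeter.
Variables (R : realType) (n : nat) (V : 'rV[R]_n -> R) (V0 M eps : R).
Notation m := (leb R n).
Hypotheses (mV : measurable_fun setT V) (V00 : 0 < V0) (V0V : forall x, V0 <= V x).
Hypotheses (VM : forall x, `|V x| <= M) (eps0 : 0 < eps).
Implicit Types (u v w : 'rV[R]_n -> R) (a c : R).

(** The potential term has no absolute value: on nonnegative functions nothing changes, and being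
    linear it is additive under minimum with maximum and under cuts. *)
Definition norm_star_le w c := exists2 a, TVle w a & eps * a + \int[m]_x (V x * w x) <= c.

Lemma intble_potential w : intble m w -> intble m (fun x => V x * w x).
Proof. by move=> wi; have := intbleM wi mV VM; under eq_fun do rewrite mulrC. Qed.

Let V_ge0 x : 0 <= V x. Proof. by rewrite (le_trans (ltW V00)). Qed.

Lemma norm_star_energy : energy m norm_star_le.
Proof.
split.
- by move=> w c c' [a Ta ac] cc'; exists a => //; exact: le_trans cc'.
- move=> w a c [wi w0] a0 [b Tb bc]; exists (a * b); first exact: TVleZ wi (ltW a0) Tb.
  have -> : \int[m]_x (V x * (a * w x)) = a * \int[m]_x (V x * w x).
    rewrite -(RintegralZl _ measurableT (intble_potential wi)).
    by apply: eq_Rintegral => x _; rewrite mulrCA.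
  by rewrite mulrCA -mulrDr ler_pM2l.
- move=> u v a b ua va [a' Ta aa] [b' Tb bb].
  have [p [q [Tp Tq pq]]] := TVle_minmax ua.1 va.1 Ta Tb.
  have [mi _] := admissible_min ua va; have [Mi _] := admissible_max ua va.
  do 2 eexists; split; [by exists p|by exists q|].
  have : \int[m]_x (V x * Num.min (u x) (v x)) + \int[m]_x (V x * Num.max (u x) (v x)) =
      \int[m]_x (V x * u x) + \int[m]_x (V x * v x).
    rewrite -(RintegralD measurableT (intble_potential mi) (intble_potential Mi)).
    rewrite -(RintegralD measurableT (intble_potential ua.1) (intble_potential va.1)).
    by apply: eq_Rintegral => x _; rewrite -!mulrDr addr_min_max.
  have : eps * (p + q) <= eps * (a' + b') by rewrite ler_pM2l.
  rewrite !mulrDr => h1 h2; move: aa bb h1 h2.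
  set i1 := Rintegral _ _ _; set i2 := Rintegral _ _ _; set i3 := Rintegral _ _ _.
  set i4 := Rintegral _ _ _ => *; lra.
- move=> u s a ua s0 [a' Ta aa].
  have [p [q [Tp Tq pq]]] := TVle_cut ua s0 Ta.
  have [mi _] := admissible_mins ua s0; have [Mi _] := admissible_cut ua s0.
  do 2 eexists; split; [by exists p|by exists q|].
  have : \int[m]_x (V x * Num.min (u x) s) + \int[m]_x (V x * Num.max (u x - s) 0) =
      \int[m]_x (V x * u x).
    rewrite -(RintegralD measurableT (intble_potential mi) (intble_potential Mi)).
    apply: eq_Rintegral => x _; rewrite -mulrDr; congr (_ * _).
    by case: (leP (u x) s); case: (leP (u x - s)) => *; lra.
  have : eps * (p + q) <= eps * a' by rewrite ler_pM2l.
  rewrite mulrDr => h1 h2; move: aa h1 h2.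
  set i1 := Rintegral _ _ _; set i2 := Rintegral _ _ _; set i3 := Rintegral _ _ _ => *; lra.
- move=> w_ w g c_ c wa ww wg gi Qw cc.
  have wi k : intble m (w_ k) := (wa k).1.
  have wg' k x : `|w_ k x| <= g x by rewrite ger0_norm//; exact: (wa k).2.
  have [||||Vi Iv] := @Rintegral_dct _ _ _ m (fun k x => V x * w_ k x) (fun x => V x * w x)
    (fun x => M * g x).
  + by move=> k; exact: (intble_meas (intble_potential (wi k))).
  + by move=> x; apply: cvgM; [exact: cvg_cst|exact: ww].
  + by move=> k x; rewrite normrM ler_pM.
  + exact: intbleZ.
  set I := \int[m]_x (V x * w x) in Iv.
  (* What is left of the bound [c] for the total variation of the limit. It is reached up to any
     [e > 0], the tails having variation at most [eps^-1 * (c - I) + e]. *)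
  exists (eps^-1 * (c - I)); last by rewrite mulrA mulfV ?lt0r_neq0// mul1r subrK.
  move=> phi tp; apply/ler_addgt0Pr => e e0.
  have e'0 : 0 < eps * e / 2 by rewrite divr_gt0// mulr_gt0.
  suff /(_ phi tp) : TVle w (eps^-1 * (c - I) + e) by [].
  apply: (TVle_lsc (fun k => intble_meas (wi k)) ww wg' gi); near=> k.
  have [a Ta ac] := Qw k => psi tq; apply: (le_trans (Ta psi tq)).
  have h1 : `|I - \int[m]_x (V x * w_ k x)| < eps * e / 2.
    by near: k; move/cvgrPdist_lt : Iv; exact.
  have h2 : `|c - c_ k| < eps * e / 2.
    by near: k; move/cvgrPdist_lt : cc; exact.
  rewrite -(ler_pM2l eps0) mulrDr mulrA mulfV ?lt0r_neq0// mul1r.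
  move: ac h1 h2; rewrite !ltr_norml; set i1 := Rintegral _ _ _.
  by move=> h /andP[h1 h2] /andP[h3 h4]; lra.
- exists V0 => // w c [wi w0] [a Ta ac].
  rewrite -(RintegralZl _ measurableT wi).
  apply: (@le_trans _ _ (\int[m]_x (V x * w x))).
    apply: (le_Rintegral measurableT (intbleZ V0 wi) (intble_potential wi)) => x _.
    by rewrite ler_wpM2r.
  by apply: le_trans ac; rewrite lerDr mulr_ge0 ?(ltW eps0)// (TVle_ge0 Ta).
- move=> C; have [del del0 delP] := mass_truncation n (eps^-1 * C).
  exists del => // w wa w1 [a Ta ac]; apply: (delP _ a wa Ta _ w1).
  rewrite ler_pdivlMl//; apply: le_trans ac; rewrite lerDl; apply: Rintegral_ge0 => x _.
  by rewrite mulr_ge0//; case: wa.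
- have [w [c [K [wa mK K0 wK Tc]]]] := bump_exists R n.
  by exists w, (eps * c + \int[m]_x (V x * w x)), K; split => //; exists c.
Unshelve. all: by end_near.
Qed.

Lemma intble_L1 w : L1 w <-> intble m w.
Proof.
rewrite /L1 measurableNE intbleP; split => -[mw].
  by rewrite iint_ge0//; apply/measurable_EFinP; exact: measurableT_comp.
by move=> iw; split => //; rewrite iint_ge0//; apply/measurable_EFinP; exact: measurableT_comp.
Qed.

Lemma BV_TVle w : BV w <-> intble m w /\ exists a, Defs.total_variation w = a%:E /\ TVle w a.
Proof.
rewrite /BV intble_L1; split => -[wi].
  move=> Tw; split => //; have T0 : (0 <= Defs.total_variation w)%E.
    apply: ereal_sup_ubound; exists (fun _ _ => 0); split; first exact: test_field0.
    have -> : (fun x : 'rV[R]_n => (w x * divergence (fun (_ : 'I_n) _ => 0) x)%:E) = cst 0%E.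
      by apply/funext => x; rewrite divergence0 mulr0.
    by rewrite iint_ge0// integral0.
  have Tf : Defs.total_variation w \is a fin_num by rewrite ge0_fin_numE.
  exists (fine (Defs.total_variation w)); rewrite fineK//; split => //.
  by apply/(TVleP _ wi); rewrite fineK.
by move=> [a [-> _]]; split => //; exact: ltry.
Qed.

Lemma norm_starE w a : intble m w -> Defs.total_variation w = a%:E ->
  norm_star eps V w = (eps * a + \int[m]_x (V x * `|w x|))%:E.
Proof.
move=> wi Tw; rewrite /norm_star Tw iint_integrable.
  by rewrite EFinD EFinM -intbleE//; apply: intble_potential; exact: intble_norm.
by apply: intble_potential; exact: intble_norm.
Qed.

(** Submodularity against 0: the total variation of [min (w, 0)] is nonnegative, so that of the
    positive part does not exceed the one of [w]. *)
Lemma positive_part_le w a : intble m w -> TVle w a ->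
  norm_star_le (fun x => Num.max (w x) 0) (eps * a + \int[m]_x (V x * `|w x|)).
Proof.
move=> wi Tw.
have [p [q [Tp Tq pq]]] := TVle_minmax wi (intble0 m) Tw (@TVle0 R n).
exists q => //; apply: lerD.
  by rewrite ler_pM2l//; have := TVle_ge0 Tp; lra.
have wi' := intble_norm wi.
have pi : intble m (fun x => Num.max (w x) 0).
  apply: (intble_le _ _ wi') => [|x]; first by apply: measurable_maxr => //; exact: intble_meas wi.
  by rewrite ger0_norm ?le_max ?lexx ?orbT// ge_max ler_norm normr_ge0.
apply: (le_Rintegral measurableT (intble_potential pi) (intble_potential wi')) => x _.
by rewrite ler_wpM2l// ge_max ler_norm normr_ge0.
Qed.

(** As [f (u) = lam 1_E], the right-hand side is [lam * \int_E w - lam * t * \int 1_E]. Passing to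
    the positive part of [w] increases the first term and not the energy, so it is at most the norm
    of [w]; the norm of [u] is at most the second term. *)
Lemma calibrable_solution (f : R -> R) (E : set 'rV[R]_n) (lam t : R) :
  0 < t -> f 0 = 0 -> f t = lam -> measurable E -> intble m \1_E -> 0 < lam ->
  norm_star_le \1_E (lam * \int[m]_x \1_E x) ->
  (forall w c, admissible m w -> norm_star_le w c -> lam * \int[m]_x (\1_E x * w x) <= c) ->
  BV_solution eps V f (fun x => t * \1_E x).
Proof.
move=> t0 f0 ft mE iE lam0 [a Ta aE] cal.
pose u (x : 'rV[R]_n) : R := t * \1_E x.
have ui : intble m u := intbleZ t iE.
have Tu : TVle u (t * a) := TVleZ iE (ltW t0) Ta.
have uBV : BV u.
  rewrite /BV intble_L1; split => //; apply: le_lt_trans (ltry (t * a)).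
  by apply/(TVleP _ ui).
split => // w /BV_TVle[wi [b [Tb TVb]]].
have [_ [b' [Tb' _]]] := (BV_TVle u).1 uBV.
have b'a : b' <= t * a by rewrite -lee_fin -Tb'; apply/(TVleP _ ui).
rewrite (norm_starE wi Tb) (norm_starE ui Tb') -EFinB.
have Ebd x : `|\1_E x : R| <= 1 by rewrite ger0_norm// indicE lern1 leq_b1.
have wE : intble m (fun x => \1_E x * w x).
  by have := intbleM wi (measurable_indic mE) Ebd; under eq_fun do rewrite mulrC.
have iF : intble m (fun x => lam * (\1_E x * w x) - lam * t * \1_E x).
  by apply: intbleB; exact: intbleZ.
have -> : (fun x => (f (u x) * (w x - u x))%:E) =
    (fun x => (lam * (\1_E x * w x) - lam * t * \1_E x)%:E).
  apply/funext => x; congr EFin; rewrite /u indicE.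
  by case: (x \in E); rewrite /= ?mulr1n ?mulr0n ?mulr1 ?mulr0 ?ft ?f0; ring.
rewrite iint_integrable// -intbleE// lee_fin.
rewrite (RintegralB measurableT (intbleZ lam wE) (intbleZ (lam * t) iE)).
rewrite (RintegralZl _ measurableT wE) (RintegralZl _ measurableT iE).
have wi' := intble_norm wi.
have pa : admissible m (fun x => Num.max (w x) 0).
  split => [|x]; last by rewrite le_max lexx orbT.
  apply: (intble_le _ _ wi') => [|x]; first by apply: measurable_maxr => //; exact: intble_meas wi.
  by rewrite ger0_norm ?le_max ?lexx ?orbT// ge_max ler_norm normr_ge0.
have c1 := cal _ _ pa (positive_part_le wi TVb).
have pE : intble m (fun x => \1_E x * Num.max (w x) 0).
  by have := intbleM pa.1 (measurable_indic mE) Ebd; under eq_fun do rewrite mulrC.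
have c2 : lam * \int[m]_x (\1_E x * w x) <= lam * \int[m]_x (\1_E x * Num.max (w x) 0).
  rewrite ler_pM2l//; apply: (le_Rintegral measurableT wE pE) => x _.
  by rewrite ler_wpM2l// le_max lexx.
have c3 : \int[m]_x (V x * `|u x|) = t * \int[m]_x (V x * \1_E x).
  rewrite -(RintegralZl _ measurableT (intble_potential iE)).
  by apply: eq_Rintegral => x _; rewrite ger0_norm ?mulr_ge0 ?(ltW t0)// mulrCA.
have c4 : t * (eps * a + \int[m]_x (V x * \1_E x)) <= t * (lam * \int[m]_x \1_E x).
  by rewrite ler_pM2l.
have c5 : eps * b' <= eps * (t * a) by rewrite ler_pM2l.
rewrite c3; move: c1 c2 c4 c5.
set i1 := \int[m]_x (V x * `|w x|); set i2 := \int[m]_x (V x * \1_E x).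
set i3 := \int[m]_x \1_E x.
set i4 := lam * \int[m]_x _; set i5 := lam * \int[m]_x _ => *; nra.
Qed.

End weighted_perimeter.

(** * The range of the nonlinearity *)

Section superlinear.
Variables (R : realType) (f : R -> R) (theta : R).
Hypotheses (cf : continuous f) (f_incr : forall s t, s < t -> f s < f t) (f0 : f 0 = 0).
Hypotheses (theta1 : 1 < theta)
  (AR : forall s, s != 0 -> theta * primitive f s <= f s * s).

Lemma primitive_ge (s0 s : R) : 0 <= s0 -> s0 <= s -> f s0 * (s - s0) <= primitive f s.
Proof.
move=> s00 s0s; have s1 : 0 <= s := le_trans s00 s0s.
have mono x y : x <= y -> f x <= f y.
  by rewrite le_eqVlt => /predU1P[->//|/f_incr/ltW].
have fi : lebesgue_measure.-integrable `[0, s] (EFin \o f).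
  apply: continuous_compact_integrable; first exact: segment_compact.
  by apply: continuous_subspaceT.
have mf D : measurable_fun D (EFin \o f).
  by apply/measurable_EFinP; apply: measurable_funTS; exact: continuous_measurable_fun.
have fI x : x \in `[0, s] -> (0 <= (f x)%:E)%E.
  by rewrite in_itv/= => /andP[x0 _]; rewrite lee_fin -f0 mono.
rewrite /primitive s1 -lee_fin fineK; last exact: integrable_fin_num fi.
apply: (@le_trans _ _ (\int[@lebesgue_measure R]_(x in `[s0, s]) (f x)%:E)%E).
  apply: (@le_trans _ _ (\int[@lebesgue_measure R]_(x in `[s0, s]) (cst (f s0)%:E x))%E).
    rewrite integral_cst//= lebesgue_measure_itv/= lte_fin.
    case: ltP => [_|ss0]; first by rewrite EFinM EFinB.
    by rewrite mule0 lee_fin (_ : s - s0 = 0) ?mulr0//; apply/eqP; rewrite subr_eq0 eq_le ss0 s0s.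
  apply: ge0_le_integral => //.
  - by move=> x _; rewrite lee_fin -f0 mono.
  - exact: mf.
  - by move=> x; rewrite /= in_itv/= => /andP[sx _]; rewrite lee_fin mono.
apply: ge0_subset_integral => //; first exact: mf.
by move=> x; rewrite /= !in_itv/= => /andP[sx ->]; rewrite (le_trans s00 sx).
Qed.

(** Were [f] bounded above with supremum [L], then [primitive f s] would grow at least like
    [f s0 * s] while [f s * s <= L * s]; letting [s] grow, [theta * f s0 <= L] for every [s0 > 0],
    and so [theta * L <= L], against [theta > 1]. The intermediate value theorem then gives [t]. *)
Lemma superlinear_onto lam : 0 < lam -> exists2 t, 0 < t & f t = lam.
Proof.
move=> lam0.
have mono x y : x <= y -> f x <= f y.
  by rewrite le_eqVlt => /predU1P[->//|/f_incr/ltW].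
have [s s0 sl] : exists2 s : R, 0 < s & lam <= f s.
  apply: contrapT => ns.
  have bd s : f s <= lam.
    have p1 : 0 < Num.max s 1 by rewrite lt_max ltr01 orbT.
    apply: (@le_trans _ _ (f (Num.max s 1))); first by rewrite mono// le_max lexx.
    by rewrite leNgt; apply/negP => h; apply: ns; exists (Num.max s 1) => //; exact: ltW.
  have iS : has_sup (range f) by split; [exists (f 0), 0|exists lam => _ [x _ <-]].
  set L := sup (range f).
  have fL x : f x <= L by apply: (ub_le_sup iS.2); exists x.
  have L0 : 0 < L by apply: lt_le_trans (fL 1); rewrite -f0 f_incr.
  have th0 : 0 < theta := lt_trans ltr01 theta1.
  have tL (s0 : R) : 0 < s0 -> theta * f s0 <= L.
    move=> s00; rewrite leNgt; apply/negP => h.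
    have fs0 : 0 < f s0 by rewrite -f0 f_incr.
    pose d := theta * f s0 - L; have d0 : 0 < d by rewrite subr_gt0.
    (* Large enough for the contradiction: [theta * f s0 * (s - s0) <= L * s] means
       [d * (s - s0) <= L * s0], while [L * s0] is less than [theta * f s0 * s0]. *)
    have [s ss0 sd] : exists2 s : R, s0 < s & d * (s - s0) = theta * f s0 * s0.
      exists (s0 + (theta * f s0 * s0) / d); first by rewrite ltrDl divr_gt0// !mulr_gt0.
      by rewrite addrC addKr mulrC divfK// lt0r_neq0.
    have s'0 : 0 < s := lt_trans s00 ss0.
    have h1 := AR (lt0r_neq0 s'0).
    have h2 : theta * (f s0 * (s - s0)) <= theta * primitive f s.
      by rewrite ler_pM2l// primitive_ge ?(ltW s00)// ltW.
    have h3 : f s * s <= L * s by rewrite ler_pM2r.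
    have : L * s0 < theta * f s0 * s0 by rewrite ltr_pM2r.
    move: sd h1 h2 h3; rewrite /d; set P := primitive f s; set p := f s; set p0 := f s0 => *; lra.
  have : theta * L <= L.
    rewrite mulrC -ler_pdivlMr//.
    apply: ge_sup; first exact: iS.1.
    move=> _ [x _ <-]; rewrite ler_pdivlMr//.
    have p1 : 0 < Num.max x 1 by rewrite lt_max ltr01 orbT.
    apply: le_trans (tL _ p1); rewrite mulrC ler_pM2l//.
    by rewrite mono// le_max lexx.
  by rewrite ger_pMl// leNgt theta1.
have [||t] := @IVT _ f 0 s lam (ltW s0).
- by apply: continuous_subspaceT.
- by rewrite f0 ge_min (ltW lam0) le_max sl orbT.
rewrite in_itv/= => /andP[t0 _] ft; exists t => //.
rewrite lt_neqAle t0 andbT; apply/eqP => t0'; move: ft; rewrite -t0' f0 => l0.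
by rewrite l0 ltxx in lam0.
Qed.

End superlinear.

Unset Implicit Arguments.
Theorem theorem1p2 (R : realType) (N : nat) (f : R -> R) (V : 'rV[R]_N -> R) :
  (2 <= N)%N ->
  (* (f1) f in C^1(R) *)
  ((forall s, derivable f s 1) /\ continuous (derive1 f)) ->
  (* (f2) f(s) = o(1) as s -> 0 *)
  f x @[x --> (0 : R)^'] --> (0 : R) ->
  (* (f3) *)
  (exists c1 c2 p : R, 0 < c1 /\ 0 < c2 /\ 1 <= p /\ p < N%:R / (N%:R - 1) /\
     forall s, `|f s| <= c1 + c2 * `|s| `^ (p - 1)) ->
  (* (f4) *)
  (exists theta : R, 1 < theta /\
     forall s, s != 0 -> 0 < theta * primitive f s /\ theta * primitive f s <= f s * s) ->
  (* (f5) f increasing *)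
  (forall s t, s < t -> f s < f t) ->
  (* (V1) V in L^infty, V0 = inf V > 0 *)
  (exists M : R, forall x, `|V x| <= M) ->
  0 < inf (range V) ->
  (* (V3) *)
  continuous V ->
  (exists Vinf : R,
     (forall e : R, 0 < e -> exists r : R, forall x, r < enorm x -> `|V x - Vinf| < e) /\
     (forall x, V x <= Vinf)) ->
  forall eps : R, 0 < eps ->
    exists u : 'rV[R]_N -> R,
      BV_solution eps V f u /\ iint (fun x => (`|u x|)%:E) != 0%E.
Proof.
move=> _ [df _] f2 _ [theta [th1 AR]] f5 [M VM] V0 cV _ eps eps0.
have cf : continuous f.
  by move=> s; apply: differentiable_continuous; apply/derivable1_diffP; exact: df.
have f0 : f 0 = 0.
  have h : f x @[x --> (0 : R)^'] --> f 0 by exact/continuous_withinNx/cf.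
  exact: (cvg_unique (@Rhausdorff R) h f2).
have V0V x : inf (range V) <= V x.
  apply: ge_inf; last by exists x.
  by exists (- M) => _ [y _ <-]; have := VM y; rewrite ler_norml => /andP[].
have Q := norm_star_energy (continuous_measurable_row cV) V0 V0V VM eps0.
have [E [lam [lam0 [mE iE E0 QE cal]]]] := calibrable_set Q.
have [t t0 ft] := superlinear_onto cf f5 f0 th1 (fun s s0 => (AR s s0).2) lam0.
exists (fun x => t * \1_E x); split.
  exact: (calibrable_solution (continuous_measurable_row cV) V0 V0V VM eps0 t0 f0 ft mE iE lam0).
have iu : intble (leb R N) (fun x => t * \1_E x) := intbleZ t iE.
rewrite iint_integrable; last exact: intble_norm.
rewrite -intbleE; last exact: intble_norm.
under eq_Rintegral do rewrite ger0_norm ?mulr_ge0// ?(ltW t0)//.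
by rewrite (RintegralZl _ measurableT iE) eqe mulf_neq0// lt0r_neq0.
Qed.
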